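(* Let $K\subset S^3$ be a hyperbolic two-bridge knot with exterior $M$ and meridian $\mu$, let $X_K$ be the character variety of irreducible representations $\pi_1(M)\to\mathrm{SL}_2(\mathbb{C})$, and let $\mathrm{tr}_\mu:X_K\to\mathbb{C}$, $\mathrm{tr}_\mu(\chi_\rho)=\mathrm{tr}\,\rho(\mu)$, be the trace function of $\mu$. Then $$\sum_{\chi_\rho\in\mathrm{tr}_\mu^{-1}(c)}\frac{1}{\mathbb{T}_\mu(\chi_\rho)}=0\qquad\text{for generic } c\in\mathbb{C},$$ where $\mathbb{T}_\mu(\chi_\rho)$ is the adjoint Reidemeister torsion.
   Context: ''Generic $c\in\mathbb{C}$'' means all $c$ outside a finite subset of $\mathbb{C}$; for generic $c$ the set $\mathrm{tr}_\mu^{-1}(c)$ is finite and consists of $\mu$-regular characters, so that the torsions are defined. A knot is hyperbolic if its complement in $S^3$ admits a complete hyperbolic metric of finite volume. **Two-bridge knots and $X_K$.** A two-bridge knot is given by a Schubert normal form $(p,q)$, where $p>0$ and $q$ are relatively prime odd integers with $-p<q<p$. It is hyperbolic if $q\ne\pm1$, and is a torus knot of type $(2,n)$ otherwise. One has $\pi_1(M)=\langle g_1,g_2\mid wg_1w^{-1}g_2^{-1}\rangle$ with $w=g_1^{\epsilon_1}g_2^{\epsilon_2}\cdots g_1^{\epsilon_{p-2}}g_2^{\epsilon_{p-1}}$, $\epsilon_i=(-1)^{\lfloor iq/p\rfloor}$, and $g_1$ is a meridian $\mu$. Up to conjugation an irreducible representation has the form $\rho(g_1)=\begin{pmatrix}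 m&1\\0&m^{-1}\end{pmatrix}$, $\rho(g_2)=\begin{pmatrix} m&0\\-u&m^{-1}\end{pmatrix}$ with $m\ne0$, $u\neq0$, $\phi_w(m,u)=0$, where $\phi_w=w_{11}-(m-m^{-1})w_{12}$ and $w_{ij}\in\mathbb{Z}[m^{\pm1},u]$ is the $(i,j)$-entry of $\rho(w)$. Thus $X_K=\{(m,u)\in\mathbb{C}^2:\phi_w(m,u)=0,\ m\ne0,\ u\ne0\}/\!\sim$, where $(m,u)\sim(m^{-1},u)$, and $\mathrm{tr}_\mu=m+m^{-1}$. **Twisted cochains.** Let $\mathfrak{g}=\mathfrak{sl}_2(\mathbb{C})$ with basis $e_1=\begin{pmatrix}0&1\\0&0\end{pmatrix}$, $e_2=\begin{pmatrix}1&0\\0&-1\end{pmatrix}$, $e_3=\begin{pmatrix}0&0\\1&0\end{pmatrix}$ and Killing form $$\left\langle\begin{pmatrix} b&a\\c&-b\end{pmatrix},\begin{pmatrix} b'&a'\\c'&-b'\end{pmatrix}\right\rangle_{\mathfrak{g}}=8bb'+4(ac'+ca').$$ Fix a triangulation of $M$, orient its cells, and let $\widetilde M$ be the universal cover. Set $C^*(M;\mathfrak{g}_\rho)=\mathrm{Hom}_{\mathbb{Z}[\pi_1M]}(C_*(\widetilde M;\mathbb{Z}),\mathfrak{g})$, where $\pi_1(M)$ acts on $\mathfrak{g}$ by $\mathrm{Ad}\circ\rho$; let $\delta^i$ be its coboundary maps and $H^*(M;\mathfrak{g}_\rho)$ its cohomology. Choosing a lift $\widetilde c_j$ of each cell $c_j$,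 let $\mathbf{c}^*$ be the basis $(c_1^1,c_1^2,c_1^3,c_2^1,\dots)$, where $c_j^i$ sends $\widetilde c_j$ to $e_i$ and the other chosen lifts to $0$; $\mathbf{c}^i$ denotes the part in degree $i$. **Regularity.** An irreducible $\rho$ (equivalently $\chi_\rho$) is $\mu$-regular if the restriction map $H^1(M;\mathfrak{g}_\rho)\to H^1(\mu;\mathfrak{g}_\rho)$ is injective (equivalently, the map $H_1(\mu;\mathfrak{g}_\rho)\to H_1(M;\mathfrak{g}_\rho)$ is surjective) and, in case $\mathrm{tr}\,\rho(\pi_1(\partial M))\subset\{\pm2\}$, $\rho(\mu)\ne\pm I$. Then $\dim H^i(M;\mathfrak{g}_\rho)=1$ for $i=1,2$ and $0$ otherwise. **Cohomology bases.** Let $\rho$ be $\mu$-regular and let $P\in\mathfrak{g}$ be nonzero and invariant under $\mathrm{Ad}_{\rho(g)}$ for all $g\in\pi_1(\partial M)$. With orientations of $\mu$ and $\partial M$ fixed once and for all, let $\widetilde\mu\in C_1(\widetilde M;\mathbb{Z})$ and $\widetilde{\partial M}\in C_2(\widetilde M;\mathbb{Z})$ be chains that are lifts of $\mu$ and of (the sum of the oriented 2-cells of) $\partial M$ with the same base point, lying in the component of the preimage of $\partial M$ stabilized by $\pi_1(\partial M)$. Then $F_1(x)=\langle P,x(\widetilde\mu)\rangle_{\mathfrak g}$ and $F_2(x)=\langle P,x(\widetilde{\partial M})\rangle_{\mathfrak g}$ define isomorphisms $F_i:H^i(M;\mathfrak{g}_\rho)\to\mathbb{C}$, and $\mathbf{h}^i$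 is the basis of $H^i(M;\mathfrak{g}_\rho)$ with $F_i(\mathbf{h}^i)=1$, $i=1,2$. **Adjoint torsion.** For each $i$ choose a sequence $b^i$ in $C^i(M;\mathfrak g_\rho)$ such that $\delta^i(b^i)$ is a basis of $\mathrm{Im}\,\delta^i$ and a representative $\widetilde{\mathbf h}^i$ of $\mathbf{h}^i$, and put $$\mathrm{tor}(C^*(M;\mathfrak g_\rho),\mathbf c^*,\mathbf h^* )=\prod_i\big[(\delta^{i-1}(b^{i-1}),\widetilde{\mathbf h}^i,b^i)/\mathbf c^i\big]^{(-1)^i},$$ where $[x/y]$ is the determinant of the transition matrix sending the basis $y$ to the basis $x$. The adjoint Reidemeister torsion is $\mathbb{T}_\mu(\rho)=\epsilon\cdot\mathrm{tor}(C^*(M;\mathfrak g_\rho),\mathbf c^*,\mathbf h^* )\in\mathbb{C}^*$, where $\epsilon\in\{\pm1\}$ is given by Turaev's sign trick: fixing a homology orientation of $M$ (an orientation of $H^*(M;\mathbb{R})$), $\epsilon=(-1)^{|C^*(M;\mathfrak g_\rho)|}\,\mathrm{sgn}\big((-1)^{|C^*(M;\mathbb{R})|}\mathrm{tor}(C^*(M;\mathbb{R}),c^*,h^* )\big)$, with $c^*$ the basis dual to the oriented cells in the same order, $h^*$ a positively oriented basis of $H^*(M;\mathbb{R})$, and $|C^*|=\sum_j\big(\sum_{i\le j}\dim C^i\big)\big(\sum_{i\le j}\dim H^i\big)$. Thus $\epsilon$ does not depend on the choice of $\mu$-regular $\rho$. $\mathbb{T}_\mu(\rho)$ depends only on the conjugacy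 class of $\rho$, equivalently on $\chi_\rho$, and is written $\mathbb{T}_\mu(\chi_\rho)$. It may be computed with the 2-complex of the presentation in place of $M$. *)

(* Defs.v *)
From HB Require Import structures.
From mathcomp Require Import all_boot all_order all_algebra.
From mathcomp Require Import all_classical all_reals.
From mathcomp Require Import complex.
From mathcomp Require Import zify ring.

Set Implicit Arguments.
Unset Strict Implicit.
Unset Printing Implicit Defensive.

Import Order.TTheory GRing.Theory Num.Theory.

Local Open Scope classical_set_scope.
Local Open Scope ring_scope.

(* A letter (j, b) is the generator g_(j+1) if b = false and its inverse if
   b = true.  Words stand for the elements of pi_1 and, at the same time, for
   edge paths in the 2-complex of the presentation. *)
Definition word := seq ('I_2 * bool).

Definition g1 : 'I_2 * bool := (0, false).
Definition g2 : 'I_2 * bool := (1, false).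

Definition winv (v : word) : word := rev [seq (a.1, ~~ a.2) | a <- v].

Definition wexp (v : word) (n : int) : word :=
  match n with
  | Posz k => flatten (nseq k v)
  | Negz k => flatten (nseq k.+1 (winv v))
  end.

Section TwoBridge.

Variables (p : nat) (q : int).

Definition schubert_normal_form : Prop :=
  [/\ (0 < p)%N, odd p, odd `|q|%N, coprime p `|q|%N & (- p%:Z < q < p%:Z)].

Definition hyperbolic_two_bridge : Prop :=
  [/\ schubert_normal_form, q != 1 & q != -1].

(* epsilon_i = (-1)^(floor (i q / p)); divz rounds down since p > 0. *)
Definition eps_neg (i : nat) : bool := odd `|((i%:Z * q) %/ p%:Z)%Z|%N.

Definition wK : word :=
  [seq ((if odd i then 0 else 1) : 'I_2, eps_neg i) | i <- iota 1 p.-1].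

Definition relator : word := wK ++ [:: g1] ++ winv wK ++ winv [:: g2].

(* rev wK is the word w read backwards with exponents unchanged; since
   epsilon_i = epsilon_(p-i), it is also w with g1 and g2 exchanged.  In pi_1
   it satisfies (rev w) g2 (rev w)^-1 = g1, as expressed by dual_relator, so
   that (rev w) w commutes with g1. *)
Definition dual_relator : word :=
  rev wK ++ [:: g2] ++ winv (rev wK) ++ winv [:: g1].

Definition longitude : word :=
  rev wK ++ wK ++ wexp [:: g1] (- (2 * \sum_(a <- wK) (-1) ^+ a.2)).

(* The elements of pi_1(boundary) = <mu> x <lambda>. *)
Definition peripheral (a b : int) : word :=
  wexp [:: g1] a ++ wexp longitude b.

(* dual_relator is the inverse of a rotation of relator: with
   relator = v' ++ v and v' of length torus_rot, dual_relator is freely equal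
   to v relator^-1 v^-1 (see torus_rotP). *)
Definition torus_rot : nat :=
  find (fun k => winv (rot k relator) == dual_relator) (iota 0 p.*2).

(* A cellular 2-chain of the universal cover, as a formal combination of the
   translates of the lifted 2-cell whose boundary path is relator. *)
Definition chain2 := seq (int * word).

(* The lift of the boundary torus.  Its 2-cell is attached along the
   commutator of longitude and g1, which is freely equal to
     (rev w) w g1 ((rev w) w)^-1 g1^-1
       = ((rev w) relator (rev w)^-1) dual_relator
       = ((rev w) relator (rev w)^-1) (v relator^-1 v^-1). *)
Definition torus_chain : chain2 :=
  [:: (1, rev wK); (-1, drop torus_rot relator)].

End TwoBridge.

Lemma floorE (p : nat) (x k : int) : (0 < p)%N ->
  k * p%:Z <= x -> x < (k + 1) * p%:Z -> (x %/ p%:Z)%Z = k.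
Proof.
move=> p0 h1 h2.
have e := divz_eq x p%:Z.
have r0 : 0 <= (x %% p%:Z)%Z by apply: modz_ge0; lia.
have r1 : (x %% p%:Z)%Z < p%:Z by apply: ltz_pmod; lia.
set d := (x %/ p%:Z)%Z in e *; set r := (x %% p%:Z)%Z in e r0 r1 *.
nia.
Qed.

Lemma floor_bounds (p : nat) (x : int) : (0 < p)%N ->
  (x %/ p%:Z)%Z * p%:Z <= x < ((x %/ p%:Z)%Z + 1) * p%:Z.
Proof.
move=> p0; have e := divz_eq x p%:Z.
have r0 : 0 <= (x %% p%:Z)%Z by apply: modz_ge0; lia.
have r1 : (x %% p%:Z)%Z < p%:Z by apply: ltz_pmod; lia.
by rewrite mulrDl mul1r; lia.
Qed.

Lemma floorN (p : nat) (x : int) : (0 < p)%N ->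
  ((- x - 1) %/ p%:Z)%Z = - (x %/ p%:Z)%Z - 1.
Proof.
move=> p0; have /andP[] := floor_bounds x p0.
set d := (x %/ p%:Z)%Z => h1 h2; apply: floorE => //; nia.
Qed.

Section TorusRot.

Variables (p : nat) (q : int).
Hypothesis pq : schubert_normal_form p q.

Let sg (i : nat) : bool := odd `|((i.+1%:Z * q - 1) %/ p%:Z)%Z|%N.

Let p0 : (0 < p)%N. Proof. by case: pq. Qed.
Let op : odd p. Proof. by case: pq. Qed.
Let oq : odd `|q|%N. Proof. by case: pq. Qed.

Lemma floor_pred i : (0 < i < p)%N ->
  ((i%:Z * q - 1) %/ p%:Z)%Z = ((i%:Z * q) %/ p%:Z)%Z.
Proof.
move=> /andP[i0 ip].
have /andP[h1 h2] := floor_bounds (i%:Z * q) p0.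
set d := (_ %/ _)%Z in h1 h2 *.
suff ne : d * p%:Z != i%:Z * q by apply: floorE => //; lia.
apply/eqP => e.
have : (p %| i * `|q|)%N.
  have : (p%:Z %| i%:Z * q)%Z by rewrite -e dvdz_mull.
  by rewrite dvdzE abszM.
rewrite Gauss_dvdl; last by case: pq.
by move=> /(dvdn_leq i0); lia.
Qed.

Lemma sg_wK i : (i < p.-1)%N -> sg i = eps_neg p q i.+1.
Proof. by move=> h; rewrite /sg floor_pred //; lia. Qed.

Lemma sg_p : sg p.-1 = false.
Proof.
rewrite /sg prednK // (@floorE _ _ (q - 1)) //; [lia| nia | nia].
Qed.

Lemma sg_refl i : (i < p.*2)%N -> sg (p.*2 - i.+1)%N = ~~ odd `|((i%:Z * q) %/ p%:Z)%Z|%N.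
Proof.
move=> ip; rewrite /sg.
have -> : (p.*2 - i.+1).+1%:Z * q - 1 = (- (i%:Z * q) - 1) + (2 * q) * p%:Z.
  have -> : (p.*2 - i.+1).+1%:Z = 2 * p%:Z - i%:Z by lia.
  ring.
rewrite addrC divzMDl; last lia.
rewrite floorN //; lia.
Qed.

Lemma size_wK : size (wK p q) = p.-1.
Proof. by rewrite size_map size_iota. Qed.

Lemma nth_wK i : (i < p.-1)%N ->
  nth g1 (wK p q) i = ((if odd i then 1 else 0) : 'I_2, sg i).
Proof.
move=> h; rewrite (nth_map 0%N) ?size_iota // nth_iota // sg_wK // add1n /=.
by case: odd.
Qed.

Lemma size_winv v : size (winv v) = size v.
Proof. by rewrite size_rev size_map. Qed.

Lemma nth_winv v i : (i < size v)%N ->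
  nth g1 (winv v) i = ((nth g1 v (size v - i.+1)%N).1, ~~ (nth g1 v (size v - i.+1)%N).2).
Proof.
move=> h; rewrite nth_rev ?size_map // (nth_map g1) //; lia.
Qed.

Lemma sg_neg i : (i < p.-1)%N -> ~~ sg (p.-1 - i.+1)%N = sg (p + i)%N.
Proof.
move=> h.
have -> : (p + i)%N = (p.*2 - (p.-1 - i.+1).+1.+1)%N by lia.
rewrite sg_refl; last lia.
by rewrite sg_wK //; lia.
Qed.

Lemma eps_sym i : (i < p.-1)%N -> sg (p.-1 - i.+1)%N = sg i.
Proof.
move=> h; apply: negb_inj; rewrite sg_neg // /sg.
have -> : (p + i).+1%:Z * q - 1 = (i.+1%:Z * q - 1) + q * p%:Z.
  have -> : (p + i).+1%:Z = p%:Z + i.+1%:Z by lia.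
  ring.
rewrite addrC divzMDl; lia.
Qed.

Lemma nth_rev_wK i : (i < p.-1)%N ->
  nth g1 (rev (wK p q)) i = ((if odd i then 0 else 1) : 'I_2, sg i).
Proof.
move=> h; rewrite nth_rev size_wK // nth_wK; last lia.
rewrite eps_sym //; congr (_, _).
have -> : odd (p.-1 - i.+1) = ~~ odd i by lia.
by case: odd.
Qed.

Lemma word_nth (a : 'I_2) (v : word) i : size v = p.-1 ->
  (forall i, (i < p.-1)%N -> nth g1 v i = ((if odd i then 1 - a else a), sg i)) ->
  (i < p.*2)%N ->
  nth g1 (v ++ [:: (a, false)] ++ winv v ++ [:: (1 - a, true)]) i =
    ((if odd i then 1 - a else a), sg i).
Proof.
move=> sv nv ip.
rewrite !nth_cat !size_winv sv /=.
case: ltnP => h1; first exact: nv.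
case: ltnP => h2.
  have -> : i = p.-1 by lia.
  by rewrite subnn /= sg_p; have -> : odd p.-1 = false by lia.
case: ltnP => h3.
  rewrite nth_winv ?sv // nv /=; last lia.
  rewrite sg_neg //; congr (_, sg _); last lia.
  by congr (if _ then _ else _); lia.
have -> : i = p.*2.-1 by lia.
have -> : (p.*2.-1 - p.-1 - 1 - p.-1 = 0)%N by lia.
have -> : odd p.*2.-1 by lia.
have -> : p.*2.-1 = (p.*2 - 1)%N by lia.
by rewrite sg_refl ?mul0r ?div0z //; lia.
Qed.

Lemma nth_relator i : (i < p.*2)%N ->
  nth g1 (relator p q) i = ((if odd i then 1 else 0) : 'I_2, sg i).
Proof.
move=> h.
have := @word_nth 0 (wK p q) i; rewrite subr0; apply=> //.
  exact: size_wK.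
exact: nth_wK.
Qed.

Lemma nth_dual i : (i < p.*2)%N ->
  nth g1 (dual_relator p q) i = ((if odd i then 0 else 1) : 'I_2, sg i).
Proof.
move=> h.
have := @word_nth 1 (rev (wK p q)) i; rewrite subrr; apply=> //.
  by rewrite size_rev size_wK.
exact: nth_rev_wK.
Qed.

Lemma torus_rotP : winv (rot (torus_rot p q) (relator p q)) = dual_relator p q.
Proof.
have sz : size (relator p q) = p.*2.
  by rewrite !size_cat size_winv size_wK /=; lia.
have sz' : size (dual_relator p q) = p.*2.
  by rewrite !size_cat size_winv size_rev size_wK /=; lia.
suff h : has (fun k => winv (rot k (relator p q)) == dual_relator p q)
    (iota 0 p.*2).
  move: (nth_find 0%N h) => /eqP; rewrite nth_iota ?add0n //.
  by move: h; rewrite has_find size_iota.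
have [k [t [k0 kp ek]]] : exists k : nat, exists t : int,
    [/\ (0 < k)%N, (k < p.*2)%N & k%:Z * q = 1 + 2 * p%:Z * t].
  have cop : coprimez q (p.*2)%:Z.
    rewrite coprimezE /= -muln2 coprimeMr coprimen2 oq andbT.
    by rewrite coprime_sym; case: pq.
  have [[u v] /= e] := coprimezP _ _ cop.
  have um := divz_eq u (p.*2)%:Z.
  have m0 : 0 <= (u %% (p.*2)%:Z)%Z by apply: modz_ge0; lia.
  have m1 : (u %% (p.*2)%:Z)%Z < (p.*2)%:Z by apply: ltz_pmod; lia.
  set d := (u %/ _)%Z in um *; set m := (u %% _)%Z in um m0 m1 *; clearbody d m.
  have E : m * q = 1 + 2 * p%:Z * (- v - d * q).
    have -> : m = u - d * (p.*2)%:Z by lia.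
    have -> : (p.*2)%:Z = 2 * p%:Z by lia.
    have e' : u * q = 1 - v * (2 * p%:Z) by lia.
    by rewrite mulrBl e'; ring.
  exists `|m|%N, (- v - d * q); split.
  - have m00 : m != 0 by apply/eqP => m00; move: E; rewrite m00 mul0r; lia.
    by lia.
  - by lia.
  - by rewrite gez0_abs.
have ok : odd k.
  have : odd (absz (k%:Z * q)) by rewrite ek; lia.
  by rewrite abszM oddM => /andP[].
apply/hasP; exists k.-1; first by rewrite mem_iota; lia.
apply/eqP; apply: (@eq_from_nth _ g1) => [|i].
  by rewrite size_winv size_rot sz sz'.
rewrite size_winv size_rot sz => ip.
rewrite nth_winv size_rot sz // nth_dual //.
have -> : nth g1 (rot k.-1 (relator p q)) (p.*2 - i.+1) =
   ((if odd i then 0 else 1) : 'I_2, ~~ sg i).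
  rewrite /rot nth_cat size_drop sz.
  have ek' : forall j : nat, forall s : int,
     j.+1%:Z = k%:Z - i.+1%:Z + 2 * s * p%:Z -> sg j = ~~ sg i.
    move=> j s ej; rewrite /sg ej.
    have -> : (k%:Z - i.+1%:Z + 2 * s * p%:Z) * q - 1 =
       (- (i.+1%:Z * q - 1) - 1) + (2 * (t + s * q)) * p%:Z.
      have -> : (k%:Z - i.+1%:Z + 2 * s * p%:Z) * q =
        k%:Z * q + (2 * s * p%:Z - i.+1%:Z) * q by ring.
      by rewrite ek; ring.
    rewrite addrC divzMDl; last lia.
    rewrite floorN //; lia.
  case: ltnP => h.
    rewrite nth_drop nth_relator; last lia.
    rewrite (ek' _ 1); last lia.
    by have -> : odd (k.-1 + (p.*2 - i.+1)) = ~~ odd i by [lia]; case: odd.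
  rewrite nth_take; last lia.
  rewrite nth_relator; last lia.
  rewrite (ek' _ 0); last lia.
  by have -> : odd (p.*2 - i.+1 - (p.*2 - k.-1)) = ~~ odd i by [lia]; case: odd.
by rewrite /= negbK.
Qed.

End TorusRot.

(* Cochains of the 2-complex of <g1, g2 | r> with coefficients in F^d.  The
   universal cover has one orbit of 0-cells, two of 1-cells (lifts of g1, g2)
   and one of 2-cells (the lift of the cell bounded by r), all lifts being
   based at one fixed 0-cell.  An equivariant cochain is given by its values
   on these lifts, stored as the rows of a matrix; act v is the action of the
   group element v on the coefficients. *)
Section Cochains.

Variables (F : fieldType) (d : nat).
Variable act : word -> {linear 'rV[F]_d -> 'rV[F]_d}.
Variable r : word.

Definition cells (i : nat) : nat :=
  match i with 0%N => 1%N | 1%N => 2%N | 2%N => 1%N | _ => 0%N end.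

Definition cochain (i : nat) := 'M[F]_(cells i, d).

(* Value of a 1-cochain on the lift of the edge path v that starts at the
   base 0-cell.  The lift of g_j^-1 is minus the translate by g_j^-1 of the
   lift of g_j, and the rest of the path is translated by its first letter. *)
Fixpoint eval1 (v : word) (x : cochain 1) : 'rV[F]_d :=
  match v with
  | [::] => 0
  | a :: v' =>
    (if a.2 then - act [:: a] (row a.1 x) else row a.1 x)
    + act [:: a] (eval1 v' x)
  end.

Definition eval2 (D : chain2) (x : cochain 2) : 'rV[F]_d :=
  \sum_(t <- D) act t.2 (row 0 x) *~ t.1.

Definition coboundary (i : nat) : cochain i -> cochain i.+1 :=
  match i return cochain i -> cochain i.+1 with
  | 0%N => fun x => \matrix_(j < 2) (act [:: (j, false)] (row 0 x) - row 0 x)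
  | 1%N => fun x => \matrix_(j < 1) eval1 r x
  | _ => fun=> 0
  end.

Fact eval1_linear v : linear (eval1 v).
Proof.
elim: v => [|[j b] v IH] k x y /=; first by rewrite scaler0 addr0.
by rewrite IH !linearP scalerDr; case: b; rewrite ?linearP addrACA.
Qed.

Fact coboundary_linear i : linear (@coboundary i).
Proof.
case: i => [|[|i]] k x y /=.
- by apply/matrixP => j l; rewrite mxE !linearD !linearZ !mxE; ring.
- by apply/matrixP => j l; rewrite mxE eval1_linear !mxE.
- by rewrite scaler0 addr0.
Qed.

HB.instance Definition _ i :=
  GRing.isLinear.Build F (cochain i) (cochain i.+1) *:%R (@coboundary i)
    (@coboundary_linear i).

Definition delta (i : nat) : 'Hom(cochain i, cochain i.+1) :=
  linfun (@coboundary i).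

Definition cocycles (i : nat) : {vspace cochain i} := lker (delta i).

Definition coboundaries (i : nat) : {vspace cochain i} :=
  match i with 0%N => 0%VS | j.+1 => limg (delta j) end.

Definition dimH (i : nat) : nat := (\dim (cocycles i) - \dim (coboundaries i))%N.

(* h i consists of cocycles representing a basis of H^i. *)
Definition cohomology_basis (h : forall i, seq (cochain i)) : Prop :=
  forall i, basis_of (cocycles i) (vbasis (coboundaries i) ++ h i).

Definition delta_prev (b : forall i, seq (cochain i)) (i : nat) :
    seq (cochain i) :=
  match i with 0%N => [::] | j.+1 => [seq delta j x | x <- b j] end.

(* [s / c^i], where c^i is the basis (c_1^1, ..., c_1^d, c_2^1, ...) in which
   mxvec computes coordinates. *)
Definition transition_det (i : nat) (s : seq (cochain i)) : F :=
  \det (\matrix_(k < cells i * d) mxvec s`_k).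

Definition is_tor (h : forall i, seq (cochain i)) (t : F) : Prop :=
  exists b : forall i, seq (cochain i),
    (forall i, basis_of (limg (delta i)) [seq delta i x | x <- b i]) /\
    t = \prod_(i < 3) transition_det (delta_prev b i ++ h i ++ b i)
                      ^ ((-1) ^+ i : int).

(* The integer |C^*| of Turaev's sign. *)
Definition tor_parity : nat :=
  \sum_(j < 3) ((\sum_(i < j.+1) \dim {: cochain i})
                * (\sum_(i < j.+1) dimH i))%N.

End Cochains.

Section AdjointTorsion.

Variable R : realType.
Local Notation C := R[i].

(* The matrix (b a; c -b) of sl_2(C) is stored as the row (a, b, c) of its
   coordinates in the basis e_1, e_2, e_3. *)
Definition sl2mx (x : 'rV[C]_3) : 'M[C]_2 :=
  \matrix_(i < 2, j < 2)
    if i == 0 then if j == 0 then x 0 1 else x 0 0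
    else if j == 0 then x 0 2 else - x 0 1.

Definition sl2rv (A : 'M[C]_2) : 'rV[C]_3 :=
  \row_(k < 3) if k == 0 then A 0 1 else if k == 1 then A 0 0 else A 1 0.

Definition killing (x y : 'rV[C]_3) : C :=
  8 * (x 0 1 * y 0 1) + 4 * (x 0 0 * y 0 2 + x 0 2 * y 0 0).

Definition rep := 'I_2 -> 'M[C]_2.

Definition reval (rho : rep) (v : word) : 'M[C]_2 :=
  \prod_(a <- v) (if a.2 then (rho a.1)^-1 else rho a.1).

Definition Ad (rho : rep) (v : word) (x : 'rV[C]_3) : 'rV[C]_3 :=
  sl2rv (reval rho v * sl2mx x * (reval rho v)^-1).

Fact Ad_linear rho v : linear (Ad rho v).
Proof.
move=> k x y; rewrite /Ad.
have -> : sl2mx (k *: x + y) = k *: sl2mx x + sl2mx y.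
  apply/matrixP => i j; rewrite !mxE.
  by case: ifP => _; case: ifP => _; rewrite // mulrN opprD.
rewrite mulrDr mulrDl -scalerAr -scalerAl.
by apply/rowP => l; rewrite !mxE; case: ifP => _ //; case: ifP.
Qed.

HB.instance Definition _ rho v :=
  GRing.isLinear.Build C 'rV[C]_3 'rV[C]_3 *:%R (Ad rho v) (Ad_linear rho v).

Definition adjoint_action (rho : rep) (v : word) :
  {linear 'rV[C]_3 -> 'rV[C]_3} := Ad rho v.

Definition trivial_action (v : word) : {linear 'rV[R]_1 -> 'rV[R]_1} := idfun.

Section Knot.

Variables (p : nat) (q : int).

Definition is_rep (rho : rep) : Prop :=
  (forall j, \det (rho j) = 1) /\ reval rho (relator p q) = 1.

Definition irreducible (rho : rep) : Prop :=
  forall U : {vspace 'cV[C]_2},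
    (forall (v : word) (x : 'cV[C]_2), x \in U -> reval rho v *m x \in U) ->
    U = 0%VS \/ U = fullv.

(* The words exhaust pi_1, so equality of characters as functions of words is
   equality as functions on pi_1. *)
Definition character (rho : rep) : word -> C := fun v => \tr (reval rho v).

Definition XK : set (word -> C) :=
  [set chi | exists rho, [/\ is_rep rho, irreducible rho
                           & chi = character rho]].

Definition tr_mu (chi : word -> C) : C := chi [:: g1].

Definition fibre (c : C) : set (word -> C) := XK `&` tr_mu @^-1` [set c].

(* The kernel of H^1(M) -> H^1(mu) vanishes: a cocycle whose value on the lift
   of mu = g1 is a coboundary of the circle mu is a coboundary. *)
Definition restriction_mu_injective (rho : rep) : Prop :=
  forall x : cochain C 3 1,
    x \in cocycles (adjoint_action rho) (relator p q) 1 ->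
    (exists y : 'rV[C]_3,
       eval1 (adjoint_action rho) [:: g1] x = Ad rho [:: g1] y - y) ->
    x \in coboundaries (adjoint_action rho) (relator p q) 1.

Definition mu_regular (rho : rep) : Prop :=
  [/\ is_rep rho, irreducible rho, restriction_mu_injective rho
    & (forall a b : int, character rho (peripheral p q a b) = 2 \/
                         character rho (peripheral p q a b) = -2) ->
      reval rho [:: g1] <> 1 /\ reval rho [:: g1] <> -1].

(* An orientation of H^*(M; R) enters through a positively oriented basis. *)
Definition homology_orientation (hR : forall i, seq (cochain R 1 i)) : Prop :=
  cohomology_basis trivial_action (relator p q) hR.

(* Turaev's sign epsilon. *)
Definition is_sign (hR : forall i, seq (cochain R 1 i)) (rho : rep) (e : R) :
    Prop :=
  exists2 t : R, is_tor trivial_action (relator p q) hR t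
  & e = (-1) ^+ tor_parity (adjoint_action rho) (relator p q)
        * Num.sg ((-1) ^+ tor_parity trivial_action (relator p q) * t).

Definition hseq (x1 : cochain C 3 1) (x2 : cochain C 3 2) (i : nat) :
    seq (cochain C 3 i) :=
  match i with 1%N => [:: x1] | 2%N => [:: x2] | _ => [::] end.

(* P is the invariant vector; x1 and x2 represent h^1 and h^2. *)
Definition is_adjoint_torsion (hR : forall i, seq (cochain R 1 i)) (rho : rep)
    (t : C) : Prop :=
  exists (P : 'rV[C]_3) (x1 : cochain C 3 1) (x2 : cochain C 3 2) (e : R)
         (t0 : C),
  [/\ P != 0 /\ (forall a b : int, Ad rho (peripheral p q a b) P = P),
      cohomology_basis (adjoint_action rho) (relator p q) (hseq x1 x2),
      killing P (eval1 (adjoint_action rho) [:: g1] x1) = 1 /\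
      killing P (eval2 (adjoint_action rho) (torus_chain p q) x2) = 1,
      is_sign hR rho e /\
      is_tor (adjoint_action rho) (relator p q) (hseq x1 x2) t0
    & t = real_complex R e * t0].

(* The value at a mu-regular character; it is 0, a value no torsion takes, at
   characters where the torsion is not defined. *)
Definition adjoint_torsion (hR : forall i, seq (cochain R 1 i))
    (chi : word -> C) : C :=
  xget 0 [set t | exists rho, [/\ mu_regular rho, chi = character rho
                                & is_adjoint_torsion hR rho t]].

End Knot.
End AdjointTorsion.

(* Main.v *)
From HB Require Import structures.
Require Import Defs.
From mathcomp Require Import all_boot all_order all_algebra.
From mathcomp Require Import all_classical all_reals.
From mathcomp Require Import complex.
From mathcomp Require Import zify ring.
From mathcomp Require separable.

(** Fix the trace 2m of the meridian.  An irreducible representation with this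
    trace is a pair g1 = m + S + N, g2 = m + S - N, where S and N are traceless
    and anticommute, S^2 = s, N^2 = u and s + u = m^2 - 1.  Up to conjugation it
    depends on the number u alone, and words in g1 and g2 are quaternions in the
    basis 1, S, N, S N whose coefficients are polynomials in u.  The knot word w
    read backwards is w with g1 and g2 exchanged; therefore w g1 - g2 w is
    2 phi(u) N for one polynomial phi, the Riley polynomial, of degree (p - 1) / 2
    ([riley_eq]).  The fibre over 2m is the set of roots of phi ([fibreE]).

    The inverse torsion is a residue.  Moving u with m fixed gives a 1-cochain
    along which the relator varies by 2 phi'(u) Y, where Y = N w^-1 g2^-1
    ([fox_tangent_relator]).  The boundary torus consists of two 2-cells, which
    are attached at the meridian g2 and at a conjugate g3 of g1 by a suffix of the
    relator, so that a class in degree 2 is measured by its pairing with g2 - g3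
    ([killing_torus]).  The same two attachments show that the coboundary of
    every cochain that preserves the traces of the meridians is orthogonal to g2
    and g3; hence Y is, and [g2, g3] = f Y for a scalar f.  Computing the
    determinants of the three degrees in the frame S, N, S N, all other factors
    cancel and f T = K phi'(u), where K is the same for all representations
    ([tor_ref_lift], [torsion_value]).

    The scalar f is a polynomial F in u, so that up to a constant the inverse
    torsions are the residues of F / phi at the simple roots of phi.  Their sum
    vanishes as soon as deg F <= deg phi - 2 ([sum_residues]), and everything
    depends on this bound.  It holds because the knot is not a torus knot: then
    the knot word has a nonempty prefix whose signs are antisymmetric and which
    conjugates g1 to g3 or to g2^-1 g3 g2, and moving N across this prefix
    shortens the word that computes f ([torus_rot_split], [tr_split], [torus_poly]).

    Generic means that phi has degree (p - 1) / 2, has no double root, and does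
    not vanish at u = 0 and u = m^2 - 1, and that m^2 <> 1.  These are open
    conditions on m, and they hold at m = 0, where phi is up to sign a polynomial
    of Chebyshev type ([riley_generic]).  The roots u = 0 and u = m^2 - 1 are
    those at which N or S is not invertible; away from them the representation is
    irreducible, and the simplicity of the root gives the regularity with respect
    to the meridian ([generic_irreducible], [restriction_injective]). *)

Set Implicit Arguments.
Unset Strict Implicit.
Unset Printing Implicit Defensive.

Import Order.TTheory GRing.Theory Num.Theory.

Local Open Scope classical_set_scope.
Local Open Scope ring_scope.

(** * Two-by-two matrices *)

Section Matrix2.

Variable F : fieldType.
Implicit Types A B : 'M[F]_2.

Lemma ord2P (i : 'I_2) : i = 0 \/ i = 1.
Proof. by case: i => [[|[|//]] hi]; [left | right]; apply: val_inj. Qed.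

Lemma mx2P A B : A 0 0 = B 0 0 -> A 0 1 = B 0 1 -> A 1 0 = B 1 0 ->
  A 1 1 = B 1 1 -> A = B.
Proof.
move=> h00 h01 h10 h11; apply/matrixP => i j.
by case: (ord2P i) => ->; case: (ord2P j) => ->.
Qed.

Lemma sum2E (f : 'I_2 -> F) : \sum_i f i = f 0 + f 1.
Proof.
rewrite big_ord_recl big_ord1; congr (f _ + f _).
by apply: val_inj.
Qed.

Lemma mulmx2E A B i j : (A * B) i j = A i 0 * B 0 j + A i 1 * B 1 j.
Proof. by rewrite mxE sum2E. Qed.

Lemma det2E A : \det A = A 0 0 * A 1 1 - A 0 1 * A 1 0.
Proof.
rewrite (expand_det_row _ 0) sum2E /cofactor !det_mx11 !mxE /= !expr1 expr0.
rewrite mul1r mulN1r mulrN.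
by congr (_ * A _ _ - _ * A _ _); apply: val_inj.
Qed.

Lemma trmx2E A : \tr A = A 0 0 + A 1 1.
Proof. exact: sum2E. Qed.

Lemma mx2_unit A : \det A = 1 -> A \is a GRing.unit.
Proof.
move=> dA; have uA : A \in unitmx by rewrite unitmxE dA unitr1.
exact: uA.
Qed.

(** Cayley-Hamilton. *)
Lemma mx2_inv A : \det A = 1 -> A^-1 = (\tr A)%:M - A.
Proof.
move=> dA; apply: (mulrI (mx2_unit dA)); rewrite mulrV ?mx2_unit //.
move: dA; rewrite det2E trmx2E => dA.
apply: mx2P; rewrite mulmx2E !mxE /= ?mulr1n ?mulr0n -?dA; ring.
Qed.

End Matrix2.

(** * Variations of words along 1-cochains *)

Section UnitRingIdentities.

Variable T : unitRingType.
Implicit Types g h x y : T.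

Lemma leibniz_inv g h x y : g \is a GRing.unit -> h \is a GRing.unit ->
  - (h^-1 * y * h^-1) * g^-1 + h^-1 * - (g^-1 * x * g^-1) =
  - ((g * h)^-1 * (x * h + g * y) * (g * h)^-1).
Proof.
move=> ug uh; rewrite invrM // !mulrDr !mulrDl !mulNr !mulrN -opprD.
congr (- _); rewrite addrC !mulrA; congr (_ + _).
  by rewrite mulrK.
by rewrite mulrVK.
Qed.

Lemma conj_mulr g h x : g \is a GRing.unit -> h \is a GRing.unit ->
  g * h * x * (g * h)^-1 = g * (h * x * h^-1) * g^-1.
Proof. by move=> ug uh; rewrite invrM // !mulrA. Qed.

Lemma inv_conjK g x : g \is a GRing.unit -> - (g * - (g^-1 * x * g^-1) * g) = x.
Proof.
by move=> ug; rewrite mulrN mulNr opprK !mulrA mulrV // mul1r mulrVK.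
Qed.

End UnitRingIdentities.

Section FoxCalculus.

Variable R : realType.
Local Notation C := R[i].

Section Sl2.

Implicit Types (x y : 'rV[C]_3) (A B : 'M[C]_2).

Lemma sl2mxE x : (sl2mx x 0 0 = x 0 1) * (sl2mx x 0 1 = x 0 0) *
  (sl2mx x 1 0 = x 0 2) * (sl2mx x 1 1 = - x 0 1).
Proof. by rewrite !mxE. Qed.

Lemma ord3P (i : 'I_3) : [\/ i = 0, i = 1 | i = 2].
Proof.
by case: i => [[|[|[|//]]] hi]; [apply: Or31 | apply: Or32 | apply: Or33];
  apply: val_inj.
Qed.

Lemma row3P x y : x 0 0 = y 0 0 -> x 0 1 = y 0 1 -> x 0 2 = y 0 2 -> x = y.
Proof.
by move=> h0 h1 h2; apply/rowP => i; case: (ord3P i) => ->.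
Qed.

Lemma sl2rvE A : (sl2rv A 0 0 = A 0 1) * (sl2rv A 0 1 = A 0 0) *
  (sl2rv A 0 2 = A 1 0).
Proof. by rewrite !mxE. Qed.

Lemma sl2rvK : cancel (@sl2mx R) (@sl2rv R).
Proof. by move=> x; apply: row3P; rewrite sl2rvE sl2mxE. Qed.

Lemma sl2mxK A : \tr A = 0 -> sl2mx (sl2rv A) = A.
Proof.
rewrite trmx2E => /eqP; rewrite addrC addr_eq0 => /eqP tA.
by apply: mx2P; rewrite sl2mxE sl2rvE // tA.
Qed.

Lemma sl2mx_tr x : \tr (sl2mx x) = 0.
Proof. by rewrite trmx2E !sl2mxE subrr. Qed.

Fact sl2mx_linear : linear (@sl2mx R).
Proof.
by move=> k x y; apply: mx2P; rewrite !(sl2mxE, mxE) //= opprD mulrN.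
Qed.

HB.instance Definition _ := GRing.isLinear.Build C 'rV[C]_3 'M[C]_2 *:%R
  (@sl2mx R) sl2mx_linear.

Fact sl2rv_linear : linear (@sl2rv R).
Proof. by move=> k A B; apply: row3P; rewrite !(sl2rvE, mxE). Qed.

HB.instance Definition _ := GRing.isLinear.Build C 'M[C]_2 'rV[C]_3 *:%R
  (@sl2rv R) sl2rv_linear.

Lemma killingE x y : killing x y = 4 * \tr (sl2mx x * sl2mx y).
Proof. rewrite trmx2E !mulmx2E !sl2mxE /killing; ring. Qed.

Lemma killingBr x y z : killing x (y - z) = killing x y - killing x z.
Proof. by rewrite /killing !mxE; ring. Qed.

End Sl2.

Variable rho : rep R.
Hypothesis det_rho : forall j, \det (rho j) = 1.

Local Notation D := (eval1 (adjoint_action rho)).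

Lemma reval_nil : reval rho [::] = 1.
Proof. exact: big_nil. Qed.

Lemma reval_cons a v :
  reval rho (a :: v) = (if a.2 then (rho a.1)^-1 else rho a.1) * reval rho v.
Proof. exact: big_cons. Qed.

Lemma reval1 a : reval rho [:: a] = if a.2 then (rho a.1)^-1 else rho a.1.
Proof. by rewrite reval_cons reval_nil mulr1. Qed.

Lemma reval_cat v1 v2 : reval rho (v1 ++ v2) = reval rho v1 * reval rho v2.
Proof. exact: big_cat. Qed.

Lemma rho_unit j : rho j \is a GRing.unit.
Proof. exact: mx2_unit. Qed.

Lemma reval_unit v : reval rho v \is a GRing.unit.
Proof.
elim: v => [|[j b] v IH]; first by rewrite reval_nil unitr1.
by rewrite reval_cons unitrMl //; case: b; rewrite ?unitrV rho_unit.
Qed.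

Lemma winv_cat v1 v2 : winv (v1 ++ v2) = winv v2 ++ winv v1.
Proof. by rewrite /winv map_cat rev_cat. Qed.

Lemma reval_winv v : reval rho (winv v) = (reval rho v)^-1.
Proof.
elim: v => [|[j b] v IH]; first by rewrite reval_nil invr1.
rewrite -cat1s winv_cat !reval_cat IH reval1 /= reval1 /=.
rewrite invrM ?reval_unit //; last by case: b; rewrite ?unitrV rho_unit.
by case: b; rewrite //= invrK.
Qed.

Lemma mxtrace_conj (A B : 'M[C]_2) : A \is a GRing.unit ->
  \tr (A * B * A^-1) = \tr B.
Proof.
by move=> uA; rewrite -[_ * _^-1]/(_ *m _) mxtrace_mulC -[_ *m _]/(_ * _)
  mulrA mulVr // mul1r.
Qed.

Lemma sl2mx_Ad v x : sl2mx (Ad rho v x) = reval rho v * sl2mx x * (reval rho v)^-1.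
Proof. by rewrite /Ad sl2mxK // mxtrace_conj ?sl2mx_tr // reval_unit. Qed.

Local Opaque Ad.

Lemma Ad_nil x : Ad rho [::] x = x.
Proof.
by apply: (can_inj sl2rvK); rewrite sl2mx_Ad reval_nil invr1 mulr1 mul1r.
Qed.

Lemma Ad_cat v1 v2 x : Ad rho (v1 ++ v2) x = Ad rho v1 (Ad rho v2 x).
Proof.
apply: (can_inj sl2rvK).
rewrite (sl2mx_Ad (v1 ++ v2)) (sl2mx_Ad v1) (sl2mx_Ad v2) (reval_cat v1).
by apply: conj_mulr; apply: reval_unit.
Qed.

(** The first-order variation of [reval rho] along the cochain [x]: an
    equivariant 1-cochain is a crossed homomorphism on words, so multiplying
    its values by [rho] on the right turns it into a derivation along [rho],
    which can be computed by the Leibniz rule. *)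
Definition fox (x : cochain C 3 1) (v : word) : 'M[C]_2 :=
  sl2mx (D v x) * reval rho v.

Lemma eval1_cat v1 v2 x : D (v1 ++ v2) x = D v1 x + Ad rho v1 (D v2 x).
Proof.
elim: v1 => [|a v1 IH] /=; first by rewrite add0r Ad_nil.
have -> : Ad rho (a :: v1) (D v2 x) = Ad rho [:: a] (Ad rho v1 (D v2 x)).
  exact: (Ad_cat [:: a] v1).
by rewrite IH linearD -addrA.
Qed.

Lemma fox_cat x v1 v2 :
  fox x (v1 ++ v2) = fox x v1 * reval rho v2 + reval rho v1 * fox x v2.
Proof.
rewrite /fox eval1_cat linearD /= sl2mx_Ad reval_cat mulrDl !mulrA; congr (_ + _).
by rewrite mulrVK ?reval_unit.
Qed.

Lemma fox_nil x : fox x [::] = 0.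
Proof. by rewrite /fox /= linear0 mul0r. Qed.

Lemma fox_gen x j : fox x [:: (j, false)] = sl2mx (row j x) * rho j.
Proof. by rewrite /fox /= linear0 addr0 reval1. Qed.

Lemma fox_inv1 x j :
  fox x [:: (j, true)] = - ((rho j)^-1 * fox x [:: (j, false)] * (rho j)^-1).
Proof.
rewrite fox_gen /fox /= linear0 addr0 linearN /= sl2mx_Ad reval1 /= invrK.
by rewrite mulNr !mulrA.
Qed.

Lemma winv1 a : winv [:: a] = [:: (a.1, ~~ a.2)].
Proof. by []. Qed.

Lemma fox_winv x v :
  fox x (winv v) = - ((reval rho v)^-1 * fox x v * (reval rho v)^-1).
Proof.
elim: v => [|[j b] v IH].
  by rewrite /winv /= fox_nil mulr0 mul0r oppr0.
rewrite -cat1s winv_cat !fox_cat reval_cat IH !reval_winv.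
have -> : fox x (winv [:: (j, b)]) =
    - ((reval rho [:: (j, b)])^-1 * fox x [:: (j, b)] * (reval rho [:: (j, b)])^-1).
  rewrite winv1 reval1; case: b; last exact: fox_inv1.
  by rewrite fox_inv1 invrK (inv_conjK _ (rho_unit j)).
by apply: leibniz_inv; apply: reval_unit.
Qed.

Lemma fox_linear v : linear (fox ^~ v).
Proof.
by move=> k x y; rewrite /fox eval1_linear linearP /= mulrDl -scalerAl.
Qed.

End FoxCalculus.

(** * Quaternions and their degrees *)

(** Words in g1 and g2 are evaluated in the quaternion algebra with basis 1, S, N,
    H = S N and relations S^2 = s, N^2 = u, N S = - S N.  The coefficients lie in
    an arbitrary commutative ring, so that s, u and m can be numbers as well as
    polynomials. *)
Record quat (B : Type) := Quat { qr : B; qS : B; qN : B; qH : B }.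

Section Quaternions.

Variable B : comNzRingType.
Variables (s u : B).
Implicit Types x y z : quat B.

Definition qmul x y := Quat
  (qr x * qr y + s * (qS x * qS y) + u * (qN x * qN y) - s * u * (qH x * qH y))
  (qr x * qS y + qS x * qr y + u * (qH x * qN y - qN x * qH y))
  (qr x * qN y + qN x * qr y + s * (qS x * qH y - qH x * qS y))
  (qr x * qH y + qH x * qr y + qS x * qN y - qN x * qS y).

Definition qone : quat B := Quat 1 0 0 0.
Definition qconj x := Quat (qr x) (- qS x) (- qN x) (- qH x).

Lemma qmulA x y z : qmul x (qmul y z) = qmul (qmul x y) z.
Proof. by congr Quat => /=; ring. Qed.

Lemma qmul1 x : qmul qone x = x.
Proof. by case: x => *; congr Quat => /=; ring. Qed.

(** [m] stands for half the common trace of the two meridians. *)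
Variable m : B.

Definition qgen (a : 'I_2 * bool) : quat B :=
  let x := Quat m 1 (if a.1 == 0 then 1 else - 1) 0 in
  if a.2 then qconj x else x.

Definition qword (v : word) : quat B :=
  foldr (fun a => qmul (qgen a)) qone v.

Lemma qword_cat v1 v2 : qword (v1 ++ v2) = qmul (qword v1) (qword v2).
Proof.
elim: v1 => [|a v1 IH] /=; first by rewrite qmul1.
by rewrite IH qmulA.
Qed.

End Quaternions.

Definition qmap (A B : Type) (f : A -> B) (x : quat A) : quat B :=
  Quat (f (qr x)) (f (qS x)) (f (qN x)) (f (qH x)).

Lemma qmap_word (A B : comNzRingType) (f : {rmorphism A -> B}) s u m v :
  qmap f (qword s u m v) = qword (f s) (f u) (f m) v.
Proof.
elim: v => [|a v IH] /=; first by rewrite /qmap /= rmorph0 rmorph1.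
rewrite -IH /qmap /qgen /=.
by case: a => a [] /=; case: (a == 0);
  congr Quat => /=; rewrite !(rmorphD, rmorphN, rmorphM, rmorph0, rmorph1).
Qed.

Section Weight.

Variable A : comNzRingType.
Implicit Types p q r : {poly A}.

Lemma size_mul_bound p q a b d : (size p <= a)%N -> (size q <= b)%N ->
  (0 < a -> 0 < b -> (a + b).-1 <= d)%N -> (size (p * q)%R <= d)%N.
Proof.
move=> ha hb hd; have := size_polyMleq p q.
have [-> | p0] := eqVneq p 0; first by rewrite mul0r size_poly0.
have [-> | q0] := eqVneq q 0; first by rewrite mulr0 size_poly0.
by move: p0 q0; rewrite -!size_poly_gt0; lia.
Qed.

Lemma size_mul3_bound r p q a b d : (size r <= 2)%N -> (size p <= a)%N ->
  (size q <= b)%N -> (0 < a -> 0 < b -> a + b <= d)%N ->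
  (size (r * (p * q))%R <= d)%N.
Proof.
move=> hr ha hb hd.
apply: (@size_mul_bound _ _ 2 d.-1 _ hr); last by lia.
by apply: size_mul_bound ha hb _; lia.
Qed.

Lemma size_add_bound p q d : (size p <= d)%N -> (size q <= d)%N ->
  (size (p + q)%R <= d)%N.
Proof. by move=> hp hq; have := size_polyD p q; lia. Qed.

Lemma size_sub_bound p q d : (size p <= d)%N -> (size q <= d)%N ->
  (size (p - q)%R <= d)%N.
Proof. by move=> hp hq; apply: size_add_bound; rewrite ?size_polyN. Qed.

(** Giving S and N weight 1 and the indeterminate u = N^2 weight 2, so that
    s = S^2 has weight 2 as well, the product of quaternions is filtered and
    a generator has weight 1; this predicate is the filtration. *)
Definition weight (k : nat) (x : quat {poly A}) : Prop :=
  [/\ (size (qr x) <= k./2.+1)%N, (size (qS x) <= uphalf k)%N,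
      (size (qN x) <= uphalf k)%N & (size (qH x) <= k./2)%N].

Variable m : A.

(** The value of s imposed by s + u = m^2 - 1, that is by det g1 = det g2 = 1. *)
Definition spoly : {poly A} := (m ^+ 2 - 1)%:P - 'X.

Definition pword : word -> quat {poly A} := qword spoly 'X m%:P.

Lemma size_spoly : (size spoly <= 2)%N.
Proof.
by apply: size_sub_bound; rewrite ?size_polyX // (leq_trans (size_polyC_leq1 _)).
Qed.

Lemma weight_mul k l x y : weight k x -> weight l y ->
  weight (k + l) (qmul spoly 'X x y).
Proof.
move=> [r1 S1 N1 H1] [r2 S2 N2 H2].
have sX : (size ('X : {poly A}) <= 2)%N by rewrite size_polyX.
have ss := size_spoly.
split=> /=.
- apply: size_sub_bound; last first.
    rewrite -mulrA; apply: (@size_mul_bound _ _ 2 (k + l)./2 _ ss); last by lia.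
    by apply: size_mul3_bound sX H1 H2 _; lia.
  apply: size_add_bound; last by apply: size_mul3_bound sX N1 N2 _; lia.
  apply: size_add_bound; first by apply: size_mul_bound r1 r2 _; lia.
  by apply: size_mul3_bound ss S1 S2 _; lia.
- apply: size_add_bound.
    by apply: size_add_bound; [apply: size_mul_bound r1 S2 _ | apply: size_mul_bound S1 r2 _]; lia.
  rewrite mulrBr; apply: size_sub_bound.
    by apply: size_mul3_bound sX H1 N2 _; lia.
  by apply: size_mul3_bound sX N1 H2 _; lia.
- apply: size_add_bound.
    by apply: size_add_bound; [apply: size_mul_bound r1 N2 _ | apply: size_mul_bound N1 r2 _]; lia.
  rewrite mulrBr; apply: size_sub_bound.
    by apply: size_mul3_bound ss S1 H2 _; lia.
  by apply: size_mul3_bound ss H1 S2 _; lia.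
- apply: size_sub_bound; last by apply: size_mul_bound N1 S2 _; lia.
  apply: size_add_bound; last by apply: size_mul_bound S1 N2 _; lia.
  by apply: size_add_bound; [apply: size_mul_bound r1 H2 _ | apply: size_mul_bound H1 r2 _]; lia.
Qed.

Lemma weight_gen a : weight 1 (qgen m%:P a).
Proof.
by case: a => a [] /=; split => /=; case: (a == 0);
  rewrite ?oppr0 ?size_polyN ?size_poly1 ?size_poly0 ?size_polyC_leq1.
Qed.

Lemma weight_word v : weight (size v) (pword v).
Proof.
elim: v => [|a v IH] /=.
  by split; rewrite /= ?size_poly0 // size_poly1.
by rewrite -add1n; apply: weight_mul IH; exact: weight_gen.
Qed.

(** By Cayley-Hamilton a square of a generator has weight 1 only. *)
Lemma weight_gen2 : weight 1 (pword [:: g1; g1]).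
Proof.
have szC (d : A) (p : {poly A}) : p = d%:P -> (size p <= 1)%N.
  by move=> ->; rewrite size_polyC_leq1.
split=> /=.
- apply: (@szC (m * m + (m ^+ 2 - 1))).
  by rewrite !(polyCD, polyCM, polyCN) /spoly polyCB; ring.
- by apply: (@szC (m + m)); rewrite !(polyCD, polyCM); ring.
- by apply: (@szC (m + m)); rewrite !(polyCD, polyCM); ring.
- by rewrite size_poly_leq0; apply/eqP; ring.
Qed.

End Weight.

(** * The dihedral representations *)

Section Dihedral.

Variable F : numFieldType.

(** The trace of g1 g2, which is 2 (2 m^2 - 1 - 2 u), for m = 0. *)
Definition ztrace : {poly F} := - 2 - 4 * 'X.

(** The pair (Q_(n-1), Q_n) of the Chebyshev-like sequence with
    Q_(-1) = Q_0 = 1 and Q_(n+1) = z Q_n - Q_(n-1). *)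
Fixpoint dih (n : nat) : {poly F} * {poly F} :=
  if n is k.+1 then ((dih k).2, ztrace * (dih k).2 - (dih k).1) else (1, 1).

(** The quadratic form preserved by the recursion. *)
Lemma dih_norm n :
  (dih n).1 ^+ 2 + (dih n).2 ^+ 2 - ztrace * (dih n).1 * (dih n).2 = 2 - ztrace.
Proof.
elim: n => [|n IH] /=; first by ring.
by rewrite -IH; ring.
Qed.

Lemma ztrace_deriv : ztrace^`() = - 4.
Proof.
by rewrite /ztrace !derivE /=; ring.
Qed.

Lemma dih_deriv n :
  (ztrace ^+ 2 - 4) * ((dih n).1)^`() =
    - 4 * ((2 * n%:R - 1) * (dih n).2 - (n%:R * ztrace - 1) * (dih n).1) /\
  (ztrace ^+ 2 - 4) * ((dih n).2)^`() =
    - 4 * ((n%:R * ztrace + 1) * (dih n).2 - (2 * n%:R + 1) * (dih n).1).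
Proof.
elim: n => [|n [IH1 IH2]] /=; first by rewrite derivC; split; ring.
rewrite -[n.+1%:R]natr1; split; first by rewrite IH2; ring.
rewrite derivB derivM ztrace_deriv.
set a' := (dih n).1^`() in IH1 *; set b' := (dih n).2^`() in IH2 *.
transitivity (- 4 * (dih n).2 * (ztrace ^+ 2 - 4)
  + ztrace * ((ztrace ^+ 2 - 4) * b') - (ztrace ^+ 2 - 4) * a'); first by ring.
by rewrite IH1 IH2; ring.
Qed.

Lemma size_ztrace : size ztrace = 2%N.
Proof.
have -> : ztrace = (- 4)%:P * 'X + (- 2)%:P.
  by rewrite !polyCN !polyC_natr /ztrace; ring.
by rewrite size_MXaddC polyC_eq0 size_polyC oppr_eq0 pnatr_eq0.
Qed.

Lemma size_dih n :
  (size (dih n).1 <= n.+1)%N /\ size (dih n).2 = n.+1.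
Proof.
elim: n => [|n [IH1 IH2]] /=; first by rewrite size_poly1.
split; first by rewrite IH2.
have zb : size (ztrace * (dih n).2) = n.+2.
  by rewrite size_mul -?size_poly_gt0 ?size_ztrace ?IH2 // addSn.
by rewrite size_polyDl zb ?size_polyN // (leq_ltn_trans IH1).
Qed.

Lemma ztrace_horner x : ztrace.[x] = - 2 - 4 * x.
Proof.
by rewrite /ztrace -!polyC_natr hornerD !hornerN hornerM hornerX !hornerC.
Qed.

Lemma dih_at_m1 n : ((dih n).1.[-1] = 1) * ((dih n).2.[-1] = 1).
Proof.
elim: n => [|n IH] /=; first by rewrite !hornerC.
by rewrite hornerD hornerN hornerM ztrace_horner !IH; split=> //; ring.
Qed.

Lemma dih_at_0 n : ((dih n).1.[0] = (-1) ^+ n * (1 - 2 * n%:R)) *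
  ((dih n).2.[0] = (-1) ^+ n * (1 + 2 * n%:R)).
Proof.
elim: n => [|n IH] /=; first by rewrite !hornerC; split; ring.
rewrite exprS -[n.+1%:R]natr1.
by rewrite hornerD hornerN hornerM ztrace_horner !IH; split; ring.
Qed.

(** A double root of Q_n is also a root of Q_(n-1), by the formula for the
    derivative; the quadratic form then vanishes, which forces x = -1, but
    Q_n (-1) = 1. *)
Lemma dih_separable n x : (dih n).2.[x] = 0 -> (dih n).2^`().[x] != 0.
Proof.
move=> b0; apply/eqP => b'0.
set a := (dih n).1; have a0 : a.[x] = 0.
  have [_ /(congr1 (horner^~ x)) /eqP] := dih_deriv n.
  rewrite -subr_eq0 -!polyC_natr !(hornerD, hornerN, hornerM) !hornerC.
  rewrite b0 b'0 -/a => /eqP h.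
  have : 4 * ((2 * n%:R + 1) * a.[x]) = 0 by rewrite -[RHS]oppr0 -h; ring.
  move/eqP; rewrite !mulf_eq0 -natrM natr1 !pnatr_eq0 /=.
  by move=> /eqP.
have := congr1 (horner^~ x) (dih_norm n) => /eqP.
rewrite -subr_eq0 -polyC_natr !(ztrace_horner, hornerD, hornerN, hornerM, horner_exp).
rewrite hornerC b0 -/a a0 => /eqP h.
have x1 : x = -1.
  have : 4 * (x + 1) = 0 by rewrite -[RHS]oppr0 -h; ring.
  by move/eqP; rewrite mulf_eq0 pnatr_eq0 /= addr_eq0 => /eqP.
by move: b0; rewrite x1 dih_at_m1 => /eqP; rewrite oner_eq0.
Qed.

End Dihedral.

(** * The knot word and the rotation of its relator *)

Section KnotWords.

Variables (p : nat) (q : int).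
Hypothesis pq : schubert_normal_form p q.

(** The sign of the i-th letter of the relator. *)
Let sg (i : nat) : bool := odd `|((i.+1%:Z * q - 1) %/ p%:Z)%Z|%N.
Let t := torus_rot p q.
Let r := relator p q.

Let p0 : (0 < p)%N. Proof. by case: pq. Qed.
Let op : odd p. Proof. by case: pq. Qed.
Let oq : odd `|q|%N. Proof. by case: pq. Qed.

Definition swap (v : word) : word := [seq (1 - a.1, a.2) | a <- v].

Lemma rev_wK : rev (wK p q) = swap (wK p q).
Proof.
apply: (@eq_from_nth _ g1) => [|i]; first by rewrite size_rev [RHS]size_map.
rewrite size_rev size_wK => ip; rewrite nth_rev_wK // [RHS](nth_map g1) ?size_wK // nth_wK //=.
by congr (_, _); case: odd; apply: val_inj.
Qed.

Lemma eps_first_neg : q < 0 -> sg 0.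
Proof.
move=> q0; have [_ _ _ _ /andP[h1 h2]] := pq.
have p2 : (0 < p.-1)%N by lia.
rewrite /sg (sg_wK pq p2) /eps_neg mul1r (@floorE _ _ (-1)) //; lia.
Qed.

Lemma eps_first_pos : 0 < q -> (1 < p)%N -> sg 0 = false.
Proof.
move=> q0 p1; have [_ _ _ _ /andP[h1 h2]] := pq.
have p2 : (0 < p.-1)%N by lia.
rewrite /sg (sg_wK pq p2) /eps_neg mul1r (@floorE _ _ 0) //; lia.
Qed.

Lemma eps_neg_ex : q != 1 -> exists2 i, (i < p.-1)%N & sg i.
Proof.
move=> q1; have [_ _ _ _ /andP[h1 h2]] := pq.
have [q0|q0] : q < 0 \/ 3 <= q by lia.
  by exists 0%N; [lia | exact: eps_first_neg].
pose j := (p %/ `|q|)%N.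
have jb : (j * `|q| <= p < j.+1 * `|q|)%N.
  by rewrite leq_divM ltn_ceil //; lia.
have jp : (j < p.-1)%N by nia.
exists j => //; rewrite /sg (sg_wK pq jp) /eps_neg (@floorE _ _ 1) //; nia.
Qed.

Lemma eps_pos_ex : q != -1 -> (1 < p)%N -> exists2 i, (i < p.-1)%N & sg i = false.
Proof.
move=> q1 p1; have [_ _ _ _ /andP[h1 h2]] := pq.
have [q0|q0] : 0 < q \/ q <= - 3 by lia.
  by exists 0%N; [lia | exact: eps_first_pos].
pose j := (p %/ `|q|)%N.
have jb : (j * `|q| <= p < j.+1 * `|q|)%N.
  by rewrite leq_divM ltn_ceil //; lia.
have jp : (j < p.-1)%N by nia.
exists j => //; rewrite /sg (sg_wK pq jp) /eps_neg (@floorE _ _ (-2)) //; nia.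
Qed.

Lemma size_relator : size r = p.*2.
Proof. by rewrite !size_cat !size_winv size_wK /=; lia. Qed.

Lemma torus_rot_lt : (t < p.*2)%N.
Proof.
have := find_size (fun k => winv (rot k r) == dual_relator p q) (iota 0 p.*2).
rewrite size_iota -/(torus_rot p q) -/t leq_eqVlt => /predU1P[tE|//].
have := torus_rotP pq; rewrite -/t tE -size_relator rot_size => e0.
have : has (fun k => winv (rot k r) == dual_relator p q) (iota 0 p.*2).
  by apply/hasP; exists 0%N; rewrite ?mem_iota ?rot0 ?e0 //=; lia.
by rewrite has_find size_iota -/(torus_rot p q) -/t tE ltnn.
Qed.

Let sg_last : sg p.*2.-1 = true.
Proof.
have -> : p.*2.-1 = (p.*2 - 1)%N by lia.
by rewrite /sg (sg_refl pq) ?mul0r ?div0z //; lia.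
Qed.

Let sg_sym i : (i < p.-1)%N -> sg (p.-1 - i.+1)%N = sg i.
Proof. exact: (@eps_sym p q pq i). Qed.

Let sg_half i : (i < p.-1)%N -> sg (p + i)%N = ~~ sg i.
Proof. by move=> ip; rewrite /sg -(sg_neg pq) // (eps_sym pq). Qed.

Let rot_nth i : (i < p.*2)%N ->
  nth g1 (winv (rot t r)) i = ((if odd i then 0 else 1) : 'I_2, sg i).
Proof. by move=> ip; rewrite (torus_rotP pq) nth_dual. Qed.

(** The rotated relator is the inverse of the dual relator, whose letters carry
    the same signs.  Hence the signs before t and the signs from t on are
    reversed and negated by the reflection in the middle of their range. *)
Let rot_low i : (i < t)%N -> ~~ odd t /\ sg i = ~~ sg (t.-1 - i)%N.
Proof.
move=> it; have := rot_nth (ltn_trans it torus_rot_lt).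
rewrite (nth_winv pq) size_rot size_relator; last by have := torus_rot_lt; lia.
have tl := torus_rot_lt.
rewrite /rot nth_cat size_drop size_relator ltnNge.
have -> : (p.*2 - t <= p.*2 - i.+1)%N by lia.
rewrite /= nth_take; last by lia.
have -> : (p.*2 - i.+1 - (p.*2 - t) = t.-1 - i)%N by lia.
rewrite nth_relator //; last by lia.
case=> h1 <-; split=> //; apply/negP => ot.
have : odd (t.-1 - i) = odd i by lia.
by move: h1 => /[swap] ->; case: odd.
Qed.

Let rot_high i : (t <= i < p.*2)%N ->
  ~~ odd t /\ sg i = ~~ sg (t + p.*2.-1 - i)%N.
Proof.
move=> /andP[ti ip]; have := rot_nth ip.
rewrite (nth_winv pq) size_rot size_relator; last by have := torus_rot_lt; lia.
have tl := torus_rot_lt.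
rewrite /rot nth_cat size_drop size_relator.
have -> : (p.*2 - i.+1 < p.*2 - t)%N by lia.
rewrite nth_drop.
have -> : (t + (p.*2 - i.+1) = t + p.*2.-1 - i)%N by lia.
rewrite nth_relator //; last by lia.
case=> h1 <-; split=> //; apply/negP => ot.
have : odd (t + p.*2.-1 - i) = odd i by lia.
by move: h1 => /[swap] ->; case: odd.
Qed.

Let t_even : ~~ odd t.
Proof. by have [] := @rot_high t; rewrite ?leqnn ?torus_rot_lt. Qed.

Let sg_t : sg t = false.
Proof.
have [|_ ->] := @rot_high t; rewrite ?leqnn ?torus_rot_lt //.
by rewrite addKn sg_last.
Qed.

(** The signs of the knot word are palindromic, so that its last letter carries
    the sign of the first one, which is opposite to the sign e at the end of the
    antisymmetric prefix. *)
Let antisym_split L b : (0 < L)%N -> (L <= p - 3)%N -> ~~ odd L ->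
  (forall i, (i < L)%N -> sg i = ~~ sg (L.-1 - i)%N) -> sg L = b ->
  exists v e x,
    [/\ wK p q = v ++ (1, e) :: (0, b) :: x ++ [:: (1, ~~ e)], size v = L.-1
      & winv (v ++ [:: (1, e)]) = swap (v ++ [:: (1, e)])].
Proof.
move=> L0 Lp Lo sgL sb; set w := wK p q.
have sw : size w = p.-1 := size_wK p q.
exists (take L.-1 w), (sg L.-1), (take (p.-1 - L.+1).-1 (drop L.+1 w)).
have tE : take L w = take L.-1 w ++ [:: (1, sg L.-1)].
  rewrite -{1}(prednK L0) (take_nth g1) ?sw; last lia.
  rewrite -cats1 nth_wK //; last lia.
  by have -> : odd L.-1 by lia.
have dE : drop L w = (0, b) :: drop L.+1 w.
  rewrite (drop_nth g1) ?sw; last lia.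
  rewrite nth_wK //; last lia.
  by rewrite (negbTE Lo) -sb.
have xE : drop L.+1 w = take (p.-1 - L.+1).-1 (drop L.+1 w) ++ [:: (1, ~~ sg L.-1)].
  rewrite -{1}[drop L.+1 w](cat_take_drop (p.-1 - L.+1).-1); congr (_ ++ _).
  rewrite (drop_nth g1) ?size_drop ?sw; last lia.
  rewrite nth_drop drop_oversize ?size_drop ?sw; last lia.
  have -> : (L.+1 + (p.-1 - L.+1).-1 = p.-1 - 1)%N by lia.
  rewrite nth_wK; [|by [] |lia].
  have -> : odd (p.-1 - 1) by lia.
  congr [:: (_, _)]; rewrite -/(sg _) sg_sym; last lia.
  by rewrite sgL // subn0.
split.
- by rewrite -xE -dE -cat1s catA -tE cat_take_drop.
- by rewrite size_take sw; case: ltnP; lia.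
- rewrite -tE; apply: (@eq_from_nth _ g1) => [|i].
    by rewrite size_winv size_map.
  have st : size (take L w) = L by rewrite size_take sw; case: ltnP; lia.
  rewrite size_winv st => iL.
  rewrite (nth_winv pq) st // (nth_map g1) ?st // !nth_take; [|lia..].
  rewrite !nth_wK; [|by []|lia|by []|lia].
  have -> : odd (L - i.+1) = ~~ odd i by lia.
  rewrite -!/(sg _) /= [in RHS]sgL // (_ : L - i.+1 = L.-1 - i)%N; last lia.
  by congr (_, _); case: (odd i); apply: val_inj.
Qed.

(** The second 2-cell of the boundary torus is attached at a suffix of the
    relator.  The knot word has an antisymmetric prefix A = v ++ [:: (1, e)] such
    that in the group this suffix is A^-1 or g1 A^-1 g2^-1, according as the
    rotation is shorter or longer than p.  An empty prefix would make all the
    signs of the knot word equal, which happens only for q = 1 and q = -1. *)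
Lemma torus_rot_split : q != 1 -> q != -1 ->
  exists v e b x,
  [/\ wK p q = v ++ (1, e) :: (0, b) :: x ++ [:: (1, ~~ e)],
      winv (v ++ [:: (1, e)]) = swap (v ++ [:: (1, e)])
    & if b then drop t r = winv (v ++ [:: (1, e); (0, true)]) ++ winv [:: g2]
      else r = v ++ (1, e) :: drop t r].
Proof.
move=> q1 qN1; have [_ _ _ _ /andP[h1 h2]] := pq.
have p1 : (2 < p)%N.
  by move: q1 qN1 h1 h2 oq; case: (p) p0 op => [|[|[|]]] //; lia.
have tl := torus_rot_lt.
have [tp|tp] := ltnP t p.
  (* If t = 0, the reflection carries the sign of each letter to the next. *)
  have t0 : (0 < t)%N.
    rewrite lt0n; apply/eqP => t0.
    have [i ip] := eps_neg_ex q1; apply/negP.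
    elim: i ip => [|i IH] ip; first by rewrite -t0 sg_t.
    have [|_ ->] := @rot_high i.+1; first by lia.
    have -> : (t + p.*2.-1 - i.+1 = p + (p.-1 - i.+1))%N by lia.
    rewrite sg_half; last lia.
    by rewrite negbK sg_sym; [apply: IH; lia | lia].
  have tp3 : (t <= p - 3)%N.
    have : t != p.-1.
      apply/eqP => tE; have [_] := rot_low t0.
      have -> : (t.-1 - 0 = p.-1 - 1)%N by lia.
      by rewrite sg_sym; [case: sg | lia].
    by move: t_even; lia.
  have [v [e [x [wE sv ve]]]] := antisym_split t0 tp3 t_even
    (fun i it => proj2 (rot_low it)) sg_t.
  exists v, e, false, x; split=> //.
  have sv1 : t = size (v ++ [:: (1, e)]) by rewrite size_cat /= sv; lia.
  have rE : r = (v ++ [:: (1, e)]) ++ ((0, false) :: x ++ [:: (1, ~~ e)]) ++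
      [:: g1] ++ winv (wK p q) ++ winv [:: g2].
    by rewrite /r /relator {1}wE -!catA.
  by rewrite {2}rE drop_size_cat // {1}rE -catA.
pose L := (p.*2 - 2 - t)%N.
have tp' : (p < t)%N by move: t_even tp op; case: ltngtP => // ->; lia.
have t2 : (t <= p.*2 - 2)%N by move: t_even tl; lia.
have tpE : t = (p + (t - p))%N by lia.
have sgtp : sg (t - p) = true.
  by apply: negb_inj; rewrite -sg_half -?tpE ?sg_t //; lia.
have sL : sg L = true.
  have -> : L = (p.-1 - (t - p).+1)%N by rewrite /L; lia.
  by rewrite sg_sym //; lia.
have L0 : (0 < L)%N.
  rewrite lt0n; apply/eqP => L0.
  have [i ip] := eps_pos_ex qN1 (ltnW p1); move/negbT/negP; apply.
  elim: i ip => [|i IH] ip; first by rewrite -L0.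
  have := IH (ltnW ip); have [|_ ->] := @rot_low i; first by lia.
  have -> : (t.-1 - i = p + (p.-1 - i.+2))%N by move: L0; rewrite /L; lia.
  rewrite sg_half; last lia.
  by rewrite negbK sg_sym.
have Lp : (L <= p - 3)%N by rewrite /L; lia.
have Lo : ~~ odd L by move: t_even; rewrite /L; lia.
have anti i : (i < L)%N -> sg i = ~~ sg (L.-1 - i)%N.
  move=> iL.
  have -> : (L.-1 - i = p.-1 - (t.+1 + i - p).+1)%N by rewrite /L in iL *; lia.
  rewrite sg_sym; last by rewrite /L in iL; lia.
  rewrite -sg_half; last by rewrite /L in iL; lia.
  have -> : (p + (t.+1 + i - p) = t.+1 + i)%N by lia.
  have [|_ ->] := @rot_high (t.+1 + i)%N; first by rewrite /L in iL; lia.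
  have -> : (t + p.*2.-1 - (t.+1 + i) = p + (p.-1 - i.+1))%N.
    by rewrite /L in iL; lia.
  rewrite sg_half; last by lia.
  by rewrite negbK sg_sym //; lia.
have [v [e [x [wE sv ve]]]] := antisym_split L0 Lp Lo anti sL.
exists v, e, true, x; split=> //.
rewrite /r /relator catA drop_cat size_cat size_wK /= ltnNge.
have -> : (p.-1 + 1 <= t)%N by lia.
rewrite /= wE (_ : v ++ _ = (v ++ [:: (1, e); (0, true)]) ++ (x ++ [:: (1, ~~ e)])).
  rewrite (winv_cat (v ++ _) (x ++ _)) -[LHS]/(drop _ _) -catA drop_size_cat //.
  by rewrite size_winv; move: (size_wK p q); rewrite wE !size_cat /= !size_cat /= sv /L; lia.
by rewrite -catA.
Qed.

End KnotWords.

(** * The Riley polynomial *)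

Section Riley.

Variables (p : nat) (q : int).
Hypothesis pq : schubert_normal_form p q.

Section Def.
Variables (A : comNzRingType) (m : A).

(** On a pair of matrices g1, g2 of trace 2m, the matrix w g1 - g2 w is twice
    this polynomial in u times N; it is the Riley polynomial of the knot. *)
Definition riley : {poly A} := qN (pword m (wK p q ++ [:: g1])).

Lemma size_word_riley : size (wK p q ++ [:: g1]) = p.
Proof. by have [p0 _ _ _ _] := pq; rewrite size_cat size_wK /=; lia. Qed.

Lemma size_riley : (size riley <= uphalf p)%N.
Proof.
by have [_ _ + _] := weight_word m (wK p q ++ [:: g1]); rewrite size_word_riley.
Qed.

End Def.

Lemma riley_map (A : comNzRingType) (m : A) :
  map_poly (horner_eval m) (riley 'X) = riley m.
Proof.
have hX : map_poly (horner_eval m) ('X)%:P = m%:P.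
  by rewrite map_polyC /= horner_evalE hornerX.
have hs : map_poly (horner_eval m) (spoly 'X) = spoly m.
  by rewrite rmorphB /= map_polyX map_polyC /= horner_evalE !hornerE.
rewrite /riley /pword -[LHS]/(qN (qmap (map_poly (horner_eval m)) _)) qmap_word.
by rewrite /= map_polyX hX hs.
Qed.

Definition positive (v : word) : word := [seq (a.1, false) | a <- v].

Lemma positive_wK : positive (wK p q) = flatten (nseq p./2 [:: g1; g2]).
Proof.
have [p0 op _ _ _] := pq.
rewrite /positive /wK -map_comp /comp /=.
have -> : p.-1 = (p./2).*2 by lia.
suff H k i : odd i ->
    [seq ((if odd j then 0 else 1) : 'I_2, false) | j <- iota i k.*2] =
    flatten (nseq k [:: g1; g2]) by exact: H.
by elim: k i => [|k IH] i oi //=; rewrite oi IH /= ?oi.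
Qed.

Section DihedralCase.

Variable F : numFieldType.

Let mul0 (x y : quat {poly F}) := qmul (spoly 0) 'X x y.
Local Notation word0 := (@pword F 0).

Lemma spoly0 : spoly 0 = - 1 - 'X :> {poly F}.
Proof. by rewrite /spoly expr0n sub0r polyCN. Qed.

(** For m = 0 the inverse of a generator is its opposite, so that only the
    alternation of the generators matters. *)
Lemma pword0_sign v : exists b : bool,
  let x := word0 v in let y := word0 (positive v) in
  [/\ qr x = (-1) ^+ b * qr y, qS x = (-1) ^+ b * qS y,
      qN x = (-1) ^+ b * qN y & qH x = (-1) ^+ b * qH y].
Proof.
elim: v => [|[j e] v [b]] /=; first by exists false; rewrite expr0 !mul1r.
case=> h1 h2 h3 h4; exists (e (+) b); rewrite signr_addb.
rewrite -!/(word0 _) -!/(spoly _).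
rewrite !h1 !h2 !h3 !h4 polyC0.
by case: e => /=; rewrite ?expr0 ?expr1; split; ring.
Qed.

(** By Cayley-Hamilton the powers of g1 g2 obey the recursion of [dih]. *)
Lemma pword0_alternating k :
  qN (word0 (flatten (nseq k [:: g1; g2]) ++ [:: g1])) = (dih F k).2 /\
  qN (word0 (flatten (nseq k.+1 [:: g1; g2]) ++ [:: g1])) = (dih F k.+1).2.
Proof.
have step (x : quat {poly F}) : let gg y := mul0 (word0 [:: g1]) (mul0 (word0 [:: g2]) y) in
    qN (gg (gg x)) = ztrace F * qN (gg x) - qN x.
  rewrite /= polyC0 spoly0 /ztrace; ring.
elim: k => [|k [IH1 IH2]].
  rewrite /= polyC0 spoly0 /ztrace.
  by split; ring.
split=> //.
have -> : (dih F k.+2).2 = ztrace F * (dih F k.+1).2 - (dih F k).2 by [].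
rewrite -IH1 -IH2.
have cat2 v : word0 ([:: g1; g2] ++ v) =
    mul0 (word0 [:: g1]) (mul0 (word0 [:: g2]) (word0 v)).
  by rewrite -(cat1s g1 [:: g2]) -catA /pword !qword_cat.
have := step (word0 (flatten (nseq k [:: g1; g2]) ++ [:: g1])).
by cbv beta zeta; rewrite -!cat2; apply.
Qed.

Lemma riley0 : exists b : bool, riley (0 : F) = (-1) ^+ b * (dih F p./2).2.
Proof.
have [b [_ _ h _]] := pword0_sign (wK p q ++ [:: g1]).
exists b; rewrite /riley h /positive map_cat -/(positive _) positive_wK.
by have [<- _] := pword0_alternating p./2.
Qed.

End DihedralCase.

Section Generic.

Variable F : numClosedFieldType.
Hypothesis p5 : (4 < p)%N.

(** Each property is the nonvanishing of a polynomial in m, and it holds for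
    m = 0, where the representations are dihedral. *)
Lemma riley_generic : exists2 E : {poly F}, E != 0 & forall m, E.[m] != 0 ->
  [/\ size (riley m) = p./2.+1, coprimep (riley m) (riley m)^`(),
      (riley m).[0] != 0, (riley m).[m ^+ 2 - 1] != 0 & m ^+ 2 != 1].
Proof.
have [p0 op _ _ _] := pq.
have n2 : (1 < p./2)%N by lia.
have [b r0E] := riley0 F.
set P := riley ('X : {poly F}).
have PE m : map_poly (horner_eval m) P = riley m := riley_map m.
have sgn0 : (-1) ^+ b != 0 :> F by rewrite signr_eq0.
have r0E' : riley (0 : F) = (-1) ^+ b *: (dih F p./2).2.
  by rewrite r0E -mul_polyC rmorphXn rmorphN rmorph1.
have [_ sd] := size_dih F p./2.
have s0 : size (riley (0 : F)) = p./2.+1 by rewrite r0E' size_scale.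
have sP : size P = p./2.+1.
  apply/eqP; rewrite eqn_leq; apply/andP; split.
    by apply: leq_trans (size_riley _) _; lia.
  by rewrite -s0 -(PE 0) size_poly.
have P0 : P != 0 by rewrite -size_poly_gt0 sP.
have lP0 : (lead_coef P).[0] != 0.
  rewrite lead_coefE sP /= -[_.[0]]/(horner_eval 0 P`_p./2) -coef_map PE.
  have -> : p./2 = (size (riley (0 : F))).-1 by rewrite s0.
  by rewrite -lead_coefE lead_coef_eq0 -size_poly_gt0 s0.
have P'E : lead_coef P^`() = lead_coef P *+ p./2 /\ size P^`() = p./2.
  have c1 : P^`()`_p./2.-1 = lead_coef P *+ p./2.
    by rewrite coef_deriv lead_coefE sP /= prednK //; lia.
  have n0 : lead_coef P *+ p./2 != 0.
    by rewrite -scaler_nat scaler_eq0 pnatr_eq0 lead_coef_eq0 (negbTE P0) orbF; lia.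
  have sP' : size P^`() = p./2.
    apply/eqP; rewrite eqn_leq; apply/andP; split.
      by apply/leq_sizeP => j hj; rewrite coef_deriv nth_default ?mul0rn // sP; lia.
    rewrite leqNgt; apply/negP => hs.
    have hs' : (size P^`() <= p./2.-1)%N by move: hs; lia.
    by move: n0; rewrite -c1 nth_default ?eqxx.
  by rewrite lead_coefE sP' c1.
have P'n m : map_poly (horner_eval m) P^`() = (riley m)^`().
  by rewrite -deriv_map PE.
have hres : (resultant P P^`()).[0] != 0.
  have lP'0 : (lead_coef P^`()).[0] != 0.
    have [-> _] := P'E.
    by rewrite -scaler_nat hornerZ mulf_neq0 // pnatr_eq0; lia.
  rewrite -[_.[0]]/(horner_eval 0 (resultant P P^`())) map_resultant //.
  rewrite PE P'n resultant_eq0 -leqNgt.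
  suff /eqP -> : coprimep (riley (0 : F)) (riley 0)^`() by [].
  apply: Pdiv.ClosedField.root_coprimep => x.
  rewrite r0E' rootZ // => /rootP d0.
  by rewrite derivZ hornerZ mulf_neq0 // dih_separable.
have ev (g : {poly F}) m : (P.[g]).[m] = (riley m).[g.[m]].
  by rewrite -PE -[g.[m]]/(horner_eval m g) horner_map.
(* The factors express, in this order, the degree, the absence of double roots,
   the values at 0 and at m^2 - 1, and m^2 <> 1. *)
exists (lead_coef P * resultant P P^`() * P.[0] * P.['X^2 - 1] * ('X^2 - 1)).
  apply/eqP => /(congr1 (horner^~ 0)) /eqP; apply/negP.
  rewrite horner0 !hornerM !ev !hornerE expr0n sub0r r0E' !hornerZ.
  rewrite dih_at_0 dih_at_m1 mulr1 !mulf_neq0 ?signr_eq0 ?oppr_eq0 ?oner_eq0 //.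
  by rewrite -natrM nat1r pnatr_eq0.
move=> m; rewrite !hornerM !ev !mulf_eq0 !negb_or !hornerE.
move=> /andP[/andP[/andP[/andP[lm rm] h0] hs] m1].
have sm : size (riley m) = p./2.+1.
  by rewrite -(PE m) size_map_poly_id0 // sP.
split=> //; last by rewrite -subr_eq0.
have [|| [U V] _ /(congr1 (map_poly (horner_eval m)))] :=
    @resultant_in_ideal _ P P^`().
- by rewrite sP ltnS ltnW.
- by have [_ ->] := P'E.
rewrite /= map_polyC rmorphD !rmorphM /= PE P'n horner_evalE => E.
apply/Bezout_coprimepP; exists (map_poly (horner_eval m) U, map_poly (horner_eval m) V).
by rewrite /= -E polyC_eqp1.
Qed.

End Generic.

End Riley.

(** * The orthogonal frame of a representation *)

Section QuaternionMaps.

Variable B : comNzRingType.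
Variables (s u m : B).
Implicit Types x y : quat B.

Local Notation word := (qword s u m).

Definition qstar x := Quat (qr x) (qS x) (- qN x) (qH x).
Definition qflip x := Quat (qr x) (- qS x) (- qN x) (qH x).
Definition qswap x := Quat (qr x) (qS x) (- qN x) (- qH x).

Lemma qmulr1 x : qmul s u x (qone B) = x.
Proof. by case: x => *; congr Quat => /=; ring. Qed.

Lemma qword_swap v : word (swap v) = qswap (word v).
Proof.
elim: v => [|[j e] v IH]; first by rewrite /qswap /= oppr0.
rewrite /= IH.
by case: (ord2P j) => ->; case: e; congr Quat => /=; ring.
Qed.

Lemma qword_rev_swap v : word (rev (swap v)) = qstar (word v).
Proof.
elim: v => [|[j e] v IH]; first by rewrite /qstar /= oppr0.
rewrite /swap /= -/(swap v) rev_cons -cats1 qword_cat IH.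
rewrite [word [:: _]]/= qmulr1.
by case: (ord2P j) => ->; case: e; congr Quat => /=; ring.
Qed.

Definition flip (v : Defs.word) : Defs.word := [seq (a.1, ~~ a.2) | a <- v].

Lemma qword_flip v : word (flip v) = qflip (word v).
Proof.
elim: v => [|[j e] v IH]; first by rewrite /qflip /= oppr0.
rewrite /= IH.
by case: (j == 0); case: e; congr Quat => /=; ring.
Qed.

End QuaternionMaps.

Section QuaternionEval.

Variables (F : fieldType) (S N : 'M[F]_2) (s u : F).
Hypotheses (SS : S * S = s%:M) (NN : N * N = u%:M) (NS : N * S = - (S * N)).

Definition qev (x : quat F) : 'M[F]_2 :=
  (qr x)%:M + qS x *: S + qN x *: N + qH x *: (S * N).

Let scalarMl (a : F) (A : 'M[F]_2) : a%:M * A = a *: A.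
Proof. exact: mul_scalar_mx. Qed.

Let scalarMr (a : F) (A : 'M[F]_2) : A * a%:M = a *: A.
Proof. exact: mul_mx_scalar. Qed.

Lemma qev_mulS y : S * qev y = qev (Quat (s * qS y) (qr y) (s * qH y) (qN y)).
Proof.
have SSN : S * (S * N) = s *: N by rewrite mulrA SS scalarMl.
rewrite /qev /= !mulrDr -!scalerAr SSN SS scalarMr.
move: (S * N) => H.
by apply: mx2P; rewrite !mxE; ring.
Qed.

Lemma qev_mulN y :
  N * qev y = qev (Quat (u * qN y) (- u * qH y) (qr y) (- qS y)).
Proof.
have NSN : N * (S * N) = - u *: S by rewrite mulrA NS mulNr -mulrA NN scalarMr scaleNr.
rewrite /qev /= !mulrDr -!scalerAr NSN NN NS scalarMr.
move: (S * N) => H.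
by apply: mx2P; rewrite !mxE; ring.
Qed.

Lemma qev_mul x y : qev (qmul s u x y) = qev x * qev y.
Proof.
have SNe : S * N * qev y = qev (Quat (s * (- u * qH y)) (u * qN y)
    (s * (- qS y)) (qr y)).
  by rewrite -mulrA qev_mulN qev_mulS.
rewrite {2}/qev !mulrDl -!scalerAl SNe qev_mulN qev_mulS scalarMl /qev /=.
move: (S * N) => H.
by apply: mx2P; rewrite !mxE; ring.
Qed.

End QuaternionEval.

Section Frame.

Variable R : realType.
Local Notation C := R[i].

Lemma mxtraceC (A B : 'M[C]_2) : \tr (A * B) = \tr (B * A).
Proof. exact: mxtrace_mulC. Qed.

Lemma sl2_anticomm (A B : 'M[C]_2) : \tr A = 0 -> \tr B = 0 ->
  A * B + B * A = (\tr (A * B))%:M.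
Proof.
rewrite !trmx2E => /eqP; rewrite addrC addr_eq0 => /eqP hA /eqP.
rewrite addrC addr_eq0 => /eqP hB.
by apply: mx2P; rewrite !(mulmx2E, mxE) /= ?mulr1n ?mulr0n hA hB; ring.
Qed.

Variable rho : rep R.
Variable m : C.
Hypothesis det_rho : forall j, \det (rho j) = 1.
Hypothesis tr_rho : forall j, \tr (rho j) = 2 * m.

Definition Sx : 'M[C]_2 := 2^-1 *: (rho 0 + rho 1) - m%:M.
Definition Nx : 'M[C]_2 := 2^-1 *: (rho 0 - rho 1).
Definition ux : C := \tr (Nx * Nx) / 2.
Definition sx : C := m ^+ 2 - 1 - ux.

Lemma tr_Sx : \tr Sx = 0.
Proof.
by rewrite /Sx linearB /= linearZ /= linearD /= !tr_rho mxtrace_scalar; field.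
Qed.

Lemma tr_Nx : \tr Nx = 0.
Proof. by rewrite /Nx linearZ /= linearB /= !tr_rho subrr mulr0. Qed.

Lemma rho0E : rho 0 = m%:M + Sx + Nx.
Proof. by apply: mx2P; rewrite !mxE; field. Qed.

Lemma rho1E : rho 1 = m%:M + Sx - Nx.
Proof. by apply: mx2P; rewrite !mxE; field. Qed.

Lemma sqr_traceless (A : 'M[C]_2) : \tr A = 0 -> A * A = (\tr (A * A) / 2)%:M.
Proof.
move=> tA; rewrite mulrC -scale_scalar_mx -(sl2_anticomm tA tA).
by apply: mx2P; rewrite !mxE; field.
Qed.

Lemma NNx : Nx * Nx = ux%:M.
Proof. exact: sqr_traceless tr_Nx. Qed.

Lemma tr_sqr j : \tr (rho j * rho j) = 4 * m ^+ 2 - 2.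
Proof.
have := det_rho j; have := tr_rho j.
rewrite !trmx2E det2E !mulmx2E => /eqP; rewrite -subr_eq0 => /eqP t /eqP.
rewrite -subr_eq0 => /eqP d; apply/eqP; rewrite -subr_eq0; apply/eqP.
rewrite -[RHS](mulr0 (- 2)) -[in RHS]d.
transitivity (0 * (rho j 0 0 + rho j 1 1 + 2 * m) - 2 * (rho j 0 0 * rho j 1 1 - rho j 0 1 * rho j 1 0 - 1)).
  rewrite -[in RHS]t; ring.
ring.
Qed.

Lemma tr_frame : \tr (Sx * Sx) + \tr (Nx * Nx) = 2 * (m ^+ 2 - 1) /\
  \tr (Sx * Nx) = 0.
Proof.
have := tr_sqr 0; have := tr_sqr 1; rewrite rho0E rho1E.
have := tr_Sx; have := tr_Nx; move: Sx Nx => S N.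
rewrite !trmx2E => /eqP; rewrite addrC addr_eq0 => /eqP hN /eqP.
rewrite addrC addr_eq0 => /eqP hS.
rewrite !(mulmx2E, mxE) /= ?mulr1n ?mulr0n hS hN => h1 h0.
split.
  transitivity (2^-1 * ((4 * m ^+ 2 - 2) + (4 * m ^+ 2 - 2)) - 2 * m ^+ 2); last by field.
  by rewrite -{1}h0 -h1; field.
transitivity (4^-1 * ((4 * m ^+ 2 - 2) - (4 * m ^+ 2 - 2))); last by field.
by rewrite -{1}h0 -h1; field.
Qed.

Lemma SSx : Sx * Sx = sx%:M.
Proof.
rewrite (sqr_traceless tr_Sx); congr (_%:M).
rewrite /sx /ux; have [] := tr_frame.
move: (\tr (Sx * Sx)) (\tr (Nx * Nx)) => s u h _.
transitivity ((s + u) / 2 - u / 2); first by field.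
by rewrite h; field.
Qed.

Lemma NSx : Nx * Sx = - (Sx * Nx).
Proof.
apply/eqP; rewrite -addr_eq0 addrC; apply/eqP.
have [_ h] := tr_frame.
by rewrite (sl2_anticomm tr_Sx tr_Nx) h -scalemx1 scale0r.
Qed.

(** S, N and S N realize the quaternion algebra with parameters s and u. *)
Definition frame_mx : quat C -> 'M[C]_2 := qev Sx Nx.
Local Notation ev := frame_mx.

Lemma tr_ev x : \tr (ev x) = 2 * qr x.
Proof.
have [_] := tr_frame; have := tr_Sx; have := tr_Nx.
rewrite /frame_mx /qev; move: (Sx * Nx) Sx Nx => H S N tN tS tH.
rewrite !mxtraceD !mxtraceZ tS tN tH mxtrace_scalar !mulr0 !addr0.
by rewrite mulr_natl.
Qed.

Lemma ev_mul x y : ev (qmul sx ux x y) = ev x * ev y.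
Proof. exact: (qev_mul SSx NNx NSx). Qed.

Lemma ev_one : ev (qone C) = 1.
Proof. by rewrite /frame_mx /qev /= !scale0r !addr0. Qed.

Lemma ev_gen a : ev (qgen m a) = reval rho [:: a].
Proof.
case: a => j b; rewrite reval1 /=.
have gen : ev (Quat m 1 (if j == 0 then 1 else -1) 0) = rho j.
  rewrite /frame_mx /qev /= scale1r scale0r addr0.
  by case: (ord2P j) => -> /=; rewrite ?scale1r ?scaleN1r ?rho0E ?rho1E.
case: b => //; rewrite mx2_inv // tr_rho -gen /frame_mx /qev /=.
move: (Sx * Nx) => H; move: Sx Nx => S N.
by move: (if _ then _ else _) => e; apply: mx2P; rewrite !mxE /= ?mulr1n ?mulr0n; ring.
Qed.

Lemma ev_word v : ev (qword sx ux m v) = reval rho v.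
Proof.
elim: v => [|a v IH]; first by rewrite ev_one reval_nil.
by rewrite -cat1s reval_cat -IH -ev_gen -ev_mul.
Qed.

Lemma qword_horner v :
  qword sx ux m v = qmap (horner^~ ux) (pword m v).
Proof.
rewrite -[horner^~ ux]/(horner_eval ux) /pword qmap_word /= !horner_evalE.
by rewrite /spoly !hornerE.
Qed.

End Frame.

Section QuaternionWords.

Variable B : comNzRingType.
Variables (s u m : B).
Hypothesis norm_gen : s + u = m ^+ 2 - 1.

Let uE : u = m ^+ 2 - 1 - s. Proof. by rewrite -norm_gen; ring. Qed.

Lemma qconj_mul (x y : quat B) :
  qconj (qmul s u x y) = qmul s u (qconj y) (qconj x).
Proof. by congr Quat => /=; ring. Qed.

Lemma qword_winv v : qword s u m (winv v) = qconj (qword s u m v).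
Proof.
elim: v => [|a v IH]; first by rewrite /qconj /= !oppr0.
rewrite -cat1s winv_cat !qword_cat IH qconj_mul; congr qmul.
rewrite winv1 /= !qmulr1.
by case: a => j [] //; rewrite /qconj /= !opprK.
Qed.

End QuaternionWords.

Lemma bracket_anticomm (T : pzRingType) (A B Y : T) :
  A * Y = - (Y * A) -> B * Y = - (Y * B) ->
  (A * B - B * A) * Y = Y * (A * B - B * A).
Proof.
move=> hA hB; rewrite mulrBl mulrBr -!mulrA hB hA !mulrN !mulrA hA hB.
by rewrite !mulNr !opprK.
Qed.

Section KnotRelation.

Variable R : realType.
Local Notation C := R[i].

(** Both vectors are orthogonal to Y, hence anticommute with it, so their
    bracket commutes with Y. *)
Lemma bracket_orthogonal (A B Y : 'M[C]_2) (u : C) : u != 0 ->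
  \tr A = 0 -> \tr B = 0 -> \tr Y = 0 -> Y * Y = u%:M ->
  \tr (A * Y) = 0 -> \tr (B * Y) = 0 ->
  A * B - B * A = (\tr ((A * B - B * A) * Y) / (2 * u)) *: Y.
Proof.
move=> u0 tA tB tY YY tAY tBY.
have anti (X : 'M[C]_2) : \tr X = 0 -> \tr (X * Y) = 0 -> X * Y = - (Y * X).
  move=> tX tXY; apply/eqP; rewrite -addr_eq0; apply/eqP.
  by rewrite (sl2_anticomm tX tY) tXY -scalemx1 scale0r.
set D := A * B - B * A.
have tD : \tr D = 0 by rewrite /D linearB /= mxtraceC subrr.
have comm : D * Y = Y * D.
  by apply: bracket_anticomm; exact: anti.
have DY : D * Y = (\tr (D * Y) / 2)%:M.
  have := sl2_anticomm tD tY; rewrite -comm => h.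
  by rewrite mulrC -scale_scalar_mx -h; move: (D * Y) => X; apply: mx2P; rewrite !mxE; field.
have : D * Y * Y = (\tr (D * Y) / 2) *: Y by rewrite {1}DY; exact: mul_scalar_mx.
rewrite -mulrA YY -[D * _]/(D *m _) mul_mx_scalar => h.
apply: (scalerI u0); rewrite h scalerA; congr (_ *: _).
by move: (\tr _) => d; field.
Qed.

Variable rho : rep R.
Variable m : C.
Hypothesis det_rho : forall j, \det (rho j) = 1.
Hypothesis tr_rho : forall j, \tr (rho j) = 2 * m.

Local Notation S := (Sx rho m).
Local Notation N := (Nx rho).
Local Notation u := (ux rho).
Local Notation s := (sx rho m).
Local Notation ev := (frame_mx rho m).
Local Notation qw := (qword s u m).
Local Notation rv := (reval rho).

Let evw v : ev (qw v) = rv v. Proof. exact: ev_word. Qed.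

Let evN : ev (Quat 0 0 1 0) = N.
Proof. by rewrite /frame_mx /qev /= scale1r !scale0r -scalemx1 scale0r !add0r addr0. Qed.

Let evM x y : ev (qmul s u x y) = ev x * ev y. Proof. exact: ev_mul. Qed.

Lemma tr_N_ev x : \tr (N * ev x) = 2 * u * qN x.
Proof. by rewrite -evN -evM tr_ev //=; ring. Qed.

Lemma swap_N v : rv (swap v) * N = N * rv (flip v).
Proof.
rewrite -!evw -evN -!evM qword_swap qword_flip; congr ev.
by case: (qw v) => *; congr Quat => /=; ring.
Qed.

Lemma N_winv v : N * rv (winv v) = rv (rev (swap v)) * N.
Proof.
rewrite -!evw -evN -!evM qword_winv qword_rev_swap; congr ev.
by case: (qw v) => *; congr Quat => /=; ring.
Qed.

Lemma swap_antisym v : winv v = swap v -> (rv v)^-1 * N = N * rv (flip v).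
Proof. by move=> h; rewrite -reval_winv // h swap_N. Qed.

Variables (p : nat) (q : int).
Hypothesis pq : schubert_normal_form p q.

Local Notation w := (wK p q).

(** The knot word read backwards is the knot word with g1 and g2 exchanged, so
    that g2 w arises from w g1 by reversing the order and exchanging the
    generators.  On quaternions this only changes the sign of the component of
    N. *)
Lemma riley_eq : rv w * rho 0 - rho 1 * rv w = (2 * (riley p q m).[u]) *: N.
Proof.
rewrite (_ : rv w * rho 0 = rv (w ++ [:: g1])); last by rewrite reval_cat reval1.
rewrite (_ : rho 1 * rv w = rv (rev (swap (w ++ [:: g1])))); last first.
  rewrite /swap map_cat -/(swap w) rev_cat reval_cat -rev_wK // revK.
  by rewrite reval1 /= subr0.
rewrite -!evw qword_rev_swap /riley.
have -> : (qN (pword m (w ++ [:: g1]))).[u] = qN (qw (w ++ [:: g1])).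
  by rewrite qword_horner.
case: (qw _) => a b c d; rewrite /frame_mx /qev /qstar /=.
move: (S * N) => H; move: S N => S N.
by apply: mx2P; rewrite !mxE; ring.
Qed.

Lemma relator_conj :
  rv (relator p q) = 1 <-> rv w * rho 0 = rho 1 * rv w.
Proof.
rewrite /relator !reval_cat !reval_winv // !reval1 /= !mulrA.
have uw := reval_unit det_rho w; have u1 := rho_unit det_rho 1.
split=> [h | ->]; last by rewrite mulrK // mulrV.
have /(congr1 (fun X => X * rho 1 * rv w)) := h.
by rewrite mul1r mulrVK // mulrVK.
Qed.

End KnotRelation.

(** * Variation of the relator *)

Section UnitRingFox.

Variable T : unitRingType.
Implicit Types W y z f : T.

Lemma fox_relator_identity W y z fW fy fz :
  W \is a GRing.unit -> z \is a GRing.unit -> W * y = z * W ->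
  (fW * (y * (W^-1 * z^-1)) + W * (fy * (W^-1 * z^-1) +
     y * (- (W^-1 * fW * W^-1) * z^-1 + W^-1 * - (z^-1 * fz * z^-1)))) *
  (z * W) = fW * y + W * fy - (fz * W + z * fW).
Proof.
move=> uW uz h.
have cancel (X : T) : X * (W^-1 * z^-1) * (z * W) = X.
  by rewrite -!mulrA mulKr // mulVr // mulr1.
have e3 : W * (y * (- (W^-1 * fW * W^-1) * z^-1)) = - (z * fW) * (W^-1 * z^-1).
  by rewrite !mulNr !mulrN !mulrA h mulrK.
have e4 : W * (y * (W^-1 * - (z^-1 * fz * z^-1))) = - (fz * W) * (W^-1 * z^-1).
  rewrite !mulrN !mulNr !mulrA h mulrK // mulrV // mul1r.
  by rewrite mulrK.
rewrite !(mulrDr y) !(mulrDr W) e3 e4 (mulrA fW) (mulrA W) -!mulrDl cancel.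
by rewrite -addrA opprD [- (z * fW) - _]addrC.
Qed.

Lemma fox_relator_identity2 W y z fW fy fz :
  W \is a GRing.unit -> W * y = z * W ->
  (fW * y + W * fy - (fz * W + z * fW)) * W^-1 =
  fW * W^-1 * z + W * fy * W^-1 - (fz + z * (fW * W^-1)).
Proof.
move=> uW h.
have hi : y * W^-1 = W^-1 * z by apply: (mulrI uW); rewrite !mulrA h mulrK // mulrV // mul1r.
by rewrite mulrBl !mulrDl -(mulrA fW y) hi mulrK // !mulrA.
Qed.

Lemma fox_rotation_identity v f f' : v \is a GRing.unit ->
  f * v^-1 + v * f' = v * (f' * v + v^-1 * f) * v^-1.
Proof.
by move=> uv; rewrite mulrDr mulVKr // mulrDl mulrA mulrK // addrC.
Qed.

Lemma relation_conj W y z : W \is a GRing.unit -> z \is a GRing.unit ->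
  W * (y * (W^-1 * z^-1)) = 1 -> W * y = z * W.
Proof.
move=> uW uz /(congr1 (fun X => X * z * W)).
by rewrite mul1r !mulrA mulrVK // mulrVK.
Qed.

End UnitRingFox.

Section FoxRelator.

Variable R : realType.
Local Notation C := R[i].
Variable rho : rep R.
Hypothesis det_rho : forall j, \det (rho j) = 1.

Local Notation rv := (reval rho).
Local Notation fx := (fox rho).

Let gen (i : 'I_2) : word := [:: (i, false)].

Let rvgen i : rv (gen i) = rho i. Proof. by rewrite reval1. Qed.

Lemma reval_relator W (i j : 'I_2) :
  rv (W ++ gen i ++ winv W ++ winv (gen j)) =
  rv W * (rho i * ((rv W)^-1 * (rho j)^-1)).
Proof.
rewrite (reval_cat rho W) (reval_cat rho (gen i)) (reval_cat rho (winv W)).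
by rewrite (reval_winv det_rho W) (reval_winv det_rho (gen j)) !rvgen.
Qed.

Lemma fox_relator x W (i j : 'I_2) : rv W * rho i = rho j * rv W ->
  fx x (W ++ gen i ++ winv W ++ winv (gen j)) * (rho j * rv W) =
  fx x (W ++ gen i) - fx x (gen j ++ W).
Proof.
move=> h.
rewrite (fox_cat det_rho x W (gen i ++ _)) (fox_cat det_rho x (gen i)).
rewrite (fox_cat det_rho x (winv W)) !reval_cat !fox_winv // !reval_winv // !rvgen.
rewrite (fox_cat det_rho x W) (fox_cat det_rho x (gen j)) !rvgen.
exact: fox_relator_identity (reval_unit det_rho W) (rho_unit det_rho j) h.
Qed.

(** For a relation w g = h w, pairing the variation of the relator with h leaves
    the difference of the variations of the traces of g and h: the variation of w
    contributes a commutator. *)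
Lemma tr_fox_relator x W (i j : 'I_2) : rv W * rho i = rho j * rv W ->
  \tr (fx x (W ++ gen i ++ winv W ++ winv (gen j)) * rho j) =
  \tr (fx x (gen i)) - \tr (fx x (gen j)).
Proof.
move=> h; have uW := reval_unit det_rho W.
have -> : forall X, X * rho j = X * (rho j * rv W) * (rv W)^-1.
  by move=> X; rewrite !mulrA mulrK.
rewrite fox_relator // !(fox_cat det_rho) !rvgen (fox_relator_identity2 _ _ _ uW h).
rewrite raddfB /= !mxtraceD (mxtrace_conj _ uW) (mxtraceC (rho j)).
by move: (\tr _) (\tr _) (\tr _) => a b c; ring.
Qed.

Variables (p : nat) (q : int).
Hypothesis pq : schubert_normal_form p q.
Hypothesis rel : rv (relator p q) = 1.

Local Notation w := (wK p q).
Local Notation r := (relator p q).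

Let wK_conj : rv w * rho 0 = rho 1 * rv w. Proof. exact/(relator_conj det_rho). Qed.

Definition torus_suffix : word := drop (torus_rot p q) r.

Let suffix_rotation : rv (take (torus_rot p q) r) = (rv torus_suffix)^-1.
Proof.
have uv := reval_unit det_rho torus_suffix.
by apply: (mulIr uv); rewrite mulVr // -(reval_cat rho (take _ r)) cat_take_drop.
Qed.

Let rot_relator : rot (torus_rot p q) r = torus_suffix ++ take (torus_rot p q) r.
Proof. by []. Qed.

Let reval_rot : rv (rot (torus_rot p q) r) = 1.
Proof.
rewrite rot_relator (reval_cat rho torus_suffix) suffix_rotation mulrV //.
exact: reval_unit.
Qed.

Let dualE : dual_relator p q =
  rev w ++ gen 1 ++ winv (rev w) ++ winv (gen 0). Proof. by []. Qed.

(** The dual relator is the inverse of a rotation of the relator. *)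
Lemma rev_wK_conj : rv (rev w) * rho 1 = rho 0 * rv (rev w).
Proof.
apply: relation_conj (reval_unit det_rho _) (rho_unit det_rho _) _.
by rewrite -reval_relator -dualE -torus_rotP // reval_winv // reval_rot invr1.
Qed.

(** The second 2-cell of the boundary torus exhibits the conjugate of the
    relator by the suffix as the inverse of the dual relator, in which the two
    generators are exchanged; [tr_fox_relator] applies to both relators. *)
Lemma tr_fox_suffix x (g3 := (rv torus_suffix)^-1 * rho 0 * rv torus_suffix) :
  \tr (fx x r * g3) = \tr (fx x (gen 0)) - \tr (fx x (gen 1)).
Proof.
set v := torus_suffix in g3 *; set v' := take (torus_rot p q) r.
have uv : rv v \is a GRing.unit by exact: reval_unit.
have v'E : rv v' = (rv v)^-1 by exact: suffix_rotation.
have rE : r = v' ++ v by rewrite cat_take_drop.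
have frot : fx x (v ++ v') = rv v * fx x r * (rv v)^-1.
  rewrite rE !(fox_cat det_rho) v'E; exact: fox_rotation_identity.
have fdual : fx x (dual_relator p q) = - (rv v * fx x r * (rv v)^-1).
  by rewrite -(torus_rotP pq) (fox_winv det_rho) reval_rot invr1 mul1r mulr1 -frot.
have := tr_fox_relator x rev_wK_conj; rewrite -dualE fdual mulNr linearN /= => h.
rewrite -[RHS]opprB -h opprK /g3.
by rewrite -!mulrA [RHS]mxtraceC -!mulrA.
Qed.

End FoxRelator.

(** * The tangent of the curve of representations *)

Section QuaternionDerivation.

Variable F : fieldType.
Variables (m u : F).

Let s : F := m ^+ 2 - 1 - u.

Hypothesis two0 : (2 : F) != 0.
Hypotheses (s0 : s != 0) (u0 : u != 0).

Definition qadd (x y : quat F) : quat F :=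
  Quat (qr x + qr y) (qS x + qS y) (qN x + qN y) (qH x + qH y).

Definition qat (x : quat {poly F}) : quat F := qmap (horner^~ u) x.

(** Along the curve on which m is constant and u varies, an orthogonal frame S,
    N with S^2 = s = m^2 - 1 - u and N^2 = u can be moved by dS = - S / 2s and
    dN = N / 2u; this is the derivative of a quaternion with polynomial
    components in that moving frame. *)
Definition qder (x : quat {poly F}) : quat F := Quat
  ((qr x)^`().[u])
  ((qS x)^`().[u] - (qS x).[u] / (2 * (m ^+ 2 - 1 - u)))
  ((qN x)^`().[u] + (qN x).[u] / (2 * u))
  ((qH x)^`().[u] + (qH x).[u] / (2 * u) - (qH x).[u] / (2 * (m ^+ 2 - 1 - u))).

(** The motion of the frame preserves S^2 = s, N^2 = u and N S = - S N. *)
Lemma qder_mul x y : qder (qmul (spoly m) 'X x y) =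
  qadd (qmul s u (qder x) (qat y)) (qmul s u (qat x) (qder y)).
Proof.
have s0' : m ^+ 2 - 1 - u != 0 := s0.
have hs : (spoly m).[u] = m ^+ 2 - 1 - u by rewrite /spoly !hornerE.
have ds : (spoly m)^`().[u] = - 1 by rewrite /spoly derivB derivC derivX !hornerE.
have dX : ('X : {poly F})^`().[u] = 1 by rewrite derivX hornerC.
have hX := hornerX u.
have dD (p q : {poly F}) : (p + q)^`().[u] = p^`().[u] + q^`().[u].
  by rewrite derivD hornerD.
have dN (p : {poly F}) : (- p)^`().[u] = - p^`().[u] by rewrite derivN hornerN.
have dM (p q : {poly F}) : (p * q)^`().[u] = p^`().[u] * q.[u] + p.[u] * q^`().[u].
  by rewrite derivM hornerD !hornerM.
case: x => a0 a1 a2 a3; case: y => b0 b1 b2 b3.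
rewrite /qder /qadd /qmul /qat /qmap /=.
move: (spoly m) 'X hs ds dX hX => sp X hs ds dX hX.
by congr Quat; rewrite !(dD, dN, dM, hornerD, hornerN, hornerM) ?hs ?hX ?ds ?dX /s;
  field; rewrite ?s0' ?u0 ?two0.
Qed.

Lemma qgen_const a : qgen m%:P a = qmap polyC (qgen m a).
Proof.
by case: a => j [] /=; rewrite /qgen /qmap /=; case: (j == 0);
  congr Quat; rewrite /= ?polyCN ?polyC1 ?polyC0 ?oppr0.
Qed.

Lemma qder_gen a : qder (qgen m%:P a) =
  Quat 0 (- (qS (qgen m a) / (2 * (m ^+ 2 - 1 - u)))) (qN (qgen m a) / (2 * u)) 0.
Proof.
rewrite qgen_const /qder /qmap /= !derivC !hornerC sub0r !add0r.
by case: a => j [] /=; rewrite ?oppr0 !mul0r subr0.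
Qed.

Lemma qat_word v : qat (pword m v) = qword s u m v.
Proof.
rewrite /qat -[horner^~ u]/(horner_eval u) /pword qmap_word /= !horner_evalE.
by rewrite /spoly !hornerE.
Qed.

Lemma qder_one : qder (qone _) = Quat 0 0 0 0.
Proof.
by rewrite /qder /= -polyC1 !derivC !hornerC !mul0r !addr0 subr0.
Qed.

Lemma qder_inv (j : 'I_2) (g := qgen m (j, false)) :
  qmul s u (qconj g) (qmul s u (qder (qgen m%:P (j, false))) (qconj g)) =
  qmul s u (qconj (qone _)) (qder (qgen m%:P (j, false))).
Proof.
have s0' : m ^+ 2 - 1 - u != 0 := s0.
rewrite qder_gen /g; case: (ord2P j) => -> /=; rewrite /qmul /=; congr Quat;
  rewrite /s; field; by rewrite ?s0' ?u0 ?two0.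
Qed.

End QuaternionDerivation.

Section Tangent.

Variable R : realType.
Local Notation C := R[i].
Variable rho : rep R.
Variable m : C.
Hypothesis det_rho : forall j, \det (rho j) = 1.
Hypothesis tr_rho : forall j, \tr (rho j) = 2 * m.

Local Notation u := (ux rho).
Local Notation s := (sx rho m).
Hypotheses (s0 : s != 0) (u0 : u != 0).
Local Notation ev := (frame_mx rho m).
Local Notation rv := (reval rho).
Local Notation qd := (qder m u).

Lemma ev_add x y : ev (qadd x y) = ev x + ev y.
Proof.
rewrite /frame_mx /qev /=; move: (Sx rho m * Nx rho) => H.
move: (Sx rho m) (Nx rho) => S N.
by apply: mx2P; rewrite !mxE; ring.
Qed.

(** The velocity of the moving frame, as a 1-cochain. *)
Definition tangent : cochain C 3 1 :=
  \matrix_(j < 2) sl2rv (ev (qd (qgen m%:P (j, false))) * (rho j)^-1).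

Lemma fox_tangent v : fox rho tangent v = ev (qd (pword m v)).
Proof.
have two0 : (2 : C) != 0 by rewrite pnatr_eq0.
have evM x y : ev (qmul s u x y) = ev x * ev y by exact: ev_mul.
have evz : ev (Quat 0 0 0 0) = 0.
  by rewrite /frame_mx /qev /= !scale0r -scalemx1 scale0r !addr0.
have gen j : fox rho tangent [:: (j, false)] = ev (qd (qgen m%:P (j, false))).
  rewrite fox_gen //.
  have -> : row j tangent = sl2rv (ev (qd (qgen m%:P (j, false))) * (rho j)^-1).
    by apply/rowP => k; rewrite !mxE.
  rewrite sl2mxK ?mulrVK ?rho_unit //.
  have -> : (rho j)^-1 = ev (qconj (qgen m (j, false))).
    have := ev_gen det_rho tr_rho (j, true); rewrite reval1 /= => <-.
    by [].
  rewrite -evM tr_ev // qder_gen.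
  rewrite (_ : qr _ = 0) ?mulr0 // {1}/sx.
  have s0' : m ^+ 2 - 1 - u != 0 := s0.
  move: (u) u0 s0' => z z0 s0'.
  by case: (ord2P j) => -> /=; field; rewrite ?s0' ?z0 ?two0.
have letter a : fox rho tangent [:: a] = ev (qd (qgen m%:P a)).
  case: a => j [] //; rewrite fox_inv1 // gen.
  have -> : (rho j)^-1 = ev (qconj (qgen m (j, false))).
    by have := ev_gen det_rho tr_rho (j, true); rewrite reval1 /= => <-.
  rewrite -mulrA -!evM qder_inv //.
  rewrite !qder_gen /frame_mx /qev /=; move: (Sx rho m * Nx rho) => H.
  move: (Sx rho m) (Nx rho) => S N.
  by apply: mx2P; rewrite !mxE; ring.
elim: v => [|a v IH]; first by rewrite fox_nil qder_one evz.
rewrite -cat1s (fox_cat det_rho) IH letter.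
rewrite [pword m _]/= -/(pword m v) qder_mul //.
rewrite ev_add !evM qat_word (ev_word det_rho tr_rho); congr (_ + _ * _).
rewrite -(ev_gen det_rho tr_rho) qgen_const; congr ev.
by rewrite /qat /qmap /= !hornerC; case: (qgen m a).
Qed.

End Tangent.

(** * The meridians of the boundary torus *)

Lemma split_identity (T : unitRingType) (A r N W F h x g : T) :
  A \is a GRing.unit -> g \is a GRing.unit -> x \is a GRing.unit ->
  h \is a GRing.unit -> A^-1 * N = N * (F * h) -> W = A * (g * (x * h)) ->
  A * r * A^-1 * (N * W^-1) = A * (r * (N * (F * (x^-1 * g^-1)))) * A^-1.
Proof.
move=> uA ug ux uh AN ->.
have -> : (A * (g * (x * h)))^-1 = h^-1 * (x^-1 * g^-1) * A^-1.
  by rewrite (invrM uA) ?(invrM ug) ?(invrM ux) // ?unitrMl // ?unitrMl // mulrA.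
rewrite -(mulrA (A * r)) (mulrA A^-1) AN -!mulrA.
by rewrite (mulVKr uh).
Qed.

Section Bracket.

Variable R : realType.
Local Notation C := R[i].
Variable rho : rep R.
Variable m : C.
Hypothesis det_rho : forall j, \det (rho j) = 1.
Hypothesis tr_rho : forall j, \tr (rho j) = 2 * m.

Local Notation S := (Sx rho m).
Local Notation N := (Nx rho).
Local Notation u := (ux rho).
Local Notation s := (sx rho m).
Local Notation ev := (frame_mx rho m).
Local Notation rv := (reval rho).
Hypotheses (s0 : s != 0) (u0 : u != 0).

Variables (p : nat) (q : int).
Hypothesis pq : schubert_normal_form p q.
Hypothesis rel : rv (relator p q) = 1.
Local Notation w := (wK p q).

Lemma wK_conj : rv w * rho 0 = rho 1 * rv w.
Proof. exact/(relator_conj det_rho). Qed.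

Lemma riley_root : (riley p q m).[u] = 0.
Proof.
have := riley_eq det_rho tr_rho pq; rewrite wK_conj subrr => /eqP.
rewrite eq_sym scaler_eq0 => /orP[|/eqP N0].
  by rewrite mulf_eq0 pnatr_eq0 /= => /eqP.
have := NNx tr_rho; rewrite N0 mul0r => /matrixP/(_ 0 0).
by rewrite !mxE => /esym/eqP; rewrite (negbTE u0).
Qed.

(** The direction in which the relator moves along the curve of characters. *)
Definition Yx : 'M[C]_2 := N * (rv w)^-1 * (rho 1)^-1.

Let NE : N = ev (Quat 0 0 1 0).
Proof. by rewrite /frame_mx /qev /= scale1r !scale0r -scalemx1 scale0r !add0r addr0. Qed.

(** Along the motion of the frame w g1 - g2 w = 2 riley(u) N, and riley(u)
    vanishes at the representation, so that only its derivative contributes. *)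
Lemma fox_tangent_relator :
  fox rho (tangent rho m) (relator p q) = (2 * (riley p q m)^`().[u]) *: Yx.
Proof.
set U := tangent rho m.
have uz := rho_unit det_rho 1; have uw := reval_unit det_rho w.
have h : fox rho U (relator p q) * (rho 1 * rv w) =
  (2 * (riley p q m)^`().[u]) *: N.
  rewrite (fox_relator det_rho U wK_conj) !fox_tangent //.
  have -> : [:: (1 : 'I_2, false)] ++ w = rev (swap (w ++ [:: g1])).
    rewrite /swap map_cat -/(swap w) rev_cat -(rev_wK pq) // revK /=.
    by congr ((_, _) :: _); apply: val_inj.
  rewrite /pword qword_rev_swap -/(pword m _).
  have := riley_root; rewrite /riley; case: (pword m _) => a b c d /= c0.
  rewrite NE /frame_mx /qev /= !derivN !hornerN c0 mul0r; move: (S * N) => H.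
  by move: S N => S' N'; apply: mx2P; rewrite !mxE; ring.
have -> : Yx = N * (rho 1 * rv w)^-1 by rewrite invrM // mulrA.
by rewrite scalerAl -h mulrK // unitrMl.
Qed.

Lemma tr_tangent_gen j : \tr (fox rho (tangent rho m) [:: (j, false)]) = 0.
Proof.
rewrite fox_tangent // tr_ev // -cat1s cats0.
rewrite [pword m _]/= qmulr1 qder_gen mulr0 //.
Qed.

Let wN : N * (rv w)^-1 = rv w * N.
Proof.
rewrite -(reval_winv det_rho) (N_winv det_rho tr_rho); congr (rv _ * _).
by rewrite -(rev_wK pq) revK.
Qed.

Let N_gen : N * (rho 1)^-1 = rho 0 * N.
Proof.
have := N_winv det_rho tr_rho [:: (1, false)].
by rewrite !reval1 /= subrr.
Qed.

Let Y_def : Yx = rv w * rho 0 * N.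
Proof. by rewrite /Yx wN -!mulrA N_gen. Qed.

Lemma Y_gen : Yx * rho 1 = N * (rv w)^-1.
Proof. by rewrite /Yx mulrVK // rho_unit. Qed.

Lemma Y_sqr : Yx * Yx = u%:M.
Proof.
rewrite {2}Y_def wK_conj mulrA [_ * (rho 1 * _)]mulrA Y_gen mulrVK ?reval_unit //.
exact: NNx tr_rho.
Qed.

Lemma tr_Y : \tr Yx = 0.
Proof.
rewrite Y_def mxtraceC -[rho 0](reval1 rho g1) -reval_cat.
rewrite -(ev_word det_rho tr_rho) (tr_N_ev det_rho tr_rho) qword_horner.
by rewrite [qN _]/= -/(riley p q m) riley_root mulr0.
Qed.

Lemma Y_inverts : rho 1 * Yx = Yx * (rho 1)^-1.
Proof.
have e : Yx = rv w * N * (rho 1)^-1 by rewrite /Yx wN.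
transitivity (rho 1 * (rv w * N * (rho 1)^-1)); first by rewrite -e.
by rewrite Y_def !mulrA -wK_conj.
Qed.

Lemma tr_bracket_Y (X : 'M[C]_2) : \tr (X * Yx) = 0 ->
  \tr ((rho 1 * X - X * rho 1) * Yx) = 2 * \tr (X * (Yx * rho 1)).
Proof.
move=> h.
have e : (rho 1)^-1 = (2 * m)%:M - rho 1 by rewrite mx2_inv // tr_rho.
have sc (A : 'M[C]_2) : A * (2 * m)%:M = (2 * m) *: A by exact: mul_mx_scalar.
have eX : X * (Yx * (rho 1)^-1) = (2 * m) *: (X * Yx) - X * (Yx * rho 1).
  by rewrite e mulrBr mulrBr sc -scalerAr.
rewrite mulrBl linearB /= -(mulrA (rho 1)) (mxtraceC (rho 1)).
rewrite -(mulrA X Yx) -(mulrA X (rho 1)) Y_inverts eX linearB /= linearZ /= h mulr0 sub0r opprK.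
by move: (\tr _) => z; ring.
Qed.

Lemma bracket_Y (X : 'M[C]_2) : \tr X = 2 * m ->
  \tr (rho 1 * Yx) = 0 -> \tr (X * Yx) = 0 ->
  rho 1 * X - X * rho 1 = (\tr (X * (N * (rv w)^-1)) / u) *: Yx.
Proof.
move=> tX h1 hX.
have cY (A : 'M[C]_2) : (A - m%:M) * Yx = A * Yx - m *: Yx.
  by rewrite mulrBl; congr (_ - _); exact: mul_scalar_mx.
have hm (A : 'M[C]_2) : \tr A = 2 * m -> \tr (A * Yx) = 0 ->
    \tr (A - m%:M) = 0 /\ \tr ((A - m%:M) * Yx) = 0.
  move=> tA hA; rewrite cY !linearB /= linearZ /= tr_Y hA tA mxtrace_scalar.
  by split; ring.
have [tb hb] := hm _ (tr_rho 1) h1; have [t3 h3] := hm _ tX hX.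
have com : (rho 1 - m%:M) * (X - m%:M) - (X - m%:M) * (rho 1 - m%:M) =
    rho 1 * X - X * rho 1.
  have scl (A : 'M[C]_2) : m%:M * A = m *: A by exact: mul_scalar_mx.
  have scr (A : 'M[C]_2) : A * m%:M = m *: A by exact: mul_mx_scalar.
  rewrite !mulrBl !mulrBr !scl !scr.
  move: (rho 1 * X) (X * rho 1) (rho 1) => D E A; clear.
  by apply: mx2P; rewrite !mxE; ring.
have := bracket_orthogonal u0 tb t3 tr_Y Y_sqr hb h3.
rewrite com => ->; rewrite tr_bracket_Y // Y_gen; congr (_ *: _).
by move: (\tr _) => z; field.
Qed.

Variables (v x : word) (e b : bool).
Hypothesis wE : w = v ++ (1, e) :: (0, b) :: x ++ [:: (1, ~~ e)].
Hypothesis anti : winv (v ++ [:: (1, e)]) = swap (v ++ [:: (1, e)]).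

(** The middle letters cancel after N has been moved to the left, which saves
    two letters of the word; this is where the knot must not be a torus
    knot. *)
Lemma tr_split : let A := rv (v ++ [:: (1, e)]) in
  \tr (A * rho 0 * A^-1 * (N * (rv w)^-1)) =
  \tr (N * rv (flip v ++ winv x ++ (if b then [:: g1; g1] else [::]))).
Proof.
move=> A.
have uA : A \is a GRing.unit by exact: reval_unit.
have AN : A^-1 * N = N * rv (flip (v ++ [:: (1, e)])).
  exact: swap_antisym.
set h := rv [:: (1, ~~ e)].
have uh : h \is a GRing.unit by exact: reval_unit.
have flipE : rv (flip (v ++ [:: (1, e)])) = rv (flip v) * h.
  by rewrite /flip map_cat -/(flip v) reval_cat.
set g := rv [:: (0, b)].
have wA : rv w = A * (g * (rv x * h)).
  by rewrite wE -!reval_cat; congr rv; rewrite -catA.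
rewrite flipE in AN.
rewrite (split_identity _ uA _ _ uh AN wA); try exact: reval_unit.
rewrite (mxtrace_conj _ uA) (mxtraceC (rho 0)) -mulrA; congr (\tr (_ * _)).
rewrite !reval_cat reval_winv // -!mulrA; congr (_ * (_ * _)).
rewrite /g reval1 /=; case: (b); rewrite ?invrK.
  by rewrite reval_cons reval1.
by rewrite mulVr ?rho_unit // reval_nil.
Qed.

End Bracket.

Lemma inverted_inv (T : unitRingType) (g y : T) : g \is a GRing.unit ->
  g * y = y * g^-1 -> g^-1 * y = y * g.
Proof. by move=> ug h; apply: (mulrI ug); rewrite mulVKr // mulrA h mulrVK. Qed.

Lemma conj_cube (K : fieldType) (T : unitAlgType K) (c : K) (g y : T) :
  g^-1 * y = y * g -> g * g * g = c *: (g * g) - g ->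
  g^-1 * (y * g) * g = c *: (y * g * g) - y * g.
Proof.
move=> gy g3; rewrite mulrA gy -!mulrA (mulrA g) g3 mulrBr -scalerAr.
by rewrite !mulrA.
Qed.

Lemma conj_suffix (T : unitRingType) (a r g : T) :
  a \is a GRing.unit -> r \is a GRing.unit -> g \is a GRing.unit ->
  ((a * r^-1)^-1 * g^-1)^-1 * r * ((a * r^-1)^-1 * g^-1) =
  g * (a * r * a^-1) * g^-1.
Proof.
move=> ua ur ug; have uar : a * r^-1 \is a GRing.unit by rewrite unitrMl ?unitrV.
rewrite (invrM (_ : (a * r^-1)^-1 \is a GRing.unit)) ?unitrV // !invrK.
by rewrite (invrM ua) ?unitrV // invrK !mulrA mulrVK.
Qed.

Section TorusPolynomial.

Variable R : realType.
Local Notation C := R[i].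
Variables (p : nat) (q : int).
Hypothesis pq : schubert_normal_form p q.
Variable m : C.

Local Notation w := (wK p q).

(** The representations that occur over a generic trace 2m. *)
Record generic_rep (rho : rep R) : Prop := GenericRep {
  gr_det : forall j, \det (rho j) = 1;
  gr_tr : forall j, \tr (rho j) = 2 * m;
  gr_s : sx rho m != 0;
  gr_u : ux rho != 0;
  gr_rel : reval rho (relator p q) = 1;
  gr_simple : (riley p q m)^`().[ux rho] != 0 }.

Section Rep.

Variable rho : rep R.
Hypothesis gr : generic_rep rho.

Let det_rho := gr_det gr.
Let tr_rho := gr_tr gr.
Let rel := gr_rel gr.

Local Notation N := (Nx rho).
Local Notation u := (ux rho).
Local Notation Y := (Yx rho p q).
Local Notation rv := (reval rho).

(** The meridian g3 at which the second 2-cell of the boundary torus is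
    attached. *)
Definition G3 : 'M[C]_2 :=
  (rv (torus_suffix p q))^-1 * rho 0 * rv (torus_suffix p q).

Lemma tr_G3 : \tr G3 = 2 * m.
Proof.
rewrite /G3 -mulrA mxtraceC -mulrA mulrV ?mulr1 ?tr_rho //.
exact: reval_unit.
Qed.

Let scale0 (x : C) : (2 * (riley p q m)^`().[u]) * x = 0 -> x = 0.
Proof.
by move/eqP; rewrite !mulf_eq0 pnatr_eq0 (negbTE (gr_simple gr)) => /eqP.
Qed.

(** The variation of the relator along the tangent is a multiple of Y, and the
    tangent preserves the traces of the meridians; therefore Y is orthogonal to
    g2 and to g3. *)
Lemma tr_Y_gen : \tr (rho 1 * Y) = 0.
Proof.
apply: scale0; have := tr_fox_relator det_rho (tangent rho m) (wK_conj det_rho rel).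
rewrite -[_ ++ _]/(relator p q) !(tr_tangent_gen det_rho tr_rho) ?(gr_s gr, gr_u gr) //.
rewrite (fox_tangent_relator det_rho tr_rho (gr_s gr) (gr_u gr) pq rel) subrr.
by rewrite -scalerAl linearZ /= (mxtraceC Y).
Qed.

Lemma tr_Y_G3 : \tr (G3 * Y) = 0.
Proof.
apply: scale0; have := tr_fox_suffix det_rho pq rel (tangent rho m).
rewrite /= -/G3 !(tr_tangent_gen det_rho tr_rho) ?(gr_s gr, gr_u gr) //.
rewrite (fox_tangent_relator det_rho tr_rho (gr_s gr) (gr_u gr) pq rel) subrr.
by rewrite -scalerAl linearZ /= (mxtraceC Y).
Qed.

Lemma bracket_G3 :
  rho 1 * G3 - G3 * rho 1 = (\tr (G3 * (N * (rv w)^-1)) / u) *: Y.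
Proof.
exact: (bracket_Y det_rho tr_rho (gr_u gr) pq rel tr_G3 tr_Y_gen tr_Y_G3).
Qed.

(** Conjugation by g2 reverses the sign of the pairing with [Y g2] on vectors
    whose conjugate is orthogonal to Y. *)
Lemma tr_conj_gen (X : 'M[C]_2) :
  \tr (rho 1 * X * (rho 1)^-1 * Y) = 0 ->
  \tr (rho 1 * X * (rho 1)^-1 * (Y * rho 1)) = - \tr (X * (Y * rho 1)).
Proof.
have u1 := rho_unit det_rho 1; set g := rho 1 in u1 *.
have gY : g^-1 * Y = Y * g.
  have h := Y_inverts det_rho tr_rho pq rel.
  exact: inverted_inv.
have g3 : g * g * g = (2 * m) *: (g * g) - g.
  have e := mx2_inv (det_rho 1); rewrite tr_rho -/g in e.
  have : g * g^-1 = (2 * m) *: g - g * g.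
    by rewrite e mulrBr; congr (_ - _); exact: mul_mx_scalar.
  rewrite mulrV // => /(congr1 (fun A => A * g)).
  rewrite mul1r mulrBl -scalerAl => e2.
  by rewrite [X in _ - X]e2 subKr.
have move1 Z : \tr (g * X * g^-1 * Z) = \tr (X * (g^-1 * Z * g)).
  rewrite -(mulrA (g * X)) -(mulrA g) (mxtraceC g); congr (\tr _).
  by rewrite -(mulrA X).
have e3 : g^-1 * (Y * g) * g = (2 * m) *: (Y * g * g) - Y * g.
  exact: conj_cube.
move=> h0; have h : \tr (X * (Y * g * g)) = 0.
  by apply: etrans h0; rewrite -gY; apply: esym; exact: move1.
apply: etrans (move1 (Y * g)) _.
by rewrite e3 mulrBr -scalerAr linearB /= linearZ /= h mulr0 sub0r.
Qed.

End Rep.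

(** The polynomial f such that [g2, g3] = f Y, where g2 and g3 are the
    meridians at which the two 2-cells of the boundary torus are attached.  Its
    degree is at least two less than that of the Riley polynomial, because the
    knot is not a torus knot. *)
Lemma torus_poly : q != 1 -> q != -1 ->
  exists2 F : {poly C}, (size F <= p./2.-1)%N &
    forall rho, generic_rep rho ->
      rho 1 * G3 rho - G3 rho * rho 1 = F.[ux rho] *: Yx rho p q.
Proof.
move=> q1 qN1.
have [v [e [b [x [wE anti rE]]]]] := torus_rot_split pq q1 qN1.
(* The word left over by [tr_split]; its length bounds the degree of f. *)
pose z : word := flip v ++ winv x ++ (if b then [:: g1; g1] else [::]).
exists ((if b then -2 else 2) *: qN (pword m z)).
  have wz : weight (p - 4 + b) (pword m z).
    have -> : (p - 4 + b = size (flip v ++ winv x) + b)%N.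
      move: (size_wK p q); rewrite wE /= !size_cat /= size_cat size_winv size_map /=.
      by lia.
    rewrite /z catA /pword qword_cat; apply: weight_mul; first exact: weight_word.
    by case: (b); [exact: weight_gen2 | exact: (weight_word m [::])].
  have [_ _ sN _] := wz; apply: leq_trans (size_scale_leq _ _) _.
  apply: leq_trans sN _; have [_ op _ _ _] := pq.
  move: (size_wK p q); rewrite wE /= !size_cat /= size_cat /=.
  by case: (b) => /=; lia.
move=> rho gr; have det_rho := gr_det gr; have tr_rho := gr_tr gr.
have rel := gr_rel gr; have u0 := gr_u gr.
rewrite bracket_G3 //; congr (_ *: _).
set A := reval rho (v ++ [:: (1, e)]).
have uA : A \is a GRing.unit by exact: reval_unit.
have tA : \tr (A * rho 0 * A^-1 * (Nx rho * (reval rho (wK p q))^-1)) =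
    2 * ux rho * (qN (pword m z)).[ux rho].
  rewrite (tr_split det_rho tr_rho wE anti) -/z -(ev_word det_rho tr_rho).
  by rewrite (tr_N_ev det_rho tr_rho) qword_horner.
rewrite hornerZ; move: tA (tr_Y_G3 gr) rE; rewrite /G3 /torus_suffix.
set t := drop _ _; case: (b) => tA t0 rE; last first.
  have At : reval rho t = A^-1.
    apply: (mulrI uA); rewrite mulrV // -reval_cat -catA /= -rE.
    exact: rel.
  by rewrite At invrK tA; field.
have tE : (reval rho t)^-1 * rho 0 * reval rho t =
    rho 1 * (A * rho 0 * A^-1) * (rho 1)^-1.
  have -> : reval rho t = (A * (rho 0)^-1)^-1 * (rho 1)^-1.
    rewrite rE reval_cat !(reval_winv det_rho) (reval1 rho g2) /=; congr (_^-1 * _).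
    by rewrite -[(0, true) :: _]cat1s -[_ :: [:: _]]cat1s catA reval_cat reval1.
  exact: conj_suffix uA (rho_unit det_rho 0) (rho_unit det_rho 1).
rewrite tE in t0 *.
have := tr_conj_gen gr t0; rewrite Y_gen // tA => ->.
by field.
Qed.

End TorusPolynomial.

(** * Torsion and the choice of lifts *)

Section TorsionIndependence.

(** The change of rows is block lower triangular with diagonal blocks A, 1, D. *)
Lemma det_block_change (F : fieldType) (n a c b : nat) (eN : n = (a + (c + b))%N)
    (r r' : nat -> 'rV[F]_n) (A : 'M[F]_a) (D : 'M[F]_b)
    (E : nat -> 'I_(a + c) -> F) :
  (forall k : 'I_a, r' k = \sum_(l < a) A k l *: r l) ->
  (forall k, (k < c)%N -> r' (a + k)%N = r (a + k)%N) ->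
  (forall k : 'I_b, r' (a + (c + k))%N =
     \sum_(l < a + c) E k l *: r l + \sum_(l < b) D k l *: r (a + (c + l))%N) ->
  \det (\matrix_(k < n) r' k) = \det A * \det D * \det (\matrix_(k < n) r k).
Proof.
subst n => h1 h2 h3.
pose L : 'M[F]_(a + (c + b)) := block_mx A 0
  (col_mx 0 (\matrix_(k < b, l < a) E k (lshift c l)))
  (block_mx 1%:M 0 (\matrix_(k < b, l < c) E k (rshift a l)) D).
have dL : \det L = \det A * \det D by rewrite det_lblock det_lblock det1 mul1r.
have -> : \matrix_k r' k = L *m (\matrix_k r k).
  apply/row_matrixP => k; rewrite rowK row_mul mulmx_sum_row.
  under eq_bigr => i _ do rewrite rowK.
  case: (split_ordP k) => [i|j] ->.
    rewrite h1 big_split_ord /= [X in _ + X]big1 ?addr0 => [|l _].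
      by apply: eq_bigr => l _; rewrite mxE block_mxEul.
    by rewrite mxE block_mxEur mxE scale0r.
  case: (split_ordP j) => [i|i] ->.
    rewrite h2; last by rewrite /= ltn_ord.
    rewrite !big_split_ord /= big1 ?add0r => [|l _]; last first.
      by rewrite mxE block_mxEdl col_mxEu mxE scale0r.
    rewrite [X in _ + X]big1 ?addr0 => [|l _]; last first.
      by rewrite mxE block_mxEdr block_mxEur mxE scale0r.
    rewrite (eq_bigr (fun l : 'I_c => (i == l)%:R *: r (a + l)%N)); last first.
      by move=> l _; rewrite mxE block_mxEdr block_mxEul mxE.
    rewrite (bigD1 i) //= eqxx scale1r big1 ?addr0 // => l /negbTE li.
    by rewrite eq_sym li scale0r.
  rewrite h3 !big_split_ord /= -!addrA; congr (_ + (_ + _)); apply: eq_bigr => l _.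
  - by rewrite mxE block_mxEdl col_mxEd mxE.
  - by rewrite mxE block_mxEdr block_mxEdl mxE.
  - by rewrite mxE !block_mxEdr.
by rewrite det_mulmx dL.
Qed.

Section VectorSpaces.

Variables (F : fieldType) (V W : vectType F).

Lemma size_basis_seq (U : {vspace V}) X : basis_of U X -> size X = \dim U.
Proof. by move=> h; rewrite (size_basis (X := in_tuple X) h). Qed.

Lemma basis_exchange (U K : {vspace V}) X Y Z : basis_of U X -> basis_of U Y ->
  basis_of K (X ++ Z) -> basis_of K (Y ++ Z).
Proof.
move=> hX hY hXZ; rewrite basisEdim -(span_basis hXZ) !span_cat.
rewrite (span_basis hX) (span_basis hY) subvv /= -(span_basis hX) -span_cat.
rewrite (span_basis hXZ) -(size_basis_seq hXZ) !size_cat.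
by rewrite (size_basis_seq hX) (size_basis_seq hY).
Qed.

Definition change (X Y : seq V) : 'M[F]_(size X) :=
  \matrix_(k, l) coord (in_tuple X) l Y`_k.

Lemma changeE (U : {vspace V}) X Y k : basis_of U X -> basis_of U Y ->
  forall kX : (k < size X)%N,
  Y`_k = \sum_(l < size X) change X Y (Ordinal kX) l *: X`_l.
Proof.
move=> hX hY kX.
rewrite (coord_basis (X := in_tuple X) hX (v := Y`_k)); last first.
  by apply: (basis_mem hY); rewrite mem_nth // (size_basis_seq hY) -(size_basis_seq hX).
by apply: eq_bigr => l _; rewrite mxE.
Qed.

Lemma det_change_neq0 (U : {vspace V}) X Y : basis_of U X -> basis_of U Y ->
  \det (change X Y) != 0.
Proof.
move=> hX hY; apply/det0P => -[v v0 vC].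
have sXY : size Y = size X by rewrite (size_basis_seq hX) (size_basis_seq hY).
have := basis_free hY; rewrite -[Y]/(tval (in_tuple Y)) => /freeP.
move=> /(_ (fun k => v 0 (cast_ord sXY k))) fr.
case/eqP: v0; apply/rowP => k; rewrite mxE -[k](cast_ordKV sXY); apply: fr.
rewrite (reindex (cast_ord (esym sXY))) /=; last first.
  by exists (cast_ord sXY) => j _; rewrite ?cast_ordK ?cast_ordKV.
transitivity (\sum_(l < size X) (v *m change X Y) 0 l *: X`_l); last first.
  by rewrite vC big1 // => l _; rewrite mxE scale0r.
under [RHS]eq_bigr => l _ do rewrite mxE scaler_suml.
rewrite exchange_big /=; apply: eq_bigr => j _.
rewrite cast_ordKV (changeE hX hY (ltn_ord j)) scaler_sumr.
apply: eq_bigr => l _; rewrite scalerA.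
by congr (_ * change _ _ _ _ *: _); apply: val_inj.
Qed.

End VectorSpaces.

Section Complex.

Variables (F : fieldType) (d : nat).
Variable act : word -> {linear 'rV[F]_d -> 'rV[F]_d}.
Variable r : word.

Local Notation cc i := (cochain F d i).
Local Notation dl := (delta act r).

Lemma delta_sqr_cocycle i (x : cc i) : dl i x = 0 -> x \in cocycles act r i.
Proof. by move=> h; rewrite memv_ker h. Qed.

Definition is_lift (b : forall i, seq (cc i)) : Prop :=
  forall i, basis_of (limg (dl i)) [seq dl i x | x <- b i].

Lemma delta_prev_basis b i : is_lift b ->
  basis_of (coboundaries act r i) (delta_prev act r b i).
Proof.
move=> hb; case: i => [|i] /=; last exact: hb.
by rewrite basisEdim span_nil subvv dimv0.
Qed.

Lemma size_delta_prev b i : is_lift b ->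
  size (delta_prev act r b i) = \dim (coboundaries act r i).
Proof. by move=> hb; exact: size_basis_seq (delta_prev_basis i hb). Qed.

Lemma size_lift b i : is_lift b -> size (b i) = \dim (limg (dl i)).
Proof. by move=> hb; rewrite -(size_basis_seq (hb i)) size_map. Qed.

Variable h : forall i, seq (cc i).
Hypothesis hh : cohomology_basis act r h.

Lemma cocycles_basis b i : is_lift b ->
  basis_of (cocycles act r i) (delta_prev act r b i ++ h i).
Proof.
move=> hb; exact: basis_exchange (vbasisP _) (delta_prev_basis i hb) (hh i).
Qed.

Lemma size_cells b i : is_lift b ->
  (cells i * d = size (delta_prev act r b i) + (size (h i) + size (b i)))%N.
Proof.
move=> hb; rewrite addnA -size_cat (size_basis_seq (cocycles_basis i hb)) (size_lift i hb).
have := limg_ker_dim (dl i) fullv.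
by rewrite capfv dimvf => ->; rewrite /dim /=.
Qed.

Variables b b' : forall i, seq (cc i).
Hypotheses (hb : is_lift b) (hb' : is_lift b').

Let dp := delta_prev act r.

Lemma transition_det_change i :
  transition_det (dp b' i ++ h i ++ b' i) =
  \det (change (dp b i) (dp b' i)) * \det (change (dp b i.+1) (dp b' i.+1)) *
  transition_det (dp b i ++ h i ++ b i).
Proof.
set A := change _ _; set D := change _ _.
have sA : size (dp b' i) = size (dp b i) by rewrite !size_delta_prev.
have sD : size (dp b i.+1) = size (b i) by rewrite size_map.
have sB : size (b' i) = size (b i) by rewrite !size_lift.
pose X := cat_tuple (in_tuple (dp b i)) (in_tuple (h i)).
pose co (k : nat) (l : 'I_(size (dp b i.+1))) :=
  coord (in_tuple (dp b i.+1)) l (dp b' i.+1)`_k.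
pose y (k : nat) := (b' i)`_k - \sum_l co k l *: (b i)`_l.
have hB := delta_prev_basis i.+1 hb; have hB' := delta_prev_basis i.+1 hb'.
have yE k : (k < size (b i))%N -> y k = \sum_l coord X l (y k) *: X`_l.
  move=> kb; have hX : basis_of (cocycles act r i) X by exact: cocycles_basis i hb.
  apply: (coord_basis hX).
  apply: delta_sqr_cocycle; rewrite /y linearB /= linear_sum /=.
  have -> : dl i (b' i)`_k = (dp b' i.+1)`_k by rewrite (nth_map 0) ?sB.
  have kD : (k < size (dp b i.+1))%N by rewrite sD.
  rewrite (changeE hB hB' kD); apply/eqP; rewrite subr_eq0; apply/eqP.
  apply: eq_bigr => l _; rewrite mxE linearZ /=; congr (_ *: _).
  by rewrite (nth_map 0) // -sD.
have sN := size_cells i hb.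
rewrite /transition_det.
apply: (@det_block_change F _ _ (size (h i)) _ (etrans sN _)
  (fun k => mxvec (dp b i ++ h i ++ b i)`_k)
  (fun k => mxvec (dp b' i ++ h i ++ b' i)`_k) A D (fun k l => coord X l (y k))).
- by rewrite sD.
- move=> k; rewrite nth_cat sA ltn_ord.
  rewrite (changeE (delta_prev_basis i hb) (delta_prev_basis i hb') (ltn_ord k)).
  rewrite linear_sum; apply: eq_bigr => l _; rewrite linearZ /= nth_cat ltn_ord.
  by congr (change _ _ _ _ *: _); apply: val_inj.
- move=> k kh; by rewrite !nth_cat sA ltnNge leq_addr /= addKn kh.
- move=> k; have kb : (k < size (b i))%N by rewrite -sD.
  rewrite nth_cat sA ltnNge leq_addr /= addKn nth_cat ltnNge leq_addr /= addKn.
  have -> : (b' i)`_k = \sum_l coord X l (y k) *: X`_l + \sum_l co k l *: (b i)`_l.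
    by rewrite -yE // subrK.
  rewrite linearD !linear_sum; congr (_ + _); apply: eq_bigr => l _.
    by rewrite linearZ /= catA [in RHS]nth_cat size_cat ltn_ord.
  rewrite linearZ /= mxE nth_cat ltnNge leq_addr /= addKn nth_cat ltnNge leq_addr.
  by rewrite /= addKn.
Qed.

Definition tor_of (b : forall i, seq (cc i)) : F :=
  \prod_(i < 3) transition_det (dp b i ++ h i ++ b i) ^ ((-1) ^+ i : int).

Lemma tor_ofE l : tor_of l = transition_det (dp l 0 ++ h 0 ++ l 0) *
  (transition_det (dp l 1 ++ h 1 ++ l 1))^-1 * transition_det (dp l 2 ++ h 2 ++ l 2).
Proof.
rewrite /tor_of !big_ord_recl big_ord0 mulr1 mulrA.
by rewrite expr0 expr1 sqrrN expr1n !expr1z exprN1.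
Qed.

(** The torsion of a complex depends on the bases of its cohomology, not on the
    lifts of the coboundaries: a change of lift is seen once as a change of
    lift in degree i and once, with the opposite exponent, as a change of basis
    of the coboundaries in degree i + 1. *)
Lemma tor_of_unique : tor_of b' = tor_of b.
Proof.
rewrite !tor_ofE !transition_det_change.
pose k i := \det (change (dp b i) (dp b' i)).
rewrite -!/(k _).
have k0 i : k i != 0.
  exact: det_change_neq0 (delta_prev_basis i hb) (delta_prev_basis i hb').
have kE i : size (dp b i) = 0%N -> k i = 1.
  move=> s0; rewrite /k; move: (change _ _); rewrite s0 => M; exact: det_mx00.
have k3 : k 3 = 1.
  apply: kE; rewrite size_map size_lift //; apply/eqP; rewrite -leqn0.
  by have := dimvS (subvf (limg (dl 2))); rewrite dimvf.
rewrite (kE 0%N) // k3 !invfM.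
move: (k 1%N) (k 2) (k0 1%N) (k0 2) => x y x0 y0.
move: (transition_det _) (transition_det _)^-1 (transition_det _) => T0 T1 T2.
by field; rewrite x0 y0.
Qed.

End Complex.

End TorsionIndependence.

(** * Determinants of coordinates *)

Section Determinants.

Variable F : comNzRingType.

(** Matrices given by the list of their rows, whose minors are computed by deleting
    entries of lists. *)
Definition mxrows n (s : seq (seq F)) : 'M[F]_n :=
  \matrix_(i < n, j < n) nth 0 (nth [::] s i) j.

Definition del T k (s : seq T) := take k s ++ drop k.+1 s.

Lemma nth_del T (x0 : T) k s i : (k < size s)%N ->
  nth x0 (del k s) i = nth x0 s (bump k i).
Proof.
move=> ks; rewrite /del nth_cat size_take ks /bump.
case: ltnP => ik; first by rewrite nth_take // leqNgt ik.
by rewrite nth_drop addSn subnKC.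
Qed.

Lemma minor_mxrows n s i j : size s = n.+1 ->
  all (fun r => size r == n.+1) s ->
  row' i (col' j (mxrows n.+1 s)) = mxrows n (map (del j) (del i s)).
Proof.
move=> ss sr; apply/matrixP => k l; rewrite !mxE.
have si : size (del i s) = n.
  by rewrite /del size_cat size_take size_drop ss ltn_ord; have := ltn_ord i; lia.
have rk : nth [::] (del i s) k = nth [::] s (lift i k) by rewrite nth_del // ss.
by rewrite (nth_map [::]) ?si // rk nth_del // (eqP (all_nthP [::] sr _ _)) // ss.
Qed.

Lemma det_mxrows n s i : size s = n.+1 ->
  all (fun r => size r == n.+1) s -> (i < n.+1)%N ->
  \det (mxrows n.+1 s) = \sum_(j < n.+1) nth 0 (nth [::] s i) j *
    ((-1) ^+ (i + j) * \det (mxrows n (map (del j) (del i s)))).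
Proof.
move=> ss sr ni; rewrite (expand_det_row _ (Ordinal ni)); apply: eq_bigr => j _.
by rewrite /cofactor minor_mxrows // mxE.
Qed.

Lemma det_mxrows3 (x0 x1 x2 y0 y1 y2 z0 z1 z2 : F) :
  \det (mxrows 3 [:: [:: x0; x1; x2]; [:: y0; y1; y2]; [:: z0; z1; z2]]) =
  x0 * (y1 * z2 - y2 * z1) - x1 * (y0 * z2 - y2 * z0) + x2 * (y0 * z1 - y1 * z0).
Proof.
rewrite (@det_mxrows _ _ 0) //.
rewrite !big_ord_recl big_ord0 /=.
rewrite !(@det_mxrows 1 _ 0) //.
rewrite !big_ord_recl !big_ord0 /= !det_mx11 !mxE /=.
rewrite /bump /=; ring.
Qed.

(** The shape taken by the coordinates of a frame of 1-cochains: with the rows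
    proportional as they are, the two halves decouple. *)
Lemma det_frame (t1 t2 t3 t4 t5 t6 x e m f k : F) :
  \det (mxrows 6 [:: [:: 0; 0; 0; t1; x * e; x * m];
                     [:: t2; - (x * e); - (x * m); 0; 0; 0];
                     [:: t3; f * m; f; t4; f * m; f];
                     [:: 1; 0; 0; 0; 0; 0];
                     [:: 0; 0; 0; 1; 0; 0];
                     [:: t5; k * m; k; t6; - (k * m); - k]]) =
  2 * f * k * x ^+ 2 * (e - m ^+ 2) ^+ 2.
Proof.
rewrite (@det_mxrows _ _ 3) //.
rewrite !big_ord_recl big_ord0 /= !mul0r !addr0 mul1r.
rewrite (@det_mxrows _ _ 3) // !big_ord_recl big_ord0 /= !mul0r !add0r !addr0 mul1r.
rewrite (@det_mxrows _ _ 0) // !big_ord_recl big_ord0 /= !mul0r !add0r !addr0.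
by rewrite !det_mxrows3 /bump /=; ring.
Qed.

End Determinants.

(** * Cochains in the orthogonal frame *)

Fact pr_key : unit. Proof. by []. Qed.

Section Frame1.

Variable R : realType.
Local Notation C := R[i].
Variable rho : rep R.
Variable m : C.
Hypothesis det_rho : forall j, \det (rho j) = 1.
Hypothesis tr_rho : forall j, \tr (rho j) = 2 * m.

Local Notation u := (ux rho).
Local Notation s := (sx rho m).
Local Notation ev := (frame_mx rho m).
Local Notation rv := (reval rho).
Local Notation act := (adjoint_action rho).

Let evM x y : ev (qmul s u x y) = ev x * ev y. Proof. exact: ev_mul. Qed.

(** The vector of g with coordinates x, y, z in the frame S, N, H = S N. *)
Definition pr : C -> C -> C -> 'rV[C]_3 :=
  locked_with pr_key (fun x y z => sl2rv (ev (Quat 0 x y z))).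

Lemma prD x y z : pr x y z = sl2rv (ev (Quat 0 x y z)).
Proof. by rewrite /pr unlock. Qed.

Lemma pr_eq x y z x' y' z' : x = x' -> y = y' -> z = z' -> pr x y z = pr x' y' z'.
Proof. by move=> -> -> ->. Qed.

Lemma sl2mx_pr x y z : sl2mx (pr x y z) = ev (Quat 0 x y z).
Proof. by rewrite prD sl2mxK // tr_ev //= mulr0. Qed.

Lemma ev_lin x y z : ev (Quat 0 x y z) = x *: ev (Quat 0 1 0 0) +
  (y *: ev (Quat 0 0 1 0) + (z *: ev (Quat 0 0 0 1) + 0)).
Proof.
rewrite /frame_mx /qev /=.
move: (Sx rho m * Nx rho) => H; move: (Sx rho m) (Nx rho) => S N.
by apply: mx2P; rewrite !mxE; ring.
Qed.

Lemma prE x y z : pr x y z = x *: pr 1 0 0 + y *: pr 0 1 0 + z *: pr 0 0 1.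
Proof.
rewrite !prD (ev_lin x y z).
move: (ev (Quat 0 1 0 0)) (ev (Quat 0 0 1 0)) (ev (Quat 0 0 0 1)) => X Y Z.
by rewrite !linearD !linearZ linear0 addr0 addrA.
Qed.

Lemma pr_sub x y z x' y' z' : pr x y z - pr x' y' z' = pr (x - x') (y - y') (z - z').
Proof.
rewrite (prE x) (prE x') (prE (x - x')).
move: (pr 1 0 0) (pr 0 1 0) (pr 0 0 1) => A B D.
by apply/rowP => j; rewrite !mxE; ring.
Qed.

Lemma Ad_pr j x y z : let g := qgen m (j, false) in
  let d := qmul s u (qmul s u g (Quat 0 x y z)) (qconj g) in
  Ad rho [:: (j, false)] (pr x y z) = pr (qS d) (qN d) (qH d).
Proof.
move=> g d; apply: (can_inj (@sl2rvK R)).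
apply: etrans (sl2mx_Ad det_rho _ _) _.
rewrite [RHS]sl2mx_pr [sl2mx (pr x y z)]sl2mx_pr.
have -> : reval rho [:: (j, false)] = ev g by rewrite -(ev_gen det_rho tr_rho).
have -> : (ev g)^-1 = ev (qconj g).
  rewrite /g (ev_gen det_rho tr_rho) reval1 /=.
  by have := ev_gen det_rho tr_rho (j, true); rewrite reval1 /= => <-.
rewrite -!evM -/d; congr ev.
have d0 : qr d = 0.
  by rewrite /d /g /sx; case: (ord2P j) => -> /=; ring.
by clearbody d; case: d d0 => ? ? ? ? /= ->.
Qed.

(** A 1-cochain, from the coordinates of its value at g1 in the frame
    S + N, N, H and of its value at g2 in the frame S - N, N, H: the first
    vectors are the traceless parts of g1 and g2. *)
Definition glued : seq C -> cochain C 3 1 :=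
  locked_with pr_key (fun l : seq C =>
    \matrix_(j < 2) if j == 0 then pr l`_0 (l`_0 + l`_1) l`_2
                    else pr l`_3 (l`_4 - l`_3) l`_5).

Lemma row_glue0 l : row 0 (glued l) = pr l`_0 (l`_0 + l`_1) l`_2.
Proof. by rewrite /glued unlock rowK. Qed.

Lemma row_glue1 l : row 1 (glued l) = pr l`_3 (l`_4 - l`_3) l`_5.
Proof. by rewrite /glued unlock rowK. Qed.

Lemma cochain1P (x y : cochain C 3 1) : row 0 x = row 0 y -> row 1 x = row 1 y ->
  x = y.
Proof.
by move=> h0 h1; apply/row_matrixP => j; case: (ord2P j) => ->.
Qed.

Variable r : word.

Lemma delta0E (y : 'rV[C]_3) j :
  row j (delta act r 0 (y : cochain C 3 0)) = Ad rho [:: (j, false)] y - y.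
Proof.
rewrite lfunE /= rowK /=.
by have -> : row 0 y = y by apply/rowP => k; rewrite !mxE.
Qed.

Local Notation e := (m ^+ 2 - 1).

Lemma delta0_pr x y z l :
  (forall j, Ad rho [:: (j, false)] (pr x y z) - pr x y z =
    if j == 0 then pr l`_0 (l`_0 + l`_1) l`_2 else pr l`_3 (l`_4 - l`_3) l`_5) ->
  delta act r 0 (pr x y z) = glued l.
Proof.
by move=> h; apply/row_matrixP => j; rewrite delta0E /glued unlock rowK h.
Qed.

Lemma delta0_a : delta act r 0 (pr 1 1 0) =
  glued [:: 0; 0; 0; 4 * u; 4 * e; 4 * m].
Proof.
apply: delta0_pr => j; rewrite Ad_pr pr_sub /sx.
by case: (ord2P j) => ->; apply: pr_eq => /=; move: (ux rho) => z; ring.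
Qed.

Lemma delta0_b : delta act r 0 (pr 1 (-1) 0) =
  glued [:: 4 * u; - (4 * e); - (4 * m); 0; 0; 0].
Proof.
apply: delta0_pr => j; rewrite Ad_pr pr_sub /sx.
by case: (ord2P j) => ->; apply: pr_eq => /=; move: (ux rho) => z; ring.
Qed.

Lemma delta0_H : delta act r 0 (pr 0 0 1) =
  glued [:: - (2 * u * m); 2 * e * m; 2 * e; 2 * u * m; 2 * e * m; 2 * e].
Proof.
apply: delta0_pr => j; rewrite Ad_pr pr_sub /sx.
by case: (ord2P j) => ->; apply: pr_eq => /=; move: (ux rho) => z; ring.
Qed.

Hypotheses (s0 : s != 0) (u0 : u != 0).

Lemma row_tangent j : let g := qgen m (j, false) in
  let d := qmul s u (qder m u (qgen m%:P (j, false))) (qconj g) in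
  row j (tangent rho m) = pr (qS d) (qN d) (qH d).
Proof.
have s0' : m ^+ 2 - 1 - u != 0 := s0.
move=> g d; rewrite rowK prD; congr sl2rv.
have -> : (rho j)^-1 = ev (qconj g).
  by have := ev_gen det_rho tr_rho (j, true); rewrite reval1 /= => <-.
rewrite -evM -/d; congr ev.
have d0 : qr d = 0.
  rewrite /d /g /sx qder_gen; move: (ux rho) u0 s0' => z z0 s0'.
  have two0 : (2 : C) != 0 by rewrite pnatr_eq0.
  by case: (ord2P j) => -> /=; field; rewrite ?z0 ?s0' ?two0.
by clearbody d; case: d d0 => ? ? ? ? /= ->.
Qed.

Lemma tangentE : let k := e / (2 * (e - u) * u) in tangent rho m =
  glued [:: - (m / (2 * (e - u))); k * m; k;
           - (m / (2 * (e - u))); - (k * m); - k].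
Proof.
have s0' : m ^+ 2 - 1 - u != 0 := s0.
have two0 : (2 : C) != 0 by rewrite pnatr_eq0.
move=> k; apply: cochain1P; rewrite row_tangent ?row_glue0 ?row_glue1.
  apply: pr_eq; rewrite qder_gen /k /sx /=; move: (ux rho) u0 s0' => z z0 s0';
  by field; rewrite ?z0 ?s0' ?two0.
apply: pr_eq; rewrite qder_gen /k /sx /=; move: (ux rho) u0 s0' => z z0 s0';
by field; rewrite ?z0 ?s0' ?two0.
Qed.

Lemma tr_fox_glue0 l : \tr (fox rho (glued l) [:: (0, false)]) =
  2 * (l`_0 * e + l`_1 * u).
Proof.
rewrite fox_gen // row_glue0 sl2mx_pr.
have <- : ev (qgen m (0, false)) = rho 0 by rewrite (ev_gen det_rho tr_rho) reval1.
by rewrite -evM tr_ev // /sx /=; move: (ux rho) => z; ring.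
Qed.

Lemma tr_fox_glue1 l : \tr (fox rho (glued l) [:: (1, false)]) =
  2 * (l`_3 * e - l`_4 * u).
Proof.
rewrite fox_gen // row_glue1 sl2mx_pr.
have <- : ev (qgen m (1, false)) = rho 1 by rewrite (ev_gen det_rho tr_rho) reval1.
by rewrite -evM tr_ev // /sx /=; move: (ux rho) => z; ring.
Qed.

End Frame1.

Section Coordinates.

Variable R : realType.
Local Notation C := R[i].

Definition rows3 (x y z : 'rV[C]_3) : 'M[C]_3 :=
  \matrix_(i < 3) nth 0 [:: x; y; z] i.

(** The determinant in the basis e1, e2, e3 is an invariant triple product. *)
Lemma det_rows3 (x y z : 'rV[C]_3) : \det (rows3 x y z) =
  - 2^-1 * \tr (sl2mx x * (sl2mx y * sl2mx z - sl2mx z * sl2mx y)).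
Proof.
have -> : rows3 x y z = mxrows 3 [:: [:: x 0 0; x 0 1; x 0 2];
    [:: y 0 0; y 0 1; y 0 2]; [:: z 0 0; z 0 1; z 0 2]].
  apply/matrixP => i j; rewrite !mxE.
  by case: (ord3P i) => ->; case: (ord3P j) => -> /=.
have sb (A B : 'M[C]_2) i j : (A - B) i j = A i j - B i j by rewrite !mxE.
rewrite det_mxrows3 trmx2E !mulmx2E !sb !mulmx2E !sl2mxE.
move: (x 0 0) (x 0 1) (x 0 2) (y 0 0) (y 0 1) (y 0 2) (z 0 0) (z 0 1) (z 0 2).
by move=> *; field.
Qed.

Definition spread (w : 'rV[C]_(3 + 3)) : cochain C 3 1 :=
  \matrix_(j < 2) if j == 0 then lsubmx w else rsubmx w.

Fact spread_linear : linear spread.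
Proof.
move=> k x y; apply/matrixP => i j; rewrite !mxE.
by case: (i == 0); rewrite !mxE.
Qed.

HB.instance Definition _ := GRing.isLinear.Build C 'rV[C]_(3 + 3) (cochain C 3 1)
  *:%R spread spread_linear.

(** The passage from the coordinates at the cells to those of [mxvec].  Its
    determinant is a constant factor of the torsion, the same for all
    representations. *)
Definition vec1_mx : 'M[C]_(3 + 3) := lin1_mx (mxvec \o spread).
Definition vec2_mx : 'M[C]_3 := lin1_mx (mxvec : 'M[C]_(1, 3) -> 'rV[C]_(1 * 3)).

Lemma mul_vec1_mx w : w *m vec1_mx = mxvec (spread w).
Proof. by rewrite mul_rV_lin1. Qed.

Lemma mul_vec2_mx (w : 'rV[C]_3) : w *m vec2_mx = mxvec (w : 'M[C]_(1, 3)).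
Proof. by rewrite mul_rV_lin1. Qed.

Lemma det_vec1_mx : \det vec1_mx != 0.
Proof.
apply/det0P => -[w w0]; rewrite mul_vec1_mx => h; case/eqP: w0.
have h' : spread w = 0 by apply: (can_inj mxvecK); rewrite h linear0.
apply/rowP => j; rewrite [RHS]mxE.
case: (split_ordP j) => k ->.
  by move/matrixP/(_ 0 k): h'; rewrite !mxE.
by move/matrixP/(_ 1 k): h'; rewrite !mxE.
Qed.

Lemma det_vec2_mx : \det vec2_mx != 0.
Proof.
apply/det0P => -[w w0]; rewrite mul_vec2_mx => h; case/eqP: w0.
by apply: (can_inj (@mxvecK _ 1 3)); rewrite h linear0.
Qed.

Lemma transition_det0 (x y z : 'rV[C]_3) :
  transition_det (i := 0) ([:: x; y; z] : seq (cochain C 3 0)) =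
  \det (rows3 x y z) * \det vec2_mx.
Proof.
rewrite /transition_det -det_mulmx; congr (\det _); apply/row_matrixP => i.
by rewrite rowK row_mul rowK mul_vec2_mx; case: (ord3P i) => ->.
Qed.

Lemma transition_det2 (x y z : 'rV[C]_3) :
  transition_det (i := 2) ([:: x; y; z] : seq (cochain C 3 2)) =
  \det (rows3 x y z) * \det vec2_mx.
Proof. exact: transition_det0. Qed.

End Coordinates.

(** * Bases of cochains *)

Section FreeFamilies.

Variables (F : fieldType) (d : nat).

Lemma free_transition_det i (s : seq (cochain F d i)) :
  size s = (cells i * d)%N -> transition_det s != 0 -> free s.
Proof.
move=> ss ds; rewrite -[s]/(tval (in_tuple s)); apply/freeP => k k0 j.
have kV : \sum_(l < cells i * d) k (cast_ord (esym ss) l) *: mxvec s`_l = 0.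
  rewrite (reindex (cast_ord ss)) /=; last first.
    by exists (cast_ord (esym ss)) => l _; rewrite ?cast_ordK ?cast_ordKV.
  under eq_bigr => l _ do rewrite cast_ordK -linearZ.
  by rewrite -linear_sum k0 linear0.
pose c := \row_l k (cast_ord (esym ss) l).
have c0 : c = 0.
  apply/eqP; apply: contraNT ds => c0; apply/det0P; exists c => //.
  rewrite mulmx_sum_row -[RHS]kV; apply: eq_bigr => l _.
  by rewrite rowK mxE.
move/rowP/(_ (cast_ord ss j)): c0.
by rewrite !mxE cast_ordK.
Qed.

Lemma basis_transition_det i (s : seq (cochain F d i)) :
  size s = (cells i * d)%N -> transition_det s != 0 -> basis_of fullv s.
Proof.
move=> ss ds; rewrite basisEfree free_transition_det // subvf /= dimvf ss.
exact: leqnn.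
Qed.

Lemma limg_basis (V W : vectType F) (f : 'Hom(V, W)) X : free (map f X) ->
  (forall v, f v \in <<map f X>>%VS) -> basis_of (limg f) (map f X).
Proof.
move=> fX h; rewrite /basis_of fX andbT eqEsubv; apply/andP; split.
  by apply/span_subvP => _ /mapP[x _ ->]; rewrite memv_img ?memvf.
by apply/subvP => _ /memv_imgP[v _ ->].
Qed.

Variable act : word -> {linear 'rV[F]_d -> 'rV[F]_d}.
Variable r : word.

Lemma delta_high i x : delta act r i.+2 x = 0.
Proof. by rewrite lfunE. Qed.

Lemma limg_delta_high i : limg (delta act r i.+2) = 0%VS.
Proof.
apply/eqP; rewrite -subv0; apply/subvP => _ /memv_imgP[v _ ->].
by rewrite delta_high mem0v.
Qed.

(** A coboundary is a principal crossed homomorphism. *)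
Lemma eval1_delta0 (act_nil : forall x, act [::] x = x)
    (act_cons : forall a v x, act (a :: v) x = act [:: a] (act v x))
    (act_inv : forall j x, act [:: (j, true)] (act [:: (j, false)] x) = x) v y :
  eval1 act v (delta act r 0 y) = act v (row 0 y) - row 0 y.
Proof.
have row_delta j : row j (delta act r 0 y) = act [:: (j, false)] (row 0 y) - row 0 y.
  by rewrite lfunE /= rowK.
move: (row 0 y) row_delta => z row_delta.
elim: v => [|[j b] v IH] /=; first by rewrite act_nil subrr.
rewrite IH row_delta (act_cons (j, b) v) !linearB.
case: b => /=; last by rewrite addrC subrKA.
by rewrite act_inv opprK addrC [- z + _]addrC subrKA.
Qed.

End FreeFamilies.

Section CochainComplex.

Variable R : realType.
Local Notation C := R[i].
Variable rho : rep R.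
Hypothesis det_rho : forall j, \det (rho j) = 1.
Local Notation act := (adjoint_action rho).
Local Notation rv := (reval rho).

Variable r : word.
Hypothesis rel : rv r = 1.

Lemma eval1_coboundary v (y : 'rV[C]_3) :
  eval1 act v (delta act r 0 (y : cochain C 3 0)) = Ad rho v y - y.
Proof.
have act_nil (x : 'rV[C]_3) : act [::] x = x by exact: Ad_nil.
have act_cons a v' (x : 'rV[C]_3) : act (a :: v') x = act [:: a] (act v' x).
  exact: (Ad_cat det_rho [:: a] v').
have act_inv j (x : 'rV[C]_3) : act [:: (j, true)] (act [:: (j, false)] x) = x.
  apply: etrans (esym (Ad_cat det_rho _ _ _)) _ => /=.
  apply: (can_inj (@sl2rvK R)); rewrite (sl2mx_Ad det_rho).
  by rewrite !reval_cons reval_nil /= mulr1 mulVr ?rho_unit // invr1 mulr1 mul1r.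
have := eval1_delta0 r act_nil act_cons act_inv v (y : cochain C 3 0).
by have -> : row 0 (y : cochain C 3 0) = y by apply/rowP => k; rewrite !mxE.
Qed.

Lemma delta1E x : row 0 (delta act r 1 x) = eval1 act r x.
Proof. by rewrite lfunE /= rowK. Qed.

Lemma sl2mx_delta1 x : sl2mx (row 0 (delta act r 1 x)) = fox rho x r.
Proof. by rewrite delta1E /fox rel mulr1. Qed.

Lemma delta_delta (y : cochain C 3 0) : delta act r 1 (delta act r 0 y) = 0.
Proof.
have -> : y = (row 0 y : cochain C 3 0).
  by apply/rowP => k; rewrite !mxE.
apply/row_matrixP => j; rewrite (ord1 j) delta1E eval1_coboundary.
apply: (can_inj (@sl2rvK R)); rewrite linearB /= (sl2mx_Ad det_rho) rel.
by rewrite mul1r invr1 mulr1 subrr row0 linear0.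
Qed.

Lemma tr_fox_delta0 (y : cochain C 3 0) j :
  \tr (fox rho (delta act r 0 y) [:: (j, false)]) = 0.
Proof.
have -> : y = (row 0 y : cochain C 3 0).
  by apply/rowP => k; rewrite !mxE.
rewrite fox_gen // delta0E linearB /= (sl2mx_Ad det_rho) reval1 /=.
rewrite mulrBl mulrVK ?rho_unit // linearB /= mxtraceC subrr //.
Qed.

End CochainComplex.

(** * Determinants of the adjoint complex *)

(** The vector triple product of sl_2. *)
Lemma triple_bracket (F : fieldType) (A B D X : 'M[F]_2) :
  \tr A = 0 -> \tr B = 0 -> \tr D = 0 -> \tr X = 0 ->
  \tr (A * ((B * D - D * B) * X - X * (B * D - D * B))) =
  2 * (\tr (D * X) * \tr (A * B) - \tr (B * X) * \tr (A * D)).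
Proof.
have sb (M M' : 'M[F]_2) i j : (M - M') i j = M i j - M' i j by rewrite !mxE.
have tr0 (M : 'M[F]_2) : \tr M = 0 -> M 1 1 = - M 0 0.
  by rewrite trmx2E addrC => /eqP; rewrite addr_eq0 => /eqP.
move=> /tr0 hA /tr0 hB /tr0 hD /tr0 hX.
rewrite !trmx2E !mulmx2E !sb !mulmx2E !sb !mulmx2E hA hB hD hX.
move: (A 0 0) (A 0 1) (A 1 0) (B 0 0) (B 0 1) (B 1 0) (D 0 0) (D 0 1) (D 1 0)
  (X 0 0) (X 0 1) (X 1 0); clear.
by move=> *; ring.
Qed.

(** As f Y = [B, G], the triple product of A, Y and X is expressed by the pairings
    of A and X with B and G. *)
Lemma degree2_algebra (F : fieldType) (A X B G Y : 'M[F]_2) (m f c e : F) :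
  (2 : F) != 0 -> \tr A = 0 -> \tr X = 0 -> \tr (B - m%:M) = 0 ->
  \tr (G - m%:M) = 0 -> \tr (A * B) = - (2 * e) -> \tr (A * G) = - (2 * e) ->
  B * G - G * B = f *: Y ->
  f * (- 2^-1 * \tr (A * ((2 * c) *: Y * X - X * ((2 * c) *: Y)))) =
  - (4 * e * c) * \tr ((B - G) * X).
Proof.
move=> two0 tA tX tB tG AB AG fE.
have scl (M : 'M[F]_2) : m%:M * M = m *: M by exact: mul_scalar_mx.
have scr (M : 'M[F]_2) : M * m%:M = m *: M by exact: mul_mx_scalar.
have trace0 (M Z : 'M[F]_2) : \tr Z = 0 -> \tr (Z * (M - m%:M)) = \tr (Z * M).
  by move=> tZ; rewrite mulrBr linearB /= scr linearZ /= tZ mulr0 subr0.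
have trC (M Z : 'M[F]_2) : \tr (M * Z) = \tr (Z * M) by exact: mxtrace_mulC.
have := triple_bracket tA tB tG tX.
rewrite (trC (G - _)) (trC (B - m%:M)) !trace0 // AB AG.
have -> : (B - m%:M) * (G - m%:M) - (G - m%:M) * (B - m%:M) = f *: Y.
  rewrite -fE !mulrBl !mulrBr !scl !scr.
  move: (B * G) (G * B) => M1 M2; clear.
  by apply: mx2P; rewrite !mxE; ring.
rewrite -!scalerAl -!scalerAr -!scalerBr -!scalerAr !linearZ /=.
rewrite (trC (B - G)) (mulrBr X) [\tr (X * B - _)]linearB /=.
move: (\tr (A * _)) (\tr (X * B)) (\tr (X * G)) => z z1 z2 h.
transitivity (- c * (f * z)); first by field.
by rewrite h; ring.
Qed.

Section TorsionFormula.

Variable R : realType.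
Local Notation C := R[i].
Variables (p : nat) (q : int).
Hypothesis pq : schubert_normal_form p q.
Variable m : C.
Hypothesis m1 : m ^+ 2 - 1 != 0.
Variable rho : rep R.
Hypothesis gr : generic_rep p q m rho.

Let det_rho := gr_det gr.
Let tr_rho := gr_tr gr.
Let rel := gr_rel gr.
Let s0 := gr_s gr.
Let u0 := gr_u gr.

Local Notation u := (ux rho).
Local Notation s := (sx rho m).
Local Notation ev := (frame_mx rho m).
Local Notation rv := (reval rho).
Local Notation act := (adjoint_action rho).
Local Notation r := (relator p q).
Local Notation e := (m ^+ 2 - 1).
Local Notation pr := (pr rho m).
Local Notation glued := (glued rho m).
Local Notation d0 := (delta act r 0).
Local Notation d1 := (delta act r 1).

Let evM x y : ev (qmul s u x y) = ev x * ev y. Proof. exact: ev_mul. Qed.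

(** The triple product of S, N and S N is 2 s u. *)
Lemma det_pr (x1 x2 x3 y1 y2 y3 z1 z2 z3 : C) :
  \det (rows3 (pr x1 x2 x3) (pr y1 y2 y3) (pr z1 z2 z3)) =
  2 * s * u * \det (mxrows 3 [:: [:: x1; x2; x3]; [:: y1; y2; y3]; [:: z1; z2; z3]]).
Proof.
have tr3 (x y z : quat C) : \tr (ev x * (ev y * ev z - ev z * ev y)) =
    2 * qr (qmul s u x (qmul s u y z)) - 2 * qr (qmul s u x (qmul s u z y)).
  rewrite -(evM y z) -(evM z y) mulrBr -(evM x) -(evM x) linearB /=.
  by rewrite (tr_ev det_rho tr_rho) (tr_ev det_rho tr_rho).
rewrite det_rows3.
rewrite (sl2mx_pr det_rho tr_rho x1) (sl2mx_pr det_rho tr_rho y1).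
rewrite (sl2mx_pr det_rho tr_rho z1) tr3 det_mxrows3 /=.
by move: (ux rho) (sx rho m) => U S; field.
Qed.

Definition frame_coords : seq (seq C) :=
  let k := e / (2 * (e - u) * u) in
  [:: [:: 0; 0; 0; 4 * u; 4 * e; 4 * m];
      [:: 4 * u; - (4 * e); - (4 * m); 0; 0; 0];
      [:: - (2 * u * m); 2 * e * m; 2 * e; 2 * u * m; 2 * e * m; 2 * e];
      [:: 1; 0; 0; 0; 0; 0];
      [:: 0; 0; 0; 1; 0; 0];
      [:: - (m / (2 * (e - u))); k * m; k; - (m / (2 * (e - u))); - (k * m); - k]].

(** The cochains that move the trace of one meridian and fix the other. *)
Definition dir1 : cochain C 3 1 := glued [:: 1; 0; 0; 0; 0; 0].
Definition dir2 : cochain C 3 1 := glued [:: 0; 0; 0; 1; 0; 0].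

Definition frame : seq (cochain C 3 1) :=
  [:: d0 (pr 1 1 0); d0 (pr 1 (-1) 0); d0 (pr 0 0 1); dir1; dir2; tangent rho m].

Lemma frameE : frame = [seq glued l | l <- frame_coords].
Proof.
rewrite /frame (delta0_a det_rho tr_rho) (delta0_b det_rho tr_rho).
by rewrite (delta0_H det_rho tr_rho) (tangentE det_rho tr_rho s0 u0).
Qed.

Let blocks : 'M[C]_(3 + 3) :=
  block_mx (rows3 (pr 1 1 0) (pr 0 1 0) (pr 0 0 1)) 0 0
           (rows3 (pr 1 (-1) 0) (pr 0 1 0) (pr 0 0 1)).

Let mul_rows3 (a b c : C) x y z :
  (\row_(j < 3) [:: a; b; c]`_j) *m rows3 x y z = a *: x + b *: y + c *: z.
Proof.
rewrite mulmx_sum_row !big_ord_recl big_ord0 addr0 !rowK !mxE /= addrA.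
by [].
Qed.

Let mxvec_glued a b c a' b' c' : mxvec (glued [:: a; b; c; a'; b'; c']) =
  (\row_(j < 3 + 3) [:: a; b; c; a'; b'; c']`_j) *m blocks *m vec1_mx R.
Proof.
rewrite mul_vec1_mx; congr mxvec.
have -> : (\row_(j < 3 + 3) [:: a; b; c; a'; b'; c']`_j : 'rV[C]_(3 + 3)) =
    row_mx (\row_(j < 3) [:: a; b; c]`_j) (\row_(j < 3) [:: a'; b'; c']`_j).
  apply/rowP => j; rewrite mxE; case: (split_ordP j) => k ->.
    by rewrite row_mxEl mxE; case: (ord3P k) => ->.
  by rewrite row_mxEr mxE; case: (ord3P k) => ->.
rewrite mul_row_block !mulmx0 addr0 add0r !mul_rows3.
apply: cochain1P; rewrite ?row_glue0 ?row_glue1 rowK /=.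
  rewrite row_mxKl (prE rho m a) (prE rho m 1 1 0).
  move: (pr 1 0 0) (pr 0 1 0) (pr 0 0 1) => X Y Z.
  by apply/rowP => k; rewrite !mxE; ring.
rewrite row_mxKr (prE rho m a') (prE rho m 1 (-1) 0).
move: (pr 1 0 0) (pr 0 1 0) (pr 0 0 1) => X Y Z.
by apply/rowP => k; rewrite !mxE; ring.
Qed.

Let two0 : (2 : C) != 0. Proof. by rewrite pnatr_eq0. Qed.

Let sE : e - u = s. Proof. by []. Qed.

Lemma det_frame_adjoint : transition_det frame =
  128 * e ^+ 2 * (s * u) * \det (vec1_mx R).
Proof.
have -> : transition_det frame = \det (mxrows 6 frame_coords *m blocks *m vec1_mx R).
  rewrite /transition_det frameE; congr (\det _); apply/row_matrixP => k.
  rewrite rowK row_mul row_mul.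
  have -> : row k (mxrows 6 frame_coords) =
    \row_(j < 3 + 3) (nth [::] frame_coords k)`_j.
    by apply/rowP => j; rewrite !mxE.
  by case: k => [[|[|[|[|[|[|//]]]]]] hk] /=; rewrite mxvec_glued.
have db : \det blocks = 2 * s * u * (2 * s * u).
  by rewrite /blocks det_ublock !det_pr !det_mxrows3; move: (ux rho) (sx rho m) => U S; ring.
rewrite !det_mulmx db /frame_coords det_frame; move: (det_vec1_mx R) (\det _) => _ Q.
have s0' : m ^+ 2 - 1 - u != 0 := s0.
rewrite /sx; move: (ux rho) u0 s0' => z z0 s0'.
by field; rewrite ?two0 ?z0 ?s0'.
Qed.

Lemma frame_basis : basis_of fullv frame.
Proof.
apply: basis_transition_det => //; rewrite det_frame_adjoint.
apply: mulf_neq0 (det_vec1_mx R); apply: mulf_neq0; last exact: mulf_neq0 s0 u0.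
by rewrite mulf_neq0 ?pnatr_eq0 // expf_neq0.
Qed.

Local Notation Y := (Yx rho p q).
Local Notation G := (G3 p q rho).
Local Notation tg := (tangent rho m).

(** The variation of the trace of a meridian. *)
Local Notation dtr x j := (\tr (fox rho x [:: (j, false)])).

Lemma frame_dtr : [/\ dtr dir1 0 = 2 * e, dtr dir1 1 = 0, dtr dir2 0 = 0,
  dtr dir2 1 = 2 * e & dtr tg 0 = 0 /\ dtr tg 1 = 0].
Proof.
have ht := tr_tangent_gen det_rho tr_rho s0 u0.
have h0 := tr_fox_glue0 det_rho tr_rho; have h1 := tr_fox_glue1 det_rho tr_rho.
by split; [rewrite h0 | rewrite h1 | rewrite h0 | rewrite h1 | split; exact: ht];
  rewrite /= ?mul1r ?mul0r ?subr0 ?addr0 ?mulr0.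
Qed.

Definition frame0 (k0 k1 k2 : C) : cochain C 3 0 :=
  k0 *: pr 1 1 0 + k1 *: pr 1 (-1) 0 + k2 *: pr 0 0 1.

Lemma d0_frame0 k0 k1 k2 : d0 (frame0 k0 k1 k2) =
  k0 *: d0 (pr 1 1 0) + k1 *: d0 (pr 1 (-1) 0) + k2 *: d0 (pr 0 0 1).
Proof.
rewrite /frame0; move: (pr 1 1 0) (pr 1 (-1) 0) (pr 0 0 1) => y1 y2 y3.
have lin : d0 (k0 *: (y1 : cochain C 3 0) + k1 *: (y2 : cochain C 3 0) +
    k2 *: (y3 : cochain C 3 0)) = k0 *: d0 y1 + k1 *: d0 y2 + k2 *: d0 y3.
  by rewrite linearD linearD !linearZ.
exact: lin.
Qed.

Lemma tr_d1_gen x : \tr (sl2mx (row 0 (d1 x)) * rho 1) = dtr x 0 - dtr x 1.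
Proof.
apply: etrans (tr_fox_relator det_rho x (wK_conj det_rho rel)).
by rewrite (sl2mx_delta1 rel).
Qed.

Lemma tr_d1_G3 x : \tr (sl2mx (row 0 (d1 x)) * G) = dtr x 0 - dtr x 1.
Proof.
apply: etrans (tr_fox_suffix det_rho pq rel x).
by rewrite (sl2mx_delta1 rel).
Qed.

(** Every 1-cochain is a coboundary up to the three transverse directions. *)
Lemma frame_coord (x : cochain C 3 1) : exists k0 k1 k2 a b c : C,
  x = d0 (frame0 k0 k1 k2) + a *: dir1 + b *: dir2 + c *: tg.
Proof.
have := coord_basis (X := in_tuple frame) frame_basis (memvf x).
rewrite !big_ord_recl big_ord0 addr0 /= => xE.
move: (coord _ _ x) (coord _ _ x) (coord _ _ x) (coord _ _ x) (coord _ _ x)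
  (coord _ _ x) xE => c5 c4 c3 c2 c1 c0 ->.
exists c0, c1, c2, c3, c4, c5; rewrite d0_frame0.
move: (c5 *: _) (c4 *: _) (c3 *: _) (c2 *: _) (c1 *: _) (c0 *: _); clear.
by move=> *; rewrite !addrA.
Qed.

Lemma frame_span (x : cochain C 3 1) : exists (y : cochain C 3 0) (a b c : C),
  x = d0 y + a *: dir1 + b *: dir2 + c *: tg.
Proof.
by have [k0 [k1 [k2 [a [b [c ->]]]]]] := frame_coord x; exists (frame0 k0 k1 k2), a, b, c.
Qed.

Let tr_fox_comb (x0 x1 x2 x3 : cochain C 3 1) (a b c y0 y1 y2 y3 : C) v :
  \tr (fox rho x0 v) = y0 -> \tr (fox rho x1 v) = y1 ->
  \tr (fox rho x2 v) = y2 -> \tr (fox rho x3 v) = y3 ->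
  \tr (fox rho (x0 + a *: x1 + b *: x2 + c *: x3) v) = y0 + a * y1 + b * y2 + c * y3.
Proof.
have lin k x y : \tr (fox rho (x + k *: y) v) = \tr (fox rho x v) + k * \tr (fox rho y v).
  by rewrite addrC fox_linear linearP addrC.
by move=> <- <- <- <-; rewrite (lin c _ x3) (lin b _ x2) (lin a x0 x1).
Qed.

Lemma dtr_span (y : cochain C 3 0) a b c :
  dtr (d0 y + a *: dir1 + b *: dir2 + c *: tg) 0 = a * (2 * e) /\
  dtr (d0 y + a *: dir1 + b *: dir2 + c *: tg) 1 = b * (2 * e).
Proof.
have [h10 h11 h20 h21 [ht0 ht1]] := frame_dtr.
have h0 := tr_fox_delta0 det_rho r y.
split.
  apply: etrans (tr_fox_comb a b c (h0 0) h10 h20 ht0) _.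
  by rewrite add0r !mulr0 !addr0.
apply: etrans (tr_fox_comb a b c (h0 1) h11 h21 ht1) _.
by rewrite add0r !mulr0 addr0 add0r.
Qed.

Lemma dtr_cocycle x : d1 x = 0 -> dtr x 0 = dtr x 1.
Proof.
move=> dx; have := tr_d1_gen x; rewrite dx row0 linear0 mul0r mxtrace0.
by move/esym/eqP; rewrite subr_eq0 => /eqP.
Qed.

Lemma Y_neq0 : Y != 0.
Proof.
apply/eqP => Y0; have := Y_sqr det_rho tr_rho pq rel.
rewrite Y0 mul0r => /matrixP/(_ 0 0); rewrite !mxE => /esym/eqP.
by rewrite (negbTE u0).
Qed.

Lemma d1_tangent : sl2mx (row 0 (d1 tg)) = (2 * (riley p q m)^`().[u]) *: Y.
Proof. by rewrite sl2mx_delta1 // fox_tangent_relator. Qed.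

Lemma d1_tangent_neq0 : d1 tg != 0.
Proof.
apply/eqP => h; have := d1_tangent; rewrite h row0 linear0 => /esym/eqP.
rewrite scaler_eq0 (negbTE Y_neq0) orbF !mulf_eq0 (negbTE two0).
by rewrite (negbTE (gr_simple gr)).
Qed.

(** A cocycle that preserves the trace of the meridian has no component along
    [dir1] and [dir2], and none along the tangent because the root u of the Riley
    polynomial is simple. *)
Lemma restriction_injective x : d1 x = 0 -> dtr x 0 = 0 -> exists y, x = d0 y.
Proof.
move=> dx t0; have t1 := dtr_cocycle dx; rewrite t0 in t1.
have [y [a [b [c xE]]]] := frame_span x.
have [ta tb] := dtr_span y a b c.
have e0 : 2 * e != 0 by rewrite mulf_neq0.
have a0 : a = 0 by apply: (mulIf e0); rewrite mul0r -ta -xE.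
have b0 : b = 0 by apply: (mulIf e0); rewrite mul0r -tb -xE.
move: dx; rewrite xE a0 b0 !scale0r !addr0 linearD /= (delta_delta det_rho rel).
rewrite add0r linearZ => /eqP; rewrite scaler_eq0 (negbTE d1_tangent_neq0) orbF.
by move=> /eqP ->; exists y; rewrite scale0r addr0.
Qed.

Variable f : C.
Hypothesis fE : rho 1 * G - G * rho 1 = f *: Y.

(** The pairing of a 2-cochain with the boundary torus. *)
Local Notation tau x2 := (\tr ((rho 1 - G) * sl2mx (row 0 x2))).

(** The coboundary of [dir2] has prescribed pairings with g2 and g3, and that of
    the tangent is a multiple of Y, hence of [g2, g3]. *)
Lemma det_degree2 (x2 : cochain C 3 2) :
  f * \det (rows3 (row 0 (d1 dir2)) (row 0 (d1 tg)) (row 0 x2)) =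
  - (4 * e * (riley p q m)^`().[u]) * tau x2.
Proof.
set A := row 0 (d1 dir2); set X := row 0 x2.
rewrite det_rows3 d1_tangent.
set c := (riley p q m)^`().[u].
set AA := sl2mx A; set XX := sl2mx X.
have trm j : \tr (rho j - m%:M) = 0.
  by rewrite linearB /= tr_rho mxtrace_scalar mulr_natl subrr.
have trG : \tr (G - m%:M) = 0.
  by rewrite linearB /= (tr_G3 gr) mxtrace_scalar mulr_natl subrr.
have [_ _ h20 h21 _] := frame_dtr.
have AB : \tr (AA * rho 1) = - (2 * e).
  by apply: etrans (tr_d1_gen dir2) _; rewrite h20 h21 sub0r.
have AG : \tr (AA * G) = - (2 * e).
  by apply: etrans (tr_d1_G3 dir2) _; rewrite h20 h21 sub0r.
apply: degree2_algebra AB AG fE => //; exact: sl2mx_tr.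
Qed.

End TorsionFormula.

(** * Torsion of a reference lift *)

Lemma mxvec_comb (F : fieldType) a b (v0 v1 v2 v3 v4 v5 : 'M[F]_(a, b))
    (c0 c1 c2 c3 c4 c5 : F) :
  mxvec (c0 *: v0 + c1 *: v1 + c2 *: v2 + c3 *: v3 + c4 *: v4 + c5 *: v5) =
  c0 *: mxvec v0 + (c1 *: mxvec v1 + c2 *: mxvec v2) +
  (c3 *: mxvec v3 + (c4 *: mxvec v4 + c5 *: mxvec v5)).
Proof. by rewrite !linearD !linearZ /= !addrA. Qed.

Section ReferenceLift.

Variable R : realType.
Local Notation C := R[i].
Variables (p : nat) (q : int).
Hypothesis pq : schubert_normal_form p q.
Variable m : C.
Hypothesis m1 : m ^+ 2 - 1 != 0.
Variable rho : rep R.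
Hypothesis gr : generic_rep p q m rho.

Let det_rho := gr_det gr.
Let tr_rho := gr_tr gr.
Let rel := gr_rel gr.
Let s0 := gr_s gr.
Let u0 := gr_u gr.

Local Notation u := (ux rho).
Local Notation s := (sx rho m).
Local Notation act := (adjoint_action rho).
Local Notation r := (relator p q).
Local Notation e := (m ^+ 2 - 1).
Local Notation pr := (pr rho m).
Local Notation d0 := (delta act r 0).
Local Notation d1 := (delta act r 1).
Local Notation Y := (Yx rho p q).
Local Notation G := (G3 p q rho).
Local Notation tg := (tangent rho m).
Local Notation dir1 := (dir1 m rho).
Local Notation dir2 := (dir2 m rho).
Local Notation dtr x j := (\tr (fox rho x [:: (j, false)])).

Let two0 : (2 : C) != 0. Proof. by rewrite pnatr_eq0. Qed.
Let e0 : 2 * e != 0. Proof. by rewrite mulf_neq0. Qed.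

(** These lifts serve for every choice of the cocycle and of the class in degree
    2, which makes the dependence of the torsion on them explicit. *)
Definition ref_lift (i : nat) : seq (cochain C 3 i) :=
  match i with
  | 0%N => [:: pr 1 1 0; pr 1 (-1) 0; pr 0 0 1]
  | 1%N => [:: dir2; tg]
  | _ => [::]
  end.

Lemma free_d0 : free [:: d0 (pr 1 1 0); d0 (pr 1 (-1) 0); d0 (pr 0 0 1)].
Proof.
have := basis_free (frame_basis m1 gr).
rewrite -[frame _ _ _ _]/([:: d0 (pr 1 1 0); d0 (pr 1 (-1) 0); d0 (pr 0 0 1)] ++
   [:: dir1; dir2; tg]).
by move/catl_free.
Qed.

Lemma d1_dir2_tg : free [:: d1 dir2; d1 tg].
Proof.
rewrite free_cons seq1_free (d1_tangent_neq0 pq gr) andbT.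
apply/negP; rewrite span_seq1 => /vlineP[k h].
have L : \tr (sl2mx (row 0 (k *: d1 tg)) * rho 1) = 0.
  rewrite linearZ /= linearZ /= (d1_tangent pq gr) -!scalerAl !linearZ /=.
  by rewrite (mxtraceC Y) (tr_Y_gen pq gr) !mulr0.
have [_ _ h20 h21 _] := frame_dtr gr.
have := tr_d1_gen gr dir2; rewrite h L h20 h21.
by rewrite sub0r => /esym/eqP; rewrite oppr_eq0 (negbTE e0).
Qed.

Section GivenCocycle.

Variable x1 : cochain C 3 1.
Hypotheses (cx1 : d1 x1 = 0) (tx1 : dtr x1 0 != 0).

(** The cocycle has a component along [dir1], which it expresses by the other
    directions. *)
Lemma d1_dir1 : d1 dir1 \in <<[:: d1 dir2; d1 tg]>>%VS.
Proof.
have [y [a [b [c xE]]]] := frame_span m1 gr x1.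
have [ta _] := dtr_span gr y a b c.
have a0 : a != 0.
  by apply: contraNneq tx1 => a0; rewrite xE ta a0 mul0r.
move: cx1; rewrite xE !linearD !linearZ /= (delta_delta det_rho rel) add0r.
move: (d1 dir1) (d1 dir2) (d1 tg) => v1 v2 v3 h.
have -> : v1 = (- (b / a)) *: v2 + (- (c / a)) *: v3.
  apply: (scalerI a0); rewrite scalerDr !scalerA !mulrN ![a * (_ / _)]mulrC !divfK //.
  apply/eqP; rewrite -subr_eq0 -h !scaleNr; apply/eqP.
  by rewrite opprD !opprK addrA.
by rewrite memvD // memvZ // memv_span // !inE eqxx ?orbT.
Qed.

Lemma limg_d1_span x : d1 x \in <<[:: d1 dir2; d1 tg]>>%VS.
Proof.
have [y [a [b [c ->]]]] := frame_span m1 gr x.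
rewrite !linearD !linearZ /= (delta_delta det_rho rel) add0r.
by rewrite !memvD // memvZ ?d1_dir1 // memv_span // !inE eqxx ?orbT.
Qed.

Lemma ref_lift_is_lift : is_lift act r ref_lift.
Proof.
case=> [|[|i]].
- apply: (@limg_basis _ _ _ _ [:: pr 1 1 0; pr 1 (-1) 0; pr 0 0 1]); first exact: free_d0.
  move=> y.
  have hY : basis_of fullv ([:: pr 1 1 0; pr 1 (-1) 0; pr 0 0 1] : seq (cochain C 3 0)).
    apply: (@basis_transition_det _ _ 0) => //.
    rewrite transition_det0 (det_pr gr) det_mxrows3.
    apply: mulf_neq0 (det_vec2_mx R); apply: mulf_neq0.
      exact: mulf_neq0 (mulf_neq0 two0 s0) u0.
    by rewrite (_ : _ - _ + _ = - 2) ?oppr_eq0 //; ring.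
  have := coord_basis (X := in_tuple _) hY (memvf y).
  rewrite !big_ord_recl big_ord0 addr0 /= => ->.
  rewrite !linearD !linearZ /= !memvD // memvZ // memv_span // !inE eqxx ?orbT //.
- apply: (@limg_basis _ _ _ _ [:: dir2; tg]); first exact: d1_dir2_tg.
  exact: limg_d1_span.
- by rewrite limg_delta_high basisEdim span_nil subvv dimv0.
Qed.

Lemma det_ref : transition_det [:: d0 (pr 1 1 0); d0 (pr 1 (-1) 0); d0 (pr 0 0 1);
    x1; dir2; tg] = dtr x1 0 / (2 * e) * transition_det (frame p q m rho).
Proof.
have [c0 [c1 [c2 [c3 [c4 [c5 xE]]]]]] := frame_coord m1 gr x1.
have -> : dtr x1 0 / (2 * e) = c3.
  have [ta _] := dtr_span gr (frame0 m rho c0 c1 c2) c3 c4 c5.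
  by rewrite xE ta mulfK.
rewrite d0_frame0 in xE.
rewrite /transition_det.
pose D : 'M[C]_3 := mxrows 3 [:: [:: c3; c4; c5]; [:: 0; 1; 0]; [:: 0; 0; 1]].
have dD : \det D = c3 by rewrite det_mxrows3; ring.
rewrite (@det_block_change _ 6 3 0 3 erefl (fun k => mxvec (frame p q m rho)`_k)
  (fun k => mxvec [:: d0 (pr 1 1 0); d0 (pr 1 (-1) 0); d0 (pr 0 0 1); x1; dir2; tg]`_k)
  1%:M D (fun k l => if k == 0%N then [:: c0; c1; c2]`_l else 0)).
- by rewrite det1 mul1r dD.
- move=> k; rewrite (bigD1 k) //= big1 ?addr0 => [|l /negbTE lk].
    by rewrite mxE eqxx scale1r; case: (ord3P k) => ->.
  by rewrite mxE eq_sym lk scale0r.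
- by [].
- move=> k; rewrite !big_ord_recl !big_ord0 !addr0 !mxE.
  case: (ord3P k) => -> /=; rewrite ?scale0r ?add0r ?scale1r ?addr0 //.
  rewrite xE.
  exact (@mxvec_comb _ 2 3 (d0 (pr 1 1 0)) (d0 (pr 1 (-1) 0)) (d0 (pr 0 0 1)) dir1 dir2 tg c0 c1 c2 c3 c4 c5).
Qed.

Variable f : C.
Hypothesis fE : rho 1 * G - G * rho 1 = f *: Y.

(** The factors m^2 - 1 and s u cancel between the three degrees; what remains of
    the representation is the derivative of the Riley polynomial, f, and the
    normalizations of the two classes. *)
Lemma tor_ref_lift (x2 : cochain C 3 2) :
  f * tor_of act r (hseq x1 x2) ref_lift =
  (riley p q m)^`().[u] * \tr ((rho 1 - G) * sl2mx (row 0 x2)) *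
    (\det (vec2_mx R) ^+ 2 / \det (vec1_mx R)) / (4 * dtr x1 0).
Proof.
rewrite tor_ofE.
set T0 := transition_det _; set T1 := transition_det _; set T2 := transition_det _.
have T0E : T0 = - (4 * (s * u) * \det (vec2_mx R)).
  rewrite /T0 transition_det0 (det_pr gr) det_mxrows3.
  by move: (ux rho) (sx rho m) (\det _) => U S Q; ring.
have T1E : T1 = 64 * e * (s * u) * dtr x1 0 * \det (vec1_mx R).
  transitivity (dtr x1 0 / (2 * e) * transition_det (frame p q m rho)); first exact: det_ref.
  rewrite (det_frame_adjoint gr).
  move: (\tr _) (\det _) (s * u) => t Q z; field; exact: m1.
have T2E : T2 = \det (rows3 (row 0 (d1 dir2)) (row 0 (d1 tg)) (row 0 x2)) * \det (vec2_mx R).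
  rewrite -transition_det2; congr transition_det.
  have rowE (x : cochain C 3 2) : row 0 x = x by apply/rowP => k; rewrite !mxE.
  by rewrite !rowE.
have fT2 : f * T2 = - (4 * e * (riley p q m)^`().[u]) *
    \tr ((rho 1 - G) * sl2mx (row 0 x2)) * \det (vec2_mx R).
  by rewrite T2E mulrA (det_degree2 pq gr fE).
clear T2E.
have -> : f * (T0 * T1^-1 * T2) = T0 * (f * T2) / T1.
  by rewrite -mulrA (mulrCA f) (mulrCA f) mulrA mulrAC.
have su0 : s * u != 0 by exact: mulf_neq0 s0 u0.
rewrite fT2 T0E T1E; have Q60 := det_vec1_mx R.
move: tx1 Q60 su0; move: (dtr x1 0) (\det (vec1_mx R)) (s * u) (\det (vec2_mx R)) (\tr _) (_.[u]).
move=> t Q su Q' t2 r1 t0 Q0 su0.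
by field; rewrite t0 Q0 su0 m1.
Qed.

End GivenCocycle.

End ReferenceLift.

(** * Pairing with the boundary *)

Section BoundaryPairing.

Variable R : realType.
Local Notation C := R[i].
Variables (p : nat) (q : int).
Hypothesis pq : schubert_normal_form p q.
Variable m : C.
Hypothesis m1 : m ^+ 2 - 1 != 0.
Variable rho : rep R.
Hypothesis gr : generic_rep p q m rho.

Let det_rho := gr_det gr.
Let tr_rho := gr_tr gr.
Let rel := gr_rel gr.

Local Notation rv := (reval rho).
Local Notation act := (adjoint_action rho).
Local Notation r := (relator p q).
Local Notation w := (wK p q).
Local Notation e := (m ^+ 2 - 1).
Local Notation G := (G3 p q rho).
Local Notation dtr x j := (\tr (fox rho x [:: (j, false)])).
Local Notation tau x2 := (\tr ((rho 1 - G) * sl2mx (row 0 x2))).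

Let scl (M : 'M[C]_2) : m%:M * M = m *: M. Proof. exact: mul_scalar_mx. Qed.
Let scr (M : 'M[C]_2) : M * m%:M = m *: M. Proof. exact: mul_mx_scalar. Qed.

(** The traceless part of the meridian g1, an invariant vector. *)
Definition axis : 'M[C]_2 := rho 0 - m%:M.

Lemma tr_axis : \tr axis = 0.
Proof. by rewrite /axis linearB /= tr_rho mxtrace_scalar mulr_natl subrr. Qed.

Lemma axis_sqr : axis * axis = e%:M.
Proof.
rewrite (sqr_traceless tr_axis); congr (_%:M).
rewrite /axis mulrBl !mulrBr scl !scr !linearB /= !linearZ /=.
rewrite (tr_sqr det_rho tr_rho) tr_rho mxtrace_scalar.
have scE (x y : C) : x *: (y : C^o) = x * y by [].
by rewrite !scE; field.
Qed.

Lemma axis_neq0 : axis != 0.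
Proof.
apply/eqP => h; have := axis_sqr; rewrite h mul0r => /matrixP/(_ 0 0).
by rewrite !mxE => /esym/eqP; rewrite (negbTE m1).
Qed.

Lemma invariant_axis (P : 'rV[C]_3) : Ad rho [:: g1] P = P ->
  exists l, sl2mx P = l *: axis.
Proof.
move=> /(congr1 (@sl2mx R)); rewrite (sl2mx_Ad det_rho) reval1 /=.
have u0 := rho_unit det_rho 0.
move=> /(congr1 (fun X => X * rho 0)); rewrite mulrVK //.
set X := sl2mx P => h.
have tX : \tr X = 0 by exact: sl2mx_tr.
have com : axis * X = X * axis by rewrite /axis mulrBl mulrBr scl scr h.
have := sl2_anticomm tr_axis tX; rewrite com => h2.
exists (\tr (X * axis) / 2 / e); apply: (scalerI m1).
have XA : X * axis = (\tr (X * axis) / 2)%:M.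
  rewrite mulrC -scale_scalar_mx -h2.
  by move: (X * axis) => Z; apply: mx2P; rewrite !mxE; field.
have <- : X * axis * axis = e *: X.
  by rewrite -mulrA axis_sqr; exact: mul_mx_scalar.
by rewrite {1}XA scalerA (mulrC e) divfK //; exact: mul_scalar_mx.
Qed.

Let tr_traceless (M Z : 'M[C]_2) : \tr Z = 0 -> \tr (Z * (M - m%:M)) = \tr (Z * M).
Proof. by move=> tZ; rewrite mulrBr scr linearB /= linearZ /= tZ mulr0 subr0. Qed.

Variables (P : 'rV[C]_3) (l : C).
Hypothesis PE : sl2mx P = l *: axis.

Lemma killing_eval1 x : killing P (eval1 act [:: g1] x) = 4 * (l * dtr x 0).
Proof.
have -> : eval1 act [:: g1] x = row 0 x by rewrite /= linear0 addr0.
rewrite killingE PE (fox_gen rho) -scalerAl linearZ /=; congr (_ * (_ * _)).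
by rewrite mxtraceC tr_traceless // sl2mx_tr.
Qed.

Lemma killing_Ad (v : word) (g X : 'M[C]_2) (x : 'rV[C]_3) :
  rv v * g = rho 0 * rv v -> sl2mx x = X ->
  killing P (Ad rho v x) = 4 * (l * \tr (X * g)).
Proof.
move=> hg xX; have uv := reval_unit det_rho v.
rewrite killingE PE (sl2mx_Ad det_rho) xX -scalerAl linearZ /=; congr (_ * (_ * _)).
have tX : \tr X = 0 by rewrite -xX sl2mx_tr.
have ag : axis * rv v = rv v * (g - m%:M).
  by rewrite mulrBr mulrBl hg scl scr.
have -> : axis * (rv v * X * (rv v)^-1) = rv v * ((g - m%:M) * X) * (rv v)^-1.
  by rewrite !mulrA ag.
by rewrite (mxtrace_conj _ uv) (mxtraceC _ X) tr_traceless.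
Qed.

(** [rev w] conjugates g2 to g1 and the suffix conjugates g3 to g1, so that the
    pairing with the torus is the pairing with g2 - g3. *)
Lemma killing_torus (x2 : cochain C 3 2) :
  killing P (eval2 act (torus_chain p q) x2) = 4 * (l * tau x2).
Proof.
set X := row 0 x2.
have -> : eval2 act (torus_chain p q) x2 =
    Ad rho (rev w) X - Ad rho (torus_suffix p q) X.
  by rewrite /eval2 !big_cons big_nil addr0.
have hG : rv (torus_suffix p q) * G = rho 0 * rv (torus_suffix p q).
  by rewrite /G3 -mulrA mulVKr // (reval_unit det_rho).
apply: etrans (killingBr _ _ _) _.
have kw := killing_Ad (rev_wK_conj det_rho pq rel) (erefl (sl2mx X)).
have kv := killing_Ad hG (erefl (sl2mx X)).
apply: etrans (congr2 (fun a b => a - b) kw kv) _.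
rewrite (mxtraceC _ (sl2mx X)) mulrBr linearB /=.
by move: (\tr _) (\tr _) => a b; ring.
Qed.

End BoundaryPairing.

(** * The value of the torsion *)

Section LiftExistence.

Variables (F : fieldType) (d : nat).
Variable act : word -> {linear 'rV[F]_d -> 'rV[F]_d}.
Variable r : word.

Local Notation cc i := (cochain F d i).
Local Notation dl := (delta act r).

Lemma lift_exists : exists b : forall i, seq (cc i), is_lift act r b.
Proof.
exists (fun i => [seq (dl i)^-1%VF y | y <- vbasis (limg (dl i))]) => i.
rewrite -map_comp map_id_in; first exact: vbasisP.
by move=> y /vbasis_mem /limg_lfunVK.
Qed.

Lemma tor_exists h : exists t, is_tor act r h t.
Proof.
have [b hb] := lift_exists; exists (tor_of act r h b).
by exists b; split.
Qed.

Lemma is_torE h b t : cohomology_basis act r h -> is_lift act r b ->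
  is_tor act r h t -> t = tor_of act r h b.
Proof. by move=> hh hb [b' [hb' ->]]; apply: etrans (tor_of_unique hh hb hb'). Qed.

Lemma dimH_cohomology_basis h i : cohomology_basis act r h ->
  dimH act r i = size (h i).
Proof.
move=> hh; rewrite /dimH -(size_basis_seq (hh i)) size_cat.
by rewrite (size_basis_seq (vbasisP _)) addKn.
Qed.

Lemma basis_cocycles_of_full (h b : forall i, seq (cc i)) i : is_lift act r b ->
  (forall x, x \in delta_prev act r b i ++ h i -> dl i x = 0) ->
  basis_of fullv (delta_prev act r b i ++ h i ++ b i) ->
  basis_of (cocycles act r i) (delta_prev act r b i ++ h i).
Proof.
move=> hb hz; rewrite catA => hfull.
have sfull := size_basis_seq hfull; rewrite basisEfree.
have /catl_free -> /= := basis_free hfull; apply/andP; split.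
  by apply/span_subvP => x /hz; exact: delta_sqr_cocycle.
have := limg_ker_dim (dl i) fullv; rewrite capfv -sfull size_cat.
by rewrite (size_lift i hb) => /eqP; rewrite eqn_add2r => /eqP <-.
Qed.

Lemma cohomology_basis_of_full (h b : forall i, seq (cc i)) : is_lift act r b ->
  (forall i x, x \in delta_prev act r b i ++ h i -> dl i x = 0) ->
  (forall i, basis_of fullv (delta_prev act r b i ++ h i ++ b i)) ->
  cohomology_basis act r h.
Proof.
move=> hb hz hfull i; apply: (basis_exchange (delta_prev_basis i hb) (vbasisP _)).
exact: basis_cocycles_of_full hb (hz i) (hfull i).
Qed.

End LiftExistence.

Section TorsionValue.

Variable R : realType.
Local Notation C := R[i].
Variables (p : nat) (q : int).
Hypothesis pq : schubert_normal_form p q.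
Variable m : C.
Hypothesis m1 : m ^+ 2 - 1 != 0.
Variable rho : rep R.
Hypothesis gr : generic_rep p q m rho.
Variable f : C.
Hypothesis fE : rho 1 * G3 p q rho - G3 p q rho * rho 1 = f *: Yx rho p q.

Let det_rho := gr_det gr.
Let tr_rho := gr_tr gr.
Let rel := gr_rel gr.

Local Notation rv := (reval rho).
Local Notation act := (adjoint_action rho).
Local Notation r := (relator p q).
Local Notation w := (wK p q).
Local Notation e := (m ^+ 2 - 1).
Local Notation G := (G3 p q rho).
Local Notation Y := (Yx rho p q).
Local Notation u := (ux rho).
Local Notation s := (sx rho m).
Local Notation pr := (pr rho m).
Local Notation d0 := (delta act r 0).
Local Notation d1 := (delta act r 1).
Local Notation tg := (tangent rho m).
Local Notation dir1 := (dir1 m rho).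
Local Notation dir2 := (dir2 m rho).
Local Notation axis := (axis m rho).
Local Notation dtr x j := (\tr (fox rho x [:: (j, false)])).
Local Notation tau x2 := (\tr ((rho 1 - G) * sl2mx (row 0 x2))).
Local Notation lift := (ref_lift m rho).

Definition tor_const : C := \det (vec2_mx R) ^+ 2 / \det (vec1_mx R) / 4.

Lemma tor_const_neq0 : tor_const != 0.
Proof.
have h3 := det_vec2_mx R; have h6 := det_vec1_mx R.
by rewrite !mulf_neq0 ?invr_neq0 ?expf_neq0 // pnatr_eq0.
Qed.

Let two0 : (2 : C) != 0. Proof. by rewrite pnatr_eq0. Qed.

(** The scale of the invariant vector enters through the normalizations of both
    classes, once in the numerator and once in the denominator. *)
Lemma torsion_value (P : 'rV[C]_3) (x1 : cochain C 3 1) (x2 : cochain C 3 2) t :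
  Ad rho [:: g1] P = P ->
  cohomology_basis act r (hseq x1 x2) ->
  killing P (eval1 act [:: g1] x1) = 1 ->
  killing P (eval2 act (torus_chain p q) x2) = 1 ->
  is_tor act r (hseq x1 x2) t ->
  f * t = (riley p q m)^`().[u] * tor_const.
Proof.
move=> /(invariant_axis m1 gr)[l PE] hh.
rewrite (killing_eval1 PE) (killing_torus pq gr PE) => h1 h2.
have cx1 : d1 x1 = 0.
  have : x1 \in cocycles act r 1.
    by apply: (basis_mem (hh 1%N)); rewrite mem_cat mem_head orbT.
  by rewrite memv_ker => /eqP.
have l0 : 4 * l != 0.
  by apply: contraTneq (oner_neq0 C) => l0; rewrite -h1 mulrA l0 mul0r eqxx.
have t1 : dtr x1 0 = (4 * l)^-1 by apply: (mulfI l0); rewrite -mulrA h1 mulfV.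
have t2 : tau x2 = (4 * l)^-1 by apply: (mulfI l0); rewrite -mulrA h2 mulfV.
have tx1 : dtr x1 0 != 0 by rewrite t1 invr_neq0.
move=> /(is_torE hh (ref_lift_is_lift pq m1 gr cx1 tx1)) ->.
rewrite (tor_ref_lift pq m1 gr tx1 fE) t1 t2 /tor_const.
move: (4 * l) l0 (\det (vec1_mx R)) (det_vec1_mx R) (\det (vec2_mx R)) (_.[u]) => k k0 x x0 y z.
by field; rewrite k0 x0.
Qed.

Hypothesis f0 : f != 0.

Let uY : u != 0 := gr_u gr.

(** Such a vector commutes with [g2, g3] = f Y. *)
Lemma orthogonal_Y (B : 'M[C]_2) : \tr B = 0 -> \tr (B * rho 1) = 0 ->
  \tr (B * G) = 0 -> exists k, B = k *: Y.
Proof.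
move=> tB h1 h2.
have scr (M : 'M[C]_2) : M * m%:M = m *: M by exact: mul_mx_scalar.
have scl (M : 'M[C]_2) : m%:M * M = m *: M by exact: mul_scalar_mx.
have anti (X : 'M[C]_2) : \tr X = 2 * m -> \tr (B * X) = 0 ->
    (X - m%:M) * B = - (B * (X - m%:M)).
  move=> tX tBX; apply/eqP; rewrite -addr_eq0; apply/eqP.
  have tX0 : \tr (X - m%:M) = 0.
    by rewrite linearB /= tX mxtrace_scalar mulr_natl subrr.
  rewrite (sl2_anticomm tX0 tB) (mxtraceC (X - _)) mulrBr scr linearB /= linearZ /=.
  by rewrite tB tBX mulr0 subr0 -scalemx1 scale0r.
have com : (rho 1 - m%:M) * (G - m%:M) - (G - m%:M) * (rho 1 - m%:M) = f *: Y.
  rewrite -fE !mulrBl !mulrBr !scl !scr.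
  move: (rho 1 * G) (G * rho 1) (rho 1) G => D E A A'.
  by apply: mx2P; rewrite !mxE; ring.
have := bracket_anticomm (anti _ (tr_rho 1) h1) (anti _ (tr_G3 gr) h2).
rewrite com -scalerAl -scalerAr => /(scalerI f0) cY.
have YY := Y_sqr det_rho tr_rho pq rel.
have BY : B * Y = (\tr (B * Y) / 2)%:M.
  have := sl2_anticomm tB (tr_Y det_rho tr_rho uY pq rel).
  rewrite cY => h.
  by rewrite mulrC -scale_scalar_mx -h; move: (B * Y) => Z; apply: mx2P; rewrite !mxE; field.
exists (\tr (B * Y) / 2 / u); apply: (scalerI uY).
have <- : B * Y * Y = u *: B by rewrite -mulrA YY; exact: mul_mx_scalar.
by rewrite {1}BY scalerA (mulrC u) divfK //; exact: mul_scalar_mx.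
Qed.

(** [dir1 + dir2] varies the two traces equally; therefore its coboundary is
    orthogonal to g2 and g3, and is compensated by a multiple of the tangent. *)
Lemma cocycle_exists k : exists2 x1, d1 x1 = 0 & dtr x1 0 = k.
Proof.
pose D := dir1 + dir2.
have lin v c x y : \tr (fox rho (x + c *: y) v) = \tr (fox rho x v) + c * \tr (fox rho y v).
  by rewrite addrC fox_linear linearP addrC.
have [h10 h11 h20 h21 [ht0 ht1]] := frame_dtr gr.
have D0 : dtr D 0 = 2 * e by rewrite /D -[dir2]scale1r lin h10 h20 mulr0 addr0.
have D1 : dtr D 1 = 2 * e by rewrite /D -[dir2]scale1r lin h11 h21 mul1r add0r.
have B1 : \tr (sl2mx (row 0 (d1 D)) * rho 1) = 0.
  by rewrite (tr_d1_gen gr D) D0 D1 subrr.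
have BG : \tr (sl2mx (row 0 (d1 D)) * G) = 0.
  by rewrite (tr_d1_G3 pq gr D) D0 D1 subrr.
have [c cE] := orthogonal_Y (sl2mx_tr _) B1 BG.
have e0 : 2 * e != 0 by rewrite mulf_neq0.
set r1 := (riley p q m)^`().[u].
have r10 : 2 * r1 != 0 by rewrite mulf_neq0 // (gr_simple gr).
have dD : d1 D = (c / (2 * r1)) *: d1 tg.
  apply/row_matrixP => j; rewrite (ord1 j) linearZ /=.
  apply: (can_inj (@sl2rvK R)); rewrite linearZ /= (d1_tangent pq gr) cE scalerA.
  by rewrite divfK.
pose a := k / (2 * e).
have [dt _] := dtr_span gr 0 a a (- (a * (c / (2 * r1)))).
exists (d0 0 + a *: dir1 + a *: dir2 + - (a * (c / (2 * r1))) *: tg);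
  last by apply: etrans dt _; rewrite divfK.
have lin2 (x y z v : cochain C 3 1) c1 c2 c3 :
    d1 (x + c1 *: y + c2 *: z + c3 *: v) =
    d1 x + c1 *: d1 y + c2 *: d1 z + c3 *: d1 v by rewrite !linearD !linearZ.
have dD2 : d1 dir1 + d1 dir2 = (c / (2 * r1)) *: d1 tg by rewrite -linearD.
rewrite lin2 (delta_delta det_rho rel) add0r -scalerDr dD2 scalerA -scalerDl subrr.
exact: scale0r.
Qed.

(** Since f is nonzero, g2 and g3 are different. *)
Lemma tau_exists k : exists x2 : cochain C 3 2, tau x2 = k.
Proof.
set D := rho 1 - G.
have D0 : D != 0.
  apply: contraNneq f0 => /eqP; rewrite subr_eq0 => /eqP h.
  have := fE; rewrite h subrr => /esym/eqP; rewrite scaler_eq0.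
  by rewrite (negbTE (Y_neq0 pq gr)) orbF.
have tD : D 1 1 = - D 0 0.
  apply/eqP; rewrite -addr_eq0 addrC -trmx2E /D linearB /= tr_rho (tr_G3 gr).
  by rewrite subrr.
pose v (a b c : C) : 'rV[C]_3 := \row_j [:: a; b; c]`_j.
have tv a b c : \tr (D * sl2mx (row 0 (v a b c : cochain C 3 2))) =
    2 * D 0 0 * b + D 0 1 * c + D 1 0 * a.
  have -> : sl2mx (row 0 (v a b c : cochain C 3 2)) =
      \matrix_(i, j) (if i == 0 then if j == 0 then b else a
                              else if j == 0 then c else - b).
    by apply: mx2P; rewrite !mxE.
  rewrite trmx2E !mulmx2E tD; move: (D 0 0) (D 0 1) (D 1 0) => x y z.
  by rewrite !mxE /=; ring.
have [z0|z0] := eqVneq (D 0 0) 0; last first.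
  exists (v 0 (k / (2 * D 0 0)) 0); rewrite tv !mulr0 !addr0 mulrC divfK //.
  exact: mulf_neq0.
have [z1|z1] := eqVneq (D 0 1) 0; last first.
  by exists (v 0 0 (k / D 0 1)); rewrite tv !mulr0 add0r addr0 mulrC divfK.
have z2 : D 1 0 != 0.
  apply: contraNneq D0 => z2; apply/eqP; apply: mx2P; rewrite [RHS]mxE //.
  by rewrite tD z0 oppr0.
by exists (v (k / D 1 0) 0 0); rewrite tv !mulr0 !add0r mulrC divfK.
Qed.

Let com v := GRing.comm (rv v) (rho 0).

Let com_cat v1 v2 : com v1 -> com v2 -> com (v1 ++ v2).
Proof.
move=> h1 h2; rewrite /com (reval_cat rho).
by apply: commr_sym; apply: commrM; apply: commr_sym.
Qed.

Let com_wexp v n : com v -> com (wexp v n).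
Proof.
have com_nseq v' k : com v' -> com (flatten (nseq k v')).
  move=> h; elim: k => [|k IH]; last exact: com_cat.
  by rewrite /com (reval_nil rho); apply: commr_sym; exact: commr1.
move=> h; case: n => k; apply: com_nseq => //.
rewrite /com (reval_winv det_rho); apply: commr_sym; apply: commrV.
exact: commr_sym.
Qed.

Lemma peripheral_comm a b : GRing.comm (rv (peripheral p q a b)) (rho 0).
Proof.
have c1 : com [:: g1] by rewrite /com reval1; exact: commr_refl.
apply: com_cat; first exact: com_wexp.
apply: com_wexp; rewrite /longitude catA; apply: com_cat; last exact: com_wexp.
rewrite /com /GRing.comm (reval_cat rho) -mulrA (wK_conj det_rho rel) mulrA (rev_wK_conj det_rho pq rel).
by rewrite mulrA.
Qed.

Lemma torsion_exists : exists (P : 'rV[C]_3) x1 x2 t,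
  [/\ P != 0 /\ (forall a b : int, Ad rho (peripheral p q a b) P = P),
      cohomology_basis act r (hseq x1 x2),
      killing P (eval1 act [:: g1] x1) = 1 /\
      killing P (eval2 act (torus_chain p q) x2) = 1
    & is_tor act r (hseq x1 x2) t].
Proof.
have four0 : (4 : C) != 0 by rewrite pnatr_eq0.
have [x1 cx1 t1] := cocycle_exists 4^-1; have [x2 t2] := tau_exists 4^-1.
pose P := sl2rv axis.
have PE : sl2mx P = 1 *: axis by rewrite scale1r sl2mxK // (tr_axis gr).
have tx1 : dtr x1 0 != 0 by rewrite t1 invr_neq0.
have hl := ref_lift_is_lift pq m1 gr cx1 tx1.
have hh : cohomology_basis act r (hseq x1 x2).
  apply: (cohomology_basis_of_full hl).
    case=> [|[|i]] x; rewrite ?in_nil //; last by move=> _; exact: delta_high.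
    rewrite mem_cat => /orP[|]; last by rewrite inE => /eqP ->.
    by case/mapP => y _ ->; exact: (delta_delta det_rho rel y).
  case=> [|[|[|i]]].
  - apply: (@basis_transition_det _ _ 0) => //.
    rewrite transition_det0 (det_pr gr) det_mxrows3.
    apply: mulf_neq0 (det_vec2_mx R); apply: mulf_neq0.
      exact: mulf_neq0 (mulf_neq0 two0 (gr_s gr)) uY.
    by rewrite (_ : _ - _ + _ = - 2) ?oppr_eq0 //; ring.
  - apply: (@basis_transition_det _ _ 1) => //.
    have -> := det_ref m1 gr x1.
    have e0 : 2 * e != 0 by rewrite mulf_neq0.
    have k0 : (128 : C) * e ^+ 2 != 0 by rewrite mulf_neq0 ?expf_neq0 // pnatr_eq0.
    rewrite (det_frame_adjoint gr).
    apply: mulf_neq0; first by rewrite mulf_neq0 ?invr_neq0.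
    exact: mulf_neq0 (mulf_neq0 k0 (mulf_neq0 (gr_s gr) uY)) (det_vec1_mx R).
  - apply: (@basis_transition_det _ _ 2) => //.
    have -> : [seq d1 x | x <- [:: dir2; tg]] ++ [:: x2] ++ [::] =
      [:: d1 dir2; d1 tg; x2] by [].
    rewrite (transition_det2 (d1 dir2) (d1 tg) x2) mulf_neq0 ?det_vec2_mx //.
    have rowE (x : cochain C 3 2) : row 0 x = x by apply/rowP => k; rewrite !mxE.
    apply: contraNneq f0 => T0; have := det_degree2 pq gr fE x2.
    rewrite !rowE T0 mulr0 -[sl2mx x2](congr1 (@sl2mx R) (rowE x2)) t2 => /esym/eqP.
    by rewrite !mulf_eq0 oppr_eq0 !mulf_eq0 invr_eq0 (negbTE four0) (negbTE m1)
      (negbTE (gr_simple gr)).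
  - rewrite basisEfree nil_free subvf dimvf.
    by [].
have u0 := rho_unit det_rho 0.
exists P, x1, x2, (tor_of act r (hseq x1 x2) lift); split=> //.
- split.
    apply: contraNneq (axis_neq0 m1 gr) => P0.
    by rewrite -[axis]scale1r -PE P0 linear0.
  move=> a b; apply: (can_inj (@sl2rvK R)); rewrite (sl2mx_Ad det_rho) PE scale1r.
  have : GRing.comm (rv (peripheral p q a b)) axis.
    apply: commrB; first exact: peripheral_comm.
    exact: comm_mx_scalar.
  by move=> ->; rewrite mulrK // (reval_unit det_rho).
- rewrite (killing_eval1 PE) (killing_torus pq gr PE) t1 t2 mul1r mulfV //.
- by exists lift.
Qed.

End TorsionValue.

(** * Sums of residues *)

Section Lagrange.

Variable F : closedFieldType.

Lemma separable_roots (P : {poly F}) : coprimep P P^`() ->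
  exists2 rs : seq F, uniq rs & P = lead_coef P *: \prod_(a <- rs) ('X - a%:P).
Proof.
move=> cP; have [rs PE] := closed_field_poly_normal P; exists rs => //.
have P0 : lead_coef P != 0.
  rewrite lead_coef_eq0; apply: contraTneq cP => ->.
  by rewrite deriv0 coprime0p -size_poly_eq1 size_poly0.
rewrite -separable.separable_prod_XsubC separable.separable_poly.unlock.
by move: cP; rewrite {1 2}PE derivZ coprimepZl // coprimepZr.
Qed.

(** The sum of the residues of g / P vanishes when g / P decays quadratically at
    infinity: it is the leading coefficient of the Lagrange interpolant of g at
    the roots of P. *)
Lemma sum_residues (P g : {poly F}) (rs : seq F) : uniq rs -> P != 0 ->
  P = lead_coef P *: \prod_(a <- rs) ('X - a%:P) -> (size g < size rs)%N ->
  (forall a, a \in rs -> P^`().[a] != 0) ->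
  \sum_(a <- rs) g.[a] / P^`().[a] = 0.
Proof.
move=> urs P0 PE sg dP.
have rP a : a \in rs -> root P a.
  by move=> ars; rewrite PE rootZ ?lead_coef_eq0 // root_prod_XsubC.
have sP : size P = (size rs).+1.
  by rewrite PE size_scale ?lead_coef_eq0 // size_prod_XsubC.
pose Q a := P %/ ('X - a%:P).
have QE a : a \in rs -> P = Q a * ('X - a%:P).
  by move=> ars; rewrite divpK // dvdp_XsubCl rP.
have sQ a : a \in rs -> size (Q a) = size rs.
  by move=> ars; rewrite size_divp ?polyXsubC_eq0 // sP size_XsubC subn1.
have lQ a : a \in rs -> (Q a)`_(size rs).-1 = lead_coef P.
  by move=> ars; rewrite [in RHS](QE a ars) lead_coef_Mmonic ?monicXsubC // lead_coefE sQ.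
have Qa a : a \in rs -> (Q a).[a] = P^`().[a].
  by move=> ars; rewrite [in RHS](QE a ars) derivM derivXsubC !hornerE subrr mulr0 add0r.
have Qb a b : a \in rs -> b \in rs -> b != a -> (Q a).[b] = 0.
  move=> ars brs ba; have := rP b brs; rewrite rootE (QE a ars) !hornerE mulf_eq0.
  by rewrite subr_eq0 (negbTE ba) orbF => /eqP.
pose L := \sum_(a <- rs) (g.[a] / P^`().[a]) *: Q a.
have Lg : L = g.
  apply/eqP; rewrite -subr_eq0; apply/eqP; apply: (roots_geq_poly_eq0 (rs := rs)) => //.
    apply/allP => b brs; rewrite rootE hornerD hornerN /L horner_sum.
    rewrite (bigD1_seq b) //= hornerZ Qa // divfK ?dP // big_seq_cond big1 ?addr0 ?subrr //.
    by move=> a /andP[ars ab]; rewrite hornerZ Qb ?mulr0 // eq_sym.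
  apply: leq_trans (size_polyD _ _) _; rewrite size_polyN geq_max (ltnW sg) andbT.
  rewrite /L big_seq; apply: leq_trans (size_sum _ _ _) _.
  by apply/bigmax_leqP_seq => a _ ars; apply: leq_trans (size_scale_leq _ _) _; rewrite sQ.
have : L`_(size rs).-1 = 0 by rewrite Lg nth_default //; move: sg; case: (size rs).
rewrite /L coef_sum big_seq (eq_bigr (fun a => g.[a] / P^`().[a] * lead_coef P)).
  rewrite -big_seq -mulr_suml => /eqP; rewrite mulf_eq0 lead_coef_eq0 (negbTE P0) orbF.
  by move/eqP.
by move=> a ars; rewrite coefZ lQ.
Qed.

End Lagrange.

(** * The fibre of the trace of the meridian *)

Section Characters.

Variable R : realType.
Local Notation C := R[i].
Variables (p : nat) (q : int).
Hypothesis pq : schubert_normal_form p q.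
Variable m : C.
Hypothesis m1 : m ^+ 2 - 1 != 0.
Hypothesis cop : coprimep (riley p q m) (riley p q m)^`().
Hypothesis r0 : (riley p q m).[0] != 0.
Hypothesis r1 : (riley p q m).[m ^+ 2 - 1] != 0.

(** Two equal meridians have a common eigenvector. *)
Lemma irreducible_gen_neq (rho : rep R) : (forall j, \det (rho j) = 1) ->
  irreducible rho -> rho 0 != rho 1.
Proof.
move=> det_rho irr; apply/eqP => h01.
have [a /eigenvalueP[v va v0]] := eigenvalue_closed (rho 0)^T (isT : (0 < 2)%N).
have vE : rho 0 *m v^T = a *: v^T by rewrite -[rho 0]trmxK -trmx_mul va linearZ.
have vT0 : v^T != 0 by rewrite trmx_eq0.
have genE j : rho j *m v^T = a *: v^T by case: (ord2P j) => ->; rewrite -?h01.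
have wE w : exists b, reval rho w *m v^T = b *: v^T.
  elim: w => [|[j e] w [b bE]]; first by exists 1; rewrite reval_nil mul1mx scale1r.
  rewrite reval_cons -[_ * _]/(_ *m _) -mulmxA bE -scalemxAr; case: e => /=; last first.
    by exists (b * a); rewrite genE scalerA.
  exists (b * (\tr (rho j) - a)).
  by rewrite (mx2_inv (det_rho j)) mulmxBl genE mul_scalar_mx -scalerBl scalerA.
have : <[v^T]>%VS = 0%VS \/ <[v^T]>%VS = fullv.
  apply: irr => w x /vlineP[k ->]; have [b bE] := wE w.
  by rewrite -scalemxAr bE scalerA memvZ // memv_line.
case=> /(congr1 (fun U : {vspace 'cV[C]_2} => \dim U)); rewrite dim_vline vT0.
  by rewrite dimv0.
by rewrite dimvf.
Qed.

(** A common eigenvector of S and N is killed by S N + N S = 0, whereas S and N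
    are invertible. *)
Lemma generic_irreducible rho : generic_rep p q m rho -> irreducible rho.
Proof.
move=> gr U hU; have tr_rho := gr_tr gr; have det_rho := gr_det gr.
have [U0|U0] := eqVneq (\dim U) 0%N; first by left; apply/eqP; rewrite -dimv_eq0 U0.
have [U2|U2] := eqVneq (\dim U) 2%N; first by right; apply/eqP; rewrite eqEdim subvf dimvf U2.
have U1 : \dim U = 1%N.
  by have := dimvS (subvf U); rewrite dimvf; case: (\dim U) U0 U2 => [|[|[|k]]].
pose v := vpick U.
have v0 : v != 0 by rewrite vpick0 -dimv_eq0 U1.
have UE : U = <[v]>%VS.
  by apply/eqP; rewrite eq_sym eqEdim -memvE memv_pick U1 dim_vline v0.
have gU j : rho j *m v \in U by have := hU [:: (j, false)] v (memv_pick U); rewrite reval1.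
have /vlineP[a aE] : Sx rho m *m v \in <[v]>%VS.
  rewrite -UE /Sx mulmxBl -scalemxAl mulmxDl mul_scalar_mx.
  by rewrite memvB // memvZ // ?memvD // memv_pick.
have /vlineP[b bE] : Nx rho *m v \in <[v]>%VS.
  by rewrite -UE /Nx -scalemxAl mulmxBl memvZ // memvB.
have sqr (A : 'M[C]_2) k c : A * A = k%:M -> A *m v = c *: v -> k = c * c.
  move=> AA Av; have : k *: v = (c * c) *: v.
    rewrite -mul_scalar_mx -AA -[A * A]/(A *m A) -mulmxA Av -scalemxAr Av scalerA //.
  by move/eqP; rewrite -subr_eq0 -scalerBl scaler_eq0 (negbTE v0) orbF subr_eq0 => /eqP.
have sE := sqr _ _ _ (SSx det_rho tr_rho) aE.
have uE := sqr _ _ _ (NNx tr_rho) bE.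
have := congr1 (fun A => A *m v) (NSx det_rho tr_rho).
rewrite -[_ * _]/(_ *m _) -[X in - X]/(_ *m _) mulNmx -!mulmxA aE bE -!scalemxAr aE bE.
rewrite !scalerA [b * a]mulrC => /eqP; rewrite -addr_eq0 -scalerDl scaler_eq0 (negbTE v0) orbF.
rewrite -mulr2n -mulr_natl !mulf_eq0 pnatr_eq0 /= => /orP[] /eqP z0.
  by have := gr_s gr; rewrite sE z0 mul0r eqxx.
by have := gr_u gr; rewrite uE z0 mul0r eqxx.
Qed.

Lemma irreducible_generic rho : is_rep p q rho -> irreducible rho ->
  \tr (rho 0) = 2 * m -> generic_rep p q m rho.
Proof.
move=> [det_rho rel] irr t0; have h01 := irreducible_gen_neq det_rho irr.
have wE := (relator_conj det_rho p q).1 rel.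
have uw := reval_unit det_rho (wK p q).
have tr_rho j : \tr (rho j) = 2 * m.
  case: (ord2P j) => -> //; rewrite -t0 -(mxtrace_conj (rho 0) uw).
  by rewrite wE mulrK.
have N0 : Nx rho != 0.
  by rewrite /Nx scaler_eq0 invr_eq0 pnatr_eq0 /= subr_eq0.
have ru : (riley p q m).[ux rho] = 0.
  have := riley_eq det_rho tr_rho pq; rewrite wE subrr => /esym/eqP.
  by rewrite scaler_eq0 (negbTE N0) orbF mulf_eq0 pnatr_eq0 /= => /eqP.
split=> //.
- by apply: contraNneq r1; rewrite /sx => /eqP; rewrite subr_eq0 => /eqP ->; rewrite ru.
- by apply: contraNneq r0 => u0; move: ru; rewrite u0 => ->.
- by apply: (coprimep_root cop); rewrite rootE ru.
Qed.

(** The character of the representation with a given value of u. *)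
Definition riley_character (u : C) : word -> C :=
  fun v => 2 * qr (qword (m ^+ 2 - 1 - u) u m v).

Lemma generic_character rho : generic_rep p q m rho ->
  character rho = riley_character (ux rho).
Proof.
move=> gr; apply/funext => v.
by rewrite /character -(ev_word (gr_det gr) (gr_tr gr)) (tr_ev (gr_det gr) (gr_tr gr)).
Qed.

Lemma riley_character_inj : injective riley_character.
Proof.
move=> u u' /(congr1 (fun chi : word -> C => chi [:: g1; g2])).
have two0 : (2 : C) != 0 by rewrite pnatr_eq0.
rewrite /riley_character => /(mulfI two0) /= h; apply: (mulfI two0).
apply/eqP; rewrite -subr_eq0; apply/eqP; move/esym/eqP: h; rewrite -subr_eq0 => /eqP h.
by rewrite -[RHS]h; ring.
Qed.

(** S is taken diagonal and N antidiagonal. *)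
Lemma generic_rep_exists u : root (riley p q m) u ->
  exists2 rho, generic_rep p q m rho & ux rho = u.
Proof.
move=> ru; set a := sqrtC (m ^+ 2 - 1 - u).
have aa : a * a = m ^+ 2 - 1 - u by rewrite -expr2 sqrtCK.
clearbody a; have u'E : u = m ^+ 2 - 1 - a * a by rewrite aa; ring.
pose S : 'M[C]_2 := \matrix_(i, j) (if i == j then if i == 0 then a else - a else 0).
pose N : 'M[C]_2 := \matrix_(i, j) (if i == j then 0 else if i == 0 then u else 1).
pose rho (j : 'I_2) := m%:M + S + (if j == 0 then N else - N).
have mE i j : (m%:M : 'M[C]_2) i j = if i == j then m else 0.
  by rewrite mxE; case: (i == j).
have det_rho j : \det (rho j) = 1.
  rewrite det2E /rho; case: (ord2P j) => ->; rewrite !mxE /= ?mulr1n ?mulr0n;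
    by rewrite [X in _ - X]mulrC u'E; ring.
have tr_rho j : \tr (rho j) = 2 * m.
  by rewrite trmx2E /rho; case: (ord2P j) => ->; rewrite !mxE /= ?mulr1n ?mulr0n; ring.
have NE : Nx rho = N.
  by rewrite /Nx /rho; apply: mx2P; rewrite !mxE /= ?mulr1n ?mulr0n; field.
have uE : ux rho = u.
  by rewrite /ux NE trmx2E !mulmx2E !mxE /=; field.
exists rho => //; split=> //.
- apply: contraNneq r1; rewrite /sx uE => /eqP; rewrite subr_eq0 => /eqP ->.
  exact/eqP/rootP.
- by rewrite uE; apply: contraNneq r0 => u0; move/rootP: ru; rewrite u0 => ->.
- apply/(relator_conj det_rho); apply/eqP; rewrite -subr_eq0.
  by rewrite (riley_eq det_rho tr_rho pq) uE (rootP ru) mulr0 scale0r.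
- by rewrite uE; apply: (coprimep_root cop).
Qed.

Lemma generic_root rho : generic_rep p q m rho -> root (riley p q m) (ux rho).
Proof.
move=> gr; apply/rootP; apply: (riley_root (gr_det gr) (gr_tr gr) (gr_u gr) pq (gr_rel gr)).
Qed.

Lemma fibreE (rs : seq C) : (forall u, root (riley p q m) u = (u \in rs)) ->
  fibre p q (2 * m) = riley_character @` [set` rs].
Proof.
move=> rsE; apply/seteqP; split=> [chi [[rho [hrho irr ->]] /= t0]|_ [u urs <-]].
  have t : \tr (rho 0) = 2 * m by rewrite -t0 /tr_mu /character reval1.
  have gr := irreducible_generic hrho irr t.
  exists (ux rho); last by rewrite generic_character.
  by rewrite /= -rsE generic_root.
have [rho gr uE] : exists2 rho, generic_rep p q m rho & ux rho = u.
  by apply: generic_rep_exists; rewrite rsE.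
rewrite -uE -(generic_character gr); split.
  exists rho; split=> //; last exact: generic_irreducible.
  by split; [exact: gr_det gr | exact: gr_rel gr].
by rewrite /= /tr_mu /character reval1 (gr_tr gr).
Qed.

Lemma generic_mu_regular rho : generic_rep p q m rho -> mu_regular p q rho.
Proof.
move=> gr; have det_rho := gr_det gr; have tr_rho := gr_tr gr; have rel := gr_rel gr.
split.
- by split.
- exact: generic_irreducible.
- move=> x; rewrite memv_ker => /eqP dx [y].
  have -> : eval1 (adjoint_action rho) [:: g1] x = row 0 x by rewrite /= linear0 addr0.
  move=> xE; have dt : \tr (fox rho x [:: (0, false)]) = 0.
    rewrite (fox_gen rho) xE linearB /= (sl2mx_Ad det_rho) reval1 mulrBl.
    by rewrite mulrVK ?rho_unit // linearB /= mxtraceC subrr.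
  have [z ->] := restriction_injective pq m1 gr dx dt.
  by rewrite /= memv_img ?memvf.
- have t2 : \tr (rho 0) ^+ 2 != 4.
    rewrite tr_rho -subr_eq0 (_ : _ - _ = 4 * (m ^+ 2 - 1)); last by ring.
    by rewrite mulf_neq0 // pnatr_eq0.
  move=> _; rewrite reval1 /=; split=> h; move: t2; rewrite h ?linearN /= mxtrace1.
    by rewrite -natrX eqxx.
  by rewrite sqrrN -natrX eqxx.
Qed.

End Characters.

(** * The sum of the inverse torsions *)

Section Sum.

Variable R : realType.
Local Notation C := R[i].
Variables (p : nat) (q : int).
Hypothesis pq : schubert_normal_form p q.
Variable hR : forall i, seq (cochain R 1 i).
Hypothesis hhR : homology_orientation p q hR.

Definition regular_parity : nat :=
  \sum_(j < 3) ((\sum_(i < j.+1) \dim {: cochain C 3 i})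
                * (\sum_(i < j.+1) size (@hseq R 0%R 0%R i)))%N.

Lemma tor_parity_regular rho (x1 : cochain C 3 1) (x2 : cochain C 3 2) :
  cohomology_basis (adjoint_action rho) (relator p q) (hseq x1 x2) ->
  tor_parity (adjoint_action rho) (relator p q) = regular_parity.
Proof.
move=> hh; apply: eq_bigr => j _; congr (_ * _)%N; apply: eq_bigr => i _.
by rewrite (dimH_cohomology_basis i hh); case: (i : nat) => [|[|[|k]]].
Qed.

(** The dimensions of the cohomology, and with them the parity, are the same for
    all representations that have classes h^1 and h^2 as above. *)
Lemma sign_regular : exists eps : R, forall rho x1 x2,
  cohomology_basis (adjoint_action rho) (relator p q) (hseq x1 x2) ->
  forall e, is_sign p q hR rho e <-> e = eps.
Proof.
have [t ht] := tor_exists (trivial_action R) (relator p q) hR.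
exists ((-1) ^+ regular_parity *
  Num.sg ((-1) ^+ tor_parity (trivial_action R) (relator p q) * t)).
move=> rho x1 x2 hh e; rewrite /is_sign (tor_parity_regular hh).
split=> [[t' ht' ->]| ->]; last by exists t.
have [b hb] := lift_exists (trivial_action R) (relator p q).
by rewrite (is_torE hhR hb ht) (is_torE hhR hb ht').
Qed.

Variable m : C.
Hypothesis m1 : m ^+ 2 - 1 != 0.
Hypothesis cop : coprimep (riley p q m) (riley p q m)^`().
Hypothesis r0 : (riley p q m).[0] != 0.
Hypothesis r1 : (riley p q m).[m ^+ 2 - 1] != 0.

Variable F : {poly C}.
Hypothesis FE : forall rho, generic_rep p q m rho ->
  rho 1 * G3 p q rho - G3 p q rho * rho 1 = F.[ux rho] *: Yx rho p q.

(** At a root of F the classes could not be normalized, so that the torsion takes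
    its default value 0 and both sides vanish. *)
Lemma adjoint_torsion_inv : exists k : C, forall u, root (riley p q m) u ->
  (adjoint_torsion p q hR (riley_character m u))^-1 =
  k * (F.[u] / (riley p q m)^`().[u]).
Proof.
have [eps epsE] := sign_regular.
exists ((real_complex R eps)^-1 / tor_const R) => u ru.
have K0 := tor_const_neq0 R.
have r'0 : (riley p q m)^`().[u] != 0 by exact: (coprimep_root cop).
set T := [set t | exists rho, [/\ mu_regular p q rho,
  riley_character m u = character rho & is_adjoint_torsion p q hR rho t]].
have [[t Tt]|noT] := pselect (exists t, T t).
  have [rho [[hrho irr _ _] chiE]] := xgetPex 0 (ex_intro _ t Tt).
  have t0 : \tr (rho 0) = 2 * m.
    have := congr1 (fun chi : word -> C => chi [:: g1]) chiE.
    rewrite /character reval1 /riley_character /= => <-.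
    by rewrite !(mulr0, addr0, subr0, mulr1).
  have gr := irreducible_generic pq cop r0 r1 hrho irr t0.
  have uE : ux rho = u.
    by apply: (@riley_character_inj R m); rewrite -(generic_character gr).
  rewrite /adjoint_torsion -/T.
  move=> [P [x1 [x2 [e [t1 [[_ hP] hh [h1 h2] [/(epsE _ _ _ hh) -> htor] ->]]]]]].
  have := torsion_value pq m1 gr (FE gr) (hP 1 0) hh h1 h2 htor.
  rewrite uE; move: (_^`().[u]) r'0 F.[u] => rd rd0 f E.
  move: (tor_const R) K0 E => K K0 E.
  have f0 : f != 0.
    by apply: contraTneq (mulf_neq0 rd0 K0) => f0; rewrite -E f0 mul0r eqxx.
  have -> : t1 = rd * K / f by rewrite -E mulrC mulKf.
  rewrite invfM; move: (real_complex R eps)^-1 => k.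
  by field; rewrite K0 rd0 f0.
have F0 : F.[u] = 0.
  apply/eqP/negPn/negP => f0; apply: noT.
  have [rho gr uE] := generic_rep_exists pq cop r0 r1 ru.
  rewrite -uE in f0.
  have [P [x1 [x2 [t [hP hh hk ht]]]]] := torsion_exists pq m1 gr (FE gr) f0.
  exists (real_complex R eps * t), rho; split.
  - exact: (generic_mu_regular pq m1 gr).
  - by rewrite -uE (generic_character gr).
  - exists P, x1, x2, eps, t; split=> //; split=> //.
    exact/(epsE _ _ _ hh).
rewrite F0 mul0r mulr0 /adjoint_torsion -/T xgetPN ?invr0 // => t Tt.
by apply: noT; exists t.
Qed.

Lemma sum_adjoint_torsion_inv : (size F <= p./2.-1)%N -> (1 < p)%N ->
  size (riley p q m) = p./2.+1 ->
  finite_set (fibre p q (2 * m)) /\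
  \sum_(chi \in fibre p q (2 * m)) (adjoint_torsion p q hR chi)^-1 = 0.
Proof.
move=> sF p1 sr; have rn0 : riley p q m != 0 by rewrite -size_poly_gt0 sr.
have [rs urs rE] := separable_roots cop.
have rsE u : root (riley p q m) u = (u \in rs).
  by rewrite rE rootZ ?lead_coef_eq0 // root_prod_XsubC.
have [k kE] := adjoint_torsion_inv.
rewrite (fibreE pq cop r0 r1 rsE); split; first exact/finite_image/finite_seq.
rewrite fsbig_image; last by move=> x y _ _; exact: riley_character_inj.
rewrite -(fsbig_seq _ _ urs) big_seq.
under eq_bigr => u urs' do rewrite kE ?rsE //.
rewrite -big_seq -mulr_sumr (sum_residues urs rn0 rE) ?mulr0 //.
  have : size (riley p q m) = (size rs).+1.
    by rewrite {1}rE size_scale ?lead_coef_eq0 // size_prod_XsubC.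
  by rewrite sr => -[<-]; apply: leq_ltn_trans sF _; lia.
by move=> a ars; apply: (coprimep_root cop); rewrite rsE.
Qed.

End Sum.

Theorem theorem1p2 (R : realType) (p : nat) (q : int)
    (hK : hyperbolic_two_bridge p q)
    (hR : forall i, seq (cochain R 1 i))
    (hhR : homology_orientation p q hR) :
  exists2 S : set R[i], finite_set S &
    forall c : R[i], ~ S c ->
      [/\ finite_set (fibre p q c),
          (forall rho : rep R, is_rep p q rho -> irreducible rho ->
             tr_mu (character rho) = c -> mu_regular p q rho)
        & \sum_(chi \in fibre p q c) (adjoint_torsion p q hR chi)^-1 = 0].
Proof.
have [pq q1 qN1] := hK.
have p4 : (4 < p)%N by have [] := pq; move: q1 qN1; lia.
have [E E0 hE] := riley_generic pq R[i] p4.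
have [bad EE] := closed_field_poly_normal E.
exists [set 2 * a | a in [set` bad]]; first exact/finite_image/finite_seq.
move=> c cbad; pose m := c / 2; have cE : c = 2 * m by rewrite mulrC divfK // pnatr_eq0.
have Em : E.[m] != 0.
  apply: contra_notN cbad => Em; exists m => //.
  by move: Em; rewrite -/(root E m) EE rootZ ?lead_coef_eq0 // root_prod_XsubC.
have [sr cop r0 r1] := hE m Em; rewrite -subr_eq0 => m1.
have [F sF FE] := torus_poly pq m q1 qN1.
rewrite {}cE in cbad *.
have [fin sum0] := sum_adjoint_torsion_inv pq hhR m1 cop r0 r1 FE sF (ltnW (ltnW (ltnW p4))) sr.
split=> // rho hrho irr t0.
apply: (generic_mu_regular pq m1); apply: (irreducible_generic pq cop r0 r1 hrho irr).
by rewrite -t0 /tr_mu /character reval1.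
Qed.
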